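(* Let $f(z)=\sum_{n\ge0} a_n z^{-n}\in\mathbb{C}[[z^{-1}]]$ be a Gevrey-1 formal series with Borel transform $\widetilde f(\zeta)=\sum_{n\ge1} \frac{a_n\zeta^{n-1}}{(n-1)!}$. Let $\lambda>0$ and assume that $\widetilde f$ extends holomorphically to $\Delta_\lambda$ and that there exist $A>0$, $B>0$ with $|\widetilde f(\zeta)|\le A e^{B|\zeta|}$ for all $\zeta\in\Delta_\lambda$. Put $a_n^{(\lambda)}=\lambda^{n-1}a_n$ and, for $n\ge0$, $$b_n^{(\lambda)}=\frac{1}{n!}\sum_{k=1}^{n+1}(-1)^{n-k+1}\mathfrak{s}(n,k-1)\,a_k^{(\lambda)}.$$ Then: (i) the factorial series $a_0+\lambda\sum_{n=0}^{+\infty}\frac{\Gamma(\lambda z)\Gamma(n+1)b_n^{(\lambda)}}{\Gamma(\lambda z+n+1)}$ converges absolutely for $\Re(z)>\max(B,1/\lambda)$, and its sum equals $\mathrm{S}_0 f(z)$ there; (ii) for every integer $N\ge0$ and every $z$ with $\Re(z)>B$, $$\Big|\mathrm{S}_0f(z)-\Big(a_0+\lambda\sum_{n=0}^{N}\frac{\Gamma(\lambda z)\Gamma(n+1)b_n^{(\lambda)}}{\Gamma(\lambda z+n+1)}\Big)\Big|\le R_{fact}(\lambda,A,B,N,z),$$ where $$R_{fact}(\lambda,A,B,N,z)=\frac{A}{(\lambda B)^{\lambda B}}\,\frac{(N+\lambda B+1)^{N+\lambda B+1}}{(N+1)^N}\left|\frac{\Gamma(\lambda z)\Gamma(N+1)}{\Gamma(\lambda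 z+N+1)(\Re(z)-B)}\right|.$$
   Context: $\Delta$ denotes the image of the open disc $D(1,1)=\{s:|s-1|<1\}$ under $s\mapsto-\ln s$ (principal logarithm), and $\Delta_\lambda=\{\lambda\zeta:\zeta\in\Delta\}$. A series $\sum a_n z^{-n}$ is Gevrey-1 if $|a_n|\le CK^n n!$ for some constants. The Borel sum is $\mathrm{S}_0 f(z)=a_0+\int_0^{+\infty}\widetilde f(\zeta)e^{-z\zeta}\,d\zeta$ ($\Re z>B$). Stirling numbers of the first kind: $\prod_{k=0}^{n-1}(x-k)=\sum_{k=0}^n\mathfrak{s}(n,k)x^k$. *)

(* Defs.v *)
From Stdlib Require Import Reals ZArith List.
From Coquelicot Require Import Coquelicot.
Open Scope R_scope.

Definition Cexp (z : C) : C :=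
  (exp (Re z) * cos (Im z), exp (Re z) * sin (Im z)).

Definition Carg (s : C) : R :=
  let x := Re s in let y := Im s in
  if Rlt_dec 0 x then atan (y / x)
  else if Rlt_dec x 0 then
         (if Rle_dec 0 y then atan (y / x) + PI else atan (y / x) - PI)
  else if Rlt_dec 0 y then PI / 2
  else if Rlt_dec y 0 then - (PI / 2) else 0.

Definition Clog (s : C) : C := (ln (Cmod s), Carg s).

Definition Delta (zeta : C) : Prop :=
  exists s : C, Cmod (s - 1)%C < 1 /\ zeta = Copp (Clog s).

Definition Delta_lam (lam : R) (zeta : C) : Prop :=
  exists xi : C, Delta xi /\ zeta = (RtoC lam * xi)%C.

Definition Gevrey1 (a : nat -> C) : Prop :=
  exists Cc K : R, forall n : nat, Cmod (a n) <= Cc * K ^ n * INR (fact n).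

(** Borel transform: tilde f (zeta) = sum_{n>=1} a_n zeta^(n-1)/(n-1)!  (reindexed) *)
Definition borel_term (a : nat -> C) (zeta : C) (n : nat) : C :=
  (a (S n) * Cpow zeta n / RtoC (INR (fact n)))%C.

(** Euler's Gamma function  Gamma(w) = int_0^oo t^(w-1) e^(-t) dt,
    (improper Riemann integral; used only for Re w > 0, where it converges). *)
Definition Cgamma (w : C) : C :=
  @RInt_gen C_R_CompleteNormedModule
    (fun t : R => (Cexp ((w - 1) * RtoC (ln t)) * RtoC (exp (- t)))%C)
    (at_right 0) (Rbar_locally p_infty).

(** Stirling numbers of the first kind (signed), as the coefficients of
    prod_{k=0}^{n-1} (x - k) = sum_k s(n,k) x^k.  Polynomials are coefficient
    lists (lowest degree first). *)
Fixpoint padd (p q : list Z) : list Z :=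
  match p, q with
  | nil, _ => q
  | _, nil => p
  | x :: p', y :: q' => (x + y)%Z :: padd p' q'
  end.

Definition mul_X_minus (c : Z) (p : list Z) : list Z :=
  padd (0%Z :: p) (map (fun x => (- c * x)%Z) p).

Fixpoint falling_poly (n : nat) : list Z :=
  match n with
  | O => 1%Z :: nil
  | S m => mul_X_minus (Z.of_nat m) (falling_poly m)
  end.

Definition stirling1 (n k : nat) : Z := nth k (falling_poly n) 0%Z.

Example stirling1_3 : map (stirling1 3) (seq 0 4) = (0 :: 2 :: -3 :: 1 :: nil)%Z.
Proof. reflexivity. Qed.
Example stirling1_4 : map (stirling1 4) (seq 0 5) = (0 :: -6 :: 11 :: -6 :: 1 :: nil)%Z.
Proof. reflexivity. Qed.

Fixpoint csum (f : nat -> C) (N : nat) : C :=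
  match N with
  | O => f O
  | S m => (csum f m + f (S m))%C
  end.

(** b_n^(lambda) = 1/n! sum_{k=1}^{n+1} (-1)^(n-k+1) s(n,k-1) lambda^(k-1) a_k ,
    reindexed with j = k-1 in 0..n: (-1)^(n-j) s(n,j) lambda^j a_(j+1) *)
Definition b_lam (lam : R) (a : nat -> C) (n : nat) : C :=
  (/ RtoC (INR (fact n)) *
   csum (fun j => RtoC ((-1) ^ (n - j) * IZR (stirling1 n j) * lam ^ j) * a (S j)) n)%C.

Definition fact_term (lam : R) (a : nat -> C) (z : C) (n : nat) : C :=
  (RtoC lam * (Cgamma (RtoC lam * z) * Cgamma (RtoC (INR (S n))) * b_lam lam a n)
     / Cgamma (RtoC lam * z + RtoC (INR (S n))))%C.

Definition laplace_integrand (F : C -> C) (z : C) (t : R) : C :=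
  (F (RtoC t) * Cexp (- (z * RtoC t)))%C.

Definition borel_sum (a : nat -> C) (F : C -> C) (z : C) : C :=
  (a O + @RInt_gen C_R_CompleteNormedModule (laplace_integrand F z)
                    (at_point 0) (Rbar_locally p_infty))%C.

Definition R_fact (lam A B : R) (N : nat) (z : C) : R :=
  A / Rpower (lam * B) (lam * B)
  * (Rpower (INR N + lam * B + 1) (INR N + lam * B + 1) / (INR N + 1) ^ N)
  * Cmod (Cgamma (RtoC lam * z) * Cgamma (RtoC (INR (S N)))
          / (Cgamma (RtoC lam * z + RtoC (INR (S N))) * RtoC (Re z - B)))%C.

(* Main.v *)
Require Import Defs.
From Stdlib Require Import Reals Lra Lia ZArith List Classical IndefiniteDescription.
From Coquelicot Require Import Coquelicot.
Open Scope R_scope.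

(** Substituting [s = exp (- t)] turns [F (lam t)] into [phi(s) = F (- lam log s)], holomorphic on
    the disc [|s - 1| < 1]; put [w = lam z], [beta = lam B] and [E_n(t) = s^n phi^(n)(s)]. Then
    [E_n' = - E_(n+1) - n E_n], so integrating the Laplace integral [L_n] of [E_n] at [w] by parts
    gives [(w + n) L_n + L_(n+1) = phi^(n)(1)]. Since [phi^(n)(1) = (-1)^n n! b_n] (because
    [s^n (d/ds)^n = sum_k s(n,k) (s d/ds)^k]), iterating yields the factorial series of [L_0] with
    remainder [+- L_(N+1) / (w (w+1) ... (w+N))].

    The remainder is controlled by Cauchy's estimate for [phi^(n)(s)] on the circle of radius
    [al s] about [s], where [|phi|] is at most [A exp(beta t) exp(beta |log(1 + v)|)], [|v| = al].
    Bounding [|log(1 + v)|] by [- ln (1 - al)] and taking [al = n / (n + beta)] gives (ii).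
    For (i) this is too weak: one uses instead that [exp(beta |log(1 + v)|)] is large only near
    [v = -1], so that its mean over the circle is [O((1 - al)^(1 - c))] for any [c > 1] with
    [c >= beta]. With [1 - al] of order [1 / n] this bounds [phi^(n)(1)] by a multiple of
    [c (c+1) ... (c+n-1)], and for [c < Re w] the quotients of these by [|w (w+1) ... (w+n)|] are
    summable, since those with [Re w] in place of [w] telescope. *)

Notation is_derive_C := (@is_derive C_AbsRing C_NormedModule).
Notation is_derive_path := (@is_derive R_AbsRing C_R_NormedModule).
Notation continuous_C := (@continuous C_UniformSpace C_UniformSpace).
Notation continuous_path := (@continuous R_UniformSpace C_UniformSpace).
Notation is_RInt_C := (@is_RInt C_R_NormedModule).
Notation RInt_C := (@RInt C_R_CompleteNormedModule).
Notation is_RInt_gen_C := (@is_RInt_gen C_R_NormedModule).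
Notation RInt_gen_C := (@RInt_gen C_R_CompleteNormedModule).
Notation is_series_C := (@is_series C_AbsRing C_NormedModule).

(** * Complex calculus *)

Lemma Re_le_Cmod (z : C) : Re z <= Cmod z.
Proof. eapply Rle_trans; [apply Rle_abs|apply re_le_Cmod]. Qed.

Lemma Re_ge_opp_Cmod (z : C) : - Cmod z <= Re z.
Proof. generalize (re_le_Cmod z). intros H. apply Rabs_le_between in H. lra. Qed.

Lemma C_Re_Im (z : C) : z = (RtoC (Re z) + RtoC (Im z) * Ci)%C.
Proof. destruct z. apply injective_projections; simpl; ring. Qed.

Lemma Cmod_le_Re_Im (z : C) : Cmod z <= Rabs (Re z) + Rabs (Im z).
Proof.
  rewrite (C_Re_Im z) at 1. eapply Rle_trans; [apply Cmod_triangle|].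
  rewrite Cmod_mult, Cmod_Ci, !Cmod_R. lra.
Qed.

Lemma Cmod_minus_sym (x y : C) : Cmod (x - y) = Cmod (y - x).
Proof. rewrite <- Cmod_opp. f_equal. ring. Qed.

Lemma Cmod_triangle_inv (x y : C) : Cmod x - Cmod y <= Cmod (x + y).
Proof.
  pose proof (Cmod_triangle (x + y) (- y)) as T. rewrite Cmod_opp in T.
  replace (x + y + - y)%C with x in T by ring. lra.
Qed.

Lemma Cmod_minus_triangle (x y z : C) : Cmod (x - z) <= Cmod (x - y) + Cmod (y - z).
Proof. replace (x - z)%C with ((x - y) + (y - z))%C by ring. apply Cmod_triangle. Qed.

Lemma Cmod_lt_pos (z : C) (r : R) : Cmod z < r -> 0 < r.
Proof. apply Rle_lt_trans, Cmod_ge_0. Qed.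

Lemma Re_pos_neq_0 (z : C) : 0 < Re z -> z <> 0.
Proof. intros H ->. simpl in H. lra. Qed.

Lemma norm_C_R (z : C) : @norm R_AbsRing C_R_NormedModule z = Cmod z.
Proof. symmetry. apply Cmod_norm. Qed.

Lemma is_derive_C_eps (f : C -> C) (z l : C) :
  is_derive_C f z l <->
  forall e, 0 < e -> exists d, 0 < d /\ forall y, Cmod (y - z) < d ->
    Cmod (f y - f z - (y - z) * l) <= e * Cmod (y - z).
Proof.
  split.
  - intros [_ H] e He.
    destruct (H z (fun P HP => HP) (mkposreal e He)) as [d Hd].
    exists d. split; [apply cond_pos|exact Hd].
  - intros H. split; [apply is_linear_scal_l|]. intros x Hx.
    rewrite <- (is_filter_lim_locally_unique (V := AbsRing_NormedModule C_AbsRing) _ _ Hx).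
    intros [e He]. destruct (H e He) as [d [Hd K]]. now exists (mkposreal d Hd).
Qed.

Lemma continuous_C_eps (f : C -> C) (z : C) :
  continuous_C f z <->
  forall e, 0 < e -> exists d, 0 < d /\ forall y, Cmod (y - z) < d -> Cmod (f y - f z) < e.
Proof.
  split.
  - intros H e He.
    destruct (proj1 (locally_C _ _) (H (fun y => Cmod (y - f z) < e)
      (proj2 (locally_C _ _) (ex_intro _ (mkposreal e He) (fun y Hy => Hy))))) as [d Hd].
    exists d. split; [apply cond_pos|exact Hd].
  - intros H P HP. apply locally_C in HP. destruct HP as [[e He] HP].
    destruct (H e He) as [d [Hd K]]. apply locally_C.
    exists (mkposreal d Hd). intros y Hy. apply HP, K, Hy.
Qed.

(* Complex differentiability read over [R], so that the chain rule for paths is that of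
   Frechet derivatives. *)
Lemma is_derive_C_filterdiff (f : C -> C) (z l : C) :
  is_derive_C f z l ->
  @filterdiff R_AbsRing C_R_NormedModule C_R_NormedModule f (locally z) (fun h => (h * l)%C).
Proof.
  intros [_ Hf]. split; [split|].
  - intros x y. apply Cmult_plus_distr_r.
  - intros k x. rewrite 2!(scal_R_Cmult k). symmetry. apply Cmult_assoc.
  - exists (Cmod l + 1). split; [pose proof (Cmod_ge_0 l); lra|]. intros x.
    rewrite (norm_C_R x), (norm_C_R (x * l)%C), Cmod_mult.
    pose proof (Cmod_ge_0 x). lra.
  - intros x Hx. rewrite <- (is_filter_lim_locally_unique (V := C_R_NormedModule) _ _ Hx).
    intros eps. specialize (Hf z (fun P HP => HP) eps). apply locally_C in Hf.
    eapply filter_imp; [|exact Hf]. intros y Hy. rewrite !norm_C_R. exact Hy.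
Qed.

Lemma is_derive_C_continuous (f : C -> C) (z l : C) : is_derive_C f z l -> continuous_C f z.
Proof.
  intros H. apply (@filterdiff_continuous R_AbsRing C_R_NormedModule C_R_NormedModule).
  exists (fun h => (h * l)%C). now apply is_derive_C_filterdiff.
Qed.

Lemma is_derive_path_comp (f : C -> C) (g : R -> C) (t : R) (l dg : C) :
  is_derive_C f (g t) l -> is_derive_path g t dg -> is_derive_path (fun u => f (g u)) t (dg * l)%C.
Proof.
  intros Hf Hg. eapply filterdiff_ext_lin.
  - apply (@filterdiff_comp' R_AbsRing _ C_R_NormedModule _ g f t _ _ Hg
      (is_derive_C_filterdiff _ _ _ Hf)).
  - intros y. transitivity (RtoC y * dg * l)%C.
    + now rewrite <- scal_R_Cmult.
    + rewrite <- Cmult_assoc. symmetry. apply scal_R_Cmult.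
Qed.

Lemma is_derive_path_continuous (g : R -> C) (t : R) (l : C) :
  is_derive_path g t l -> continuous_path g t.
Proof. intros H. apply (@ex_derive_continuous R_AbsRing C_R_NormedModule). now exists l. Qed.

Lemma is_derive_path_Re (f : R -> C) (t : R) (l : C) :
  is_derive_path f t l -> is_derive (fun u => Re (f u)) t (Re l).
Proof.
  intros H. exact (@filterdiff_comp' R_AbsRing _ C_R_NormedModule R_NormedModule f (@fst R R) t _ _ H
    (filterdiff_linear _ is_linear_fst)).
Qed.

Lemma is_derive_path_Im (f : R -> C) (t : R) (l : C) :
  is_derive_path f t l -> is_derive (fun u => Im (f u)) t (Im l).
Proof.
  intros H. exact (@filterdiff_comp' R_AbsRing _ C_R_NormedModule R_NormedModule f (@snd R R) t _ _ H
    (filterdiff_linear _ is_linear_snd)).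
Qed.

Lemma is_derive_path_pair (f : R -> C) (t : R) (l : C) :
  is_derive (fun u => Re (f u)) t (Re l) -> is_derive (fun u => Im (f u)) t (Im l) ->
  is_derive_path f t l.
Proof.
  intros Hr Hi.
  pose proof (@is_derive_plus R_AbsRing C_R_NormedModule _ _ _ _ _
    (@is_derive_scal_l R_AbsRing C_R_NormedModule _ _ _ (1 : C) Hr)
    (@is_derive_scal_l R_AbsRing C_R_NormedModule _ _ _ Ci Hi)) as H.
  rewrite 2!scal_R_Cmult, Cmult_1_r in H.
  rewrite (C_Re_Im l). eapply is_derive_ext; [|exact H]. intros u.
  transitivity (RtoC (Re (f u)) * 1 + RtoC (Im (f u)) * Ci)%C.
  - now rewrite <- !scal_R_Cmult.
  - rewrite Cmult_1_r. symmetry. apply C_Re_Im.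
Qed.

Lemma is_derive_path_unique (f : R -> C) (t : R) (l m : C) :
  is_derive_path f t l -> is_derive_path f t m -> l = m.
Proof.
  intros Hl Hm. apply injective_projections.
  - apply is_derive_path_Re, is_derive_unique in Hl. apply is_derive_path_Re, is_derive_unique in Hm.
    exact (eq_trans (eq_sym Hl) Hm).
  - apply is_derive_path_Im, is_derive_unique in Hl. apply is_derive_path_Im, is_derive_unique in Hm.
    exact (eq_trans (eq_sym Hl) Hm).
Qed.

Lemma is_derive_path_RtoC (f : R -> R) (t l : R) :
  is_derive f t l -> is_derive_path (fun u => RtoC (f u)) t (RtoC l).
Proof.
  intros H. apply is_derive_path_pair; [exact H|].
  exact (@is_derive_const R_AbsRing R_NormedModule 0 t).
Qed.

Lemma is_derive_path_const (c : C) (t : R) : is_derive_path (fun _ => c) t (RtoC 0).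
Proof. apply (@is_derive_const R_AbsRing C_R_NormedModule). Qed.

Lemma is_derive_path_plus (f g : R -> C) (t : R) (l m : C) :
  is_derive_path f t l -> is_derive_path g t m ->
  is_derive_path (fun u => f u + g u)%C t (l + m)%C.
Proof. apply (@is_derive_plus R_AbsRing C_R_NormedModule). Qed.

Lemma is_derive_path_mult (f g : R -> C) (t : R) (l m : C) :
  is_derive_path f t l -> is_derive_path g t m ->
  is_derive_path (fun u => f u * g u)%C t (l * g t + f t * m)%C.
Proof.
  intros Hf Hg.
  pose proof (is_derive_path_Re _ _ _ Hf) as Rf. pose proof (is_derive_path_Im _ _ _ Hf) as If.
  pose proof (is_derive_path_Re _ _ _ Hg) as Rg. pose proof (is_derive_path_Im _ _ _ Hg) as Ig.
  assert (Er : Re (l * g t + f t * m)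
    = (Re l * Re (g t) + Re (f t) * Re m) - (Im l * Im (g t) + Im (f t) * Im m))
    by (rewrite re_plus, !re_mult; ring).
  assert (Ei : Im (l * g t + f t * m)
    = (Re l * Im (g t) + Re (f t) * Im m) + (Im l * Re (g t) + Im (f t) * Re m))
    by (rewrite im_plus, !im_mult; ring).
  apply is_derive_path_pair; [rewrite Er|rewrite Ei].
  - apply (@is_derive_minus R_AbsRing R_NormedModule);
      (apply (@is_derive_mult R_AbsRing); [assumption..|exact Rmult_comm]).
  - apply (@is_derive_plus R_AbsRing R_NormedModule);
      (apply (@is_derive_mult R_AbsRing); [assumption..|exact Rmult_comm]).
Qed.

Lemma is_derive_path_scal (c : C) (f : R -> C) (t : R) (l : C) :
  is_derive_path f t l -> is_derive_path (fun u => c * f u)%C t (c * l)%C.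
Proof.
  intros H. evar_last; [apply is_derive_path_mult; [apply is_derive_path_const|exact H]|].
  cbv beta. ring.
Qed.

Lemma is_derive_path_line (z h : C) (t : R) : is_derive_path (fun u => z + RtoC u * h)%C t h.
Proof.
  evar_last.
  - apply is_derive_path_plus; [apply is_derive_path_const|].
    apply is_derive_path_mult; [apply is_derive_path_RtoC, @is_derive_id|apply is_derive_path_const].
  - unfold one; simpl. ring.
Qed.

(* Coquelicot derives products for values in [AbsRing_NormedModule K], compositions for inner
   functions with such values; both are stated here for [C_NormedModule]. *)
Lemma is_derive_C_AbsRing (f : C -> C) (z l : C) :
  is_derive_C f z l <-> @is_derive C_AbsRing (AbsRing_NormedModule C_AbsRing) f z l.
Proof. split; intros [_ H]; (split; [apply is_linear_scal_l|exact H]). Qed.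

Lemma is_derive_C_mult (f g : C -> C) (z l m : C) :
  is_derive_C f z l -> is_derive_C g z m ->
  is_derive_C (fun y => f y * g y)%C z (l * g z + f z * m)%C.
Proof.
  rewrite !is_derive_C_AbsRing. intros Hf Hg.
  exact (@is_derive_mult C_AbsRing f g z l m Hf Hg Cmult_comm).
Qed.

Lemma is_derive_C_comp (f g : C -> C) (z l m : C) :
  is_derive_C f (g z) l -> is_derive_C g z m -> is_derive_C (fun y => f (g y)) z (m * l)%C.
Proof. intros Hf Hg%is_derive_C_AbsRing. exact (is_derive_comp f g z l m Hf Hg). Qed.

Lemma is_derive_C_shift (c z : C) : is_derive_C (fun y => y + c)%C z (RtoC 1).
Proof.
  apply is_derive_C_eps. intros e He. exists 1. split; [lra|]. intros y _.
  replace (y + c - (z + c) - (y - z) * 1)%C with (RtoC 0) by ring.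
  rewrite Cmod_0. apply Rmult_le_pos; [lra|apply Cmod_ge_0].
Qed.

Lemma is_derive_C_scal (c : C) (f : C -> C) (z l : C) :
  is_derive_C f z l -> is_derive_C (fun y => c * f y)%C z (c * l)%C.
Proof.
  intros H. evar_last; [apply is_derive_C_mult; [apply @is_derive_const|exact H]|].
  unfold zero; simpl. ring.
Qed.

Lemma is_derive_C_ext_disc (f g : C -> C) (z l : C) (r : R) :
  0 < r -> (forall y, Cmod (y - z) < r -> f y = g y) -> is_derive_C f z l -> is_derive_C g z l.
Proof. intros Hr H. apply is_derive_ext_loc. now exists (mkposreal r Hr). Qed.

Lemma is_derive_C_quadratic (f : C -> C) (z l : C) (M d : R) :
  0 < d ->
  (forall y, Cmod (y - z) < d -> Cmod (f y - f z - (y - z) * l) <= M * Cmod (y - z) ^ 2) ->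
  is_derive_C f z l.
Proof.
  intros Hd H. apply is_derive_C_eps. intros e He.
  assert (HM : 0 < Rabs M + 1) by (pose proof (Rabs_pos M); lra).
  exists (Rmin d (e / (Rabs M + 1))). split.
  { apply Rmin_pos; [assumption|now apply Rdiv_lt_0_compat]. }
  intros y Hy. apply Rmin_Rgt_l in Hy. destruct Hy as [Hyd Hye].
  apply Rlt_div_r in Hye; [|exact HM].
  eapply Rle_trans; [apply (H y Hyd)|].
  pose proof (Cmod_ge_0 (y - z)). pose proof (Rle_abs M). nra.
Qed.

Lemma is_derive_C_inv (z : C) : z <> 0 -> is_derive_C Cinv z (- / (z * z))%C.
Proof.
  intros Hz. assert (P : 0 < Cmod z) by (now apply Cmod_gt_0).
  apply (is_derive_C_quadratic Cinv z _ (2 / Cmod z ^ 3) (Cmod z / 2)); [lra|].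
  intros y Hy.
  assert (Y : Cmod z / 2 < Cmod y).
  { pose proof (Cmod_triangle_inv z (y - z)) as T. replace (z + (y - z))%C with y in T by ring. lra. }
  assert (Hy0 : y <> 0) by (apply Cmod_gt_0; lra).
  replace (/ y - / z - (y - z) * - / (z * z))%C with ((y - z) * (y - z) * (/ y * / (z * z)))%C
    by (field; now split).
  rewrite !Cmod_mult, !Cmod_inv, Cmod_mult by (try apply Cmult_neq_0; assumption).
  replace (2 / Cmod z ^ 3 * Cmod (y - z) ^ 2)
    with (Cmod (y - z) * Cmod (y - z) * (/ (Cmod z / 2) * / (Cmod z * Cmod z))) by (field; lra).
  pose proof (Cmod_ge_0 (y - z)).
  apply Rmult_le_compat_l; [nra|]. apply Rmult_le_compat_r.
  - apply Rlt_le, Rinv_0_lt_compat. nra.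
  - apply Rinv_le_contravar; lra.
Qed.

Section ComplexContinuity.

Context {U : UniformSpace}.

Lemma continuous_Cplus (f g : U -> C) (x : U) :
  @continuous U C_UniformSpace f x -> @continuous U C_UniformSpace g x ->
  @continuous U C_UniformSpace (fun y => f y + g y)%C x.
Proof. apply (@continuous_plus U R_AbsRing C_R_NormedModule). Qed.

Lemma continuous_Cminus (f g : U -> C) (x : U) :
  @continuous U C_UniformSpace f x -> @continuous U C_UniformSpace g x ->
  @continuous U C_UniformSpace (fun y => f y - g y)%C x.
Proof. apply (@continuous_minus U R_AbsRing C_R_NormedModule). Qed.

Lemma continuous_Cmult (f g : U -> C) (x : U) :
  @continuous U C_UniformSpace f x -> @continuous U C_UniformSpace g x ->
  @continuous U C_UniformSpace (fun y => f y * g y)%C x.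
Proof.
  intros Hf Hg. apply (@continuous_scal U C_AbsRing C_NormedModule f g x); [|exact Hg].
  intros P HP. apply Hf, locally_C, HP.
Qed.

Lemma continuous_Cinv (f : U -> C) (x : U) :
  f x <> 0 -> @continuous U C_UniformSpace f x -> @continuous U C_UniformSpace (fun y => / f y)%C x.
Proof.
  intros Hx Hf. apply (@continuous_comp U C_UniformSpace C_UniformSpace f Cinv); [exact Hf|].
  eapply is_derive_C_continuous, is_derive_C_inv, Hx.
Qed.

Lemma continuous_Cpow (f : U -> C) (n : nat) (x : U) :
  @continuous U C_UniformSpace f x -> @continuous U C_UniformSpace (fun y => f y ^ n)%C x.
Proof.
  intros H. induction n as [|n IH]; [apply continuous_const|].
  now apply (continuous_Cmult f (fun y => f y ^ n)%C).
Qed.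

Lemma continuous_RtoC (f : U -> R) (x : U) :
  continuous f x -> @continuous U C_UniformSpace (fun y => RtoC (f y)) x.
Proof.
  intros H. apply filterlim_locally. intros e.
  generalize (proj1 (filterlim_locally _ _) H e). apply filter_imp.
  intros y Hy. split; [exact Hy|apply ball_center].
Qed.

End ComplexContinuity.

Lemma is_RInt_C_unique (f : R -> C) (a b : R) (l m : C) :
  is_RInt_C f a b l -> is_RInt_C f a b m -> l = m.
Proof.
  intros Hl Hm. rewrite <- (@is_RInt_unique C_R_CompleteNormedModule f a b l Hl).
  exact (@is_RInt_unique C_R_CompleteNormedModule f a b m Hm).
Qed.

Lemma is_RInt_C_ext (f g : R -> C) (a b : R) (l : C) :
  (forall t, f t = g t) -> is_RInt_C f a b l -> is_RInt_C g a b l.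
Proof. intros H. apply (@is_RInt_ext C_R_NormedModule). intros t _. apply H. Qed.

Lemma is_RInt_C_derive (F f : R -> C) (a b : R) :
  (forall t, Rmin a b <= t <= Rmax a b -> is_derive_path F t (f t)) ->
  (forall t, Rmin a b <= t <= Rmax a b -> continuous_path f t) ->
  is_RInt_C f a b (F b - F a)%C.
Proof. apply (@is_RInt_derive C_R_CompleteNormedModule). Qed.

Lemma RInt_C_correct (f : R -> C) (a b : R) :
  (forall t, Rmin a b <= t <= Rmax a b -> continuous_path f t) -> is_RInt_C f a b (RInt_C f a b).
Proof.
  intros H.
  apply (@RInt_correct C_R_CompleteNormedModule), (@ex_RInt_continuous C_R_CompleteNormedModule), H.
Qed.

Lemma is_RInt_C_Re (f : R -> C) (a b : R) (l : C) :
  is_RInt_C f a b l -> is_RInt (fun t => Re (f t)) a b (Re l).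
Proof. apply (@is_RInt_fct_extend_fst R_NormedModule R_NormedModule). Qed.

Lemma is_RInt_C_Im (f : R -> C) (a b : R) (l : C) :
  is_RInt_C f a b l -> is_RInt (fun t => Im (f t)) a b (Im l).
Proof. apply (@is_RInt_fct_extend_snd R_NormedModule R_NormedModule). Qed.

Lemma is_RInt_C_scal (c : C) (f : R -> C) (a b : R) (l : C) :
  is_RInt_C f a b l -> is_RInt_C (fun t => c * f t)%C a b (c * l)%C.
Proof.
  intros H. pose proof (is_RInt_C_Re _ _ _ _ H) as Hr. pose proof (is_RInt_C_Im _ _ _ _ H) as Hi.
  apply (@is_RInt_fct_extend_pair R_NormedModule R_NormedModule).
  - apply (@is_RInt_minus R_NormedModule); now apply (@is_RInt_scal R_NormedModule).
  - apply (@is_RInt_plus R_NormedModule); now apply (@is_RInt_scal R_NormedModule).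
Qed.

Lemma Cmod_RInt_le (f : R -> C) (g : R -> R) (a b : R) (l : C) (m : R) :
  a <= b -> (forall t, a <= t <= b -> Cmod (f t) <= g t) ->
  is_RInt_C f a b l -> is_RInt g a b m -> Cmod l <= m.
Proof.
  intros Hab H Hl Hm. rewrite <- norm_C_R.
  apply (@norm_RInt_le C_R_NormedModule f g a b l m Hab); [|assumption..].
  intros t Ht. rewrite norm_C_R. now apply H.
Qed.

Lemma Cmod_RInt_le_const (f : R -> C) (a b : R) (l : C) (M : R) :
  (forall t, Rmin a b <= t <= Rmax a b -> Cmod (f t) <= M) ->
  is_RInt_C f a b l -> Cmod l <= Rabs (b - a) * M.
Proof.
  intros H Hl. rewrite <- norm_C_R.
  apply (@norm_RInt_le_const_abs C_R_NormedModule f a b l M); [|assumption].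
  intros t Ht. rewrite norm_C_R. now apply H.
Qed.

Lemma Cmod_path_increment_le (g dg : R -> C) (a b L : R) :
  (forall t, Rmin a b <= t <= Rmax a b -> is_derive_path g t (dg t)) ->
  (forall t, Rmin a b <= t <= Rmax a b -> continuous_path dg t) ->
  (forall t, Rmin a b <= t <= Rmax a b -> Cmod (dg t) <= L) ->
  Cmod (g b - g a) <= Rabs (b - a) * L.
Proof.
  intros Hg Hdg HL. apply (Cmod_RInt_le_const dg); [exact HL|]. now apply is_RInt_C_derive.
Qed.

Lemma is_derive_C_lines (f g : C -> C) (z : C) (r : R) :
  0 < r ->
  (forall y, Cmod (y - z) < r -> continuous_C g y) ->
  (forall h t, Cmod h < r -> 0 <= t <= 1 ->
    is_derive_path (fun u => f (z + RtoC u * h)%C) t (h * g (z + RtoC t * h))%C) ->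
  is_derive_C f z (g z).
Proof.
  intros Hr Hg Hf. apply is_derive_C_eps. intros e He.
  assert (Hz : Cmod (z - z) < r) by (replace (z - z)%C with (RtoC 0) by ring; now rewrite Cmod_0).
  destruct (proj1 (continuous_C_eps g z) (Hg z Hz) e He) as [d [Hd Hgz]].
  exists (Rmin r d). split; [now apply Rmin_pos|]. intros y Hy. apply Rmin_Rgt_l in Hy.
  set (h := (y - z)%C) in *.
  assert (Hseg : forall t, 0 <= t <= 1 -> Cmod (z + RtoC t * h - z) <= Cmod h).
  { intros t Ht. replace (z + RtoC t * h - z)%C with (RtoC t * h)%C by ring.
    rewrite Cmod_mult, Cmod_R, Rabs_pos_eq by lra. pose proof (Cmod_ge_0 h). nra. }
  pose proof (Cmod_path_increment_le
    (fun t => f (z + RtoC t * h) - RtoC t * (h * g z))%C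
    (fun t => h * g (z + RtoC t * h) - h * g z)%C 0 1 (Cmod h * e)) as K.
  rewrite Rmin_left, Rmax_right, Rminus_0_r, Rabs_R1, Rmult_1_l in K by lra.
  replace (e * Cmod h) with (Cmod h * e) by ring.
  replace (f y - f z - h * g z)%C
    with (f (z + RtoC 1 * h) - RtoC 1 * (h * g z) - (f (z + RtoC 0 * h) - RtoC 0 * (h * g z)))%C.
  2: { replace (z + RtoC 1 * h)%C with y by (unfold h; ring).
       replace (z + RtoC 0 * h)%C with z by ring. ring. }
  apply K; intros t Ht.
  - apply (@is_derive_minus R_AbsRing C_R_NormedModule); [apply Hf; [apply Hy|exact Ht]|].
    evar_last; [apply is_derive_path_mult|].
    + apply is_derive_path_RtoC, @is_derive_id.
    + apply is_derive_path_const.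
    + unfold one; simpl. ring.
  - apply continuous_Cminus; [|apply continuous_const].
    apply continuous_Cmult; [apply continuous_const|].
    apply (@continuous_comp R_UniformSpace C_UniformSpace C_UniformSpace (fun t => z + RtoC t * h)%C g).
    + eapply is_derive_path_continuous, is_derive_path_line.
    + apply Hg. eapply Rle_lt_trans; [now apply Hseg|apply Hy].
  - replace (h * g (z + RtoC t * h) - h * g z)%C with (h * (g (z + RtoC t * h) - g z))%C by ring.
    rewrite Cmod_mult. apply Rmult_le_compat_l; [apply Cmod_ge_0|]. apply Rlt_le, Hgz.
    eapply Rle_lt_trans; [now apply Hseg|apply Hy].
Qed.

(** * Exponential and logarithm *)

Lemma Cmod_polar (r t : R) : 0 <= r -> Cmod (r * cos t, r * sin t) = r.
Proof.
  intros H. unfold Cmod; simpl.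
  replace (r * cos t * (r * cos t * 1) + r * sin t * (r * sin t * 1))
    with (r * r * (Rsqr (sin t) + Rsqr (cos t))) by (unfold Rsqr; ring).
  rewrite sin2_cos2, Rmult_1_r. now apply sqrt_square.
Qed.

Lemma Cmod_Cexp (z : C) : Cmod (Cexp z) = exp (Re z).
Proof. apply Cmod_polar. apply Rlt_le, exp_pos. Qed.

Lemma Cexp_plus (y z : C) : Cexp (y + z) = (Cexp y * Cexp z)%C.
Proof.
  unfold Cexp. rewrite re_plus, im_plus, exp_plus, cos_plus, sin_plus.
  apply injective_projections; simpl; ring.
Qed.

Lemma Cexp_RtoC (x : R) : Cexp (RtoC x) = RtoC (exp x).
Proof. unfold Cexp. simpl. rewrite cos_0, sin_0. apply injective_projections; simpl; ring. Qed.

Lemma is_derive_path_Cexp_line (c : C) (t : R) :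
  is_derive_path (fun u => Cexp (c * RtoC u)) t (c * Cexp (c * RtoC t))%C.
Proof.
  destruct c as [x y]. apply is_derive_path_pair; simpl; auto_derive; try exact I.
  all: unfold Rminus; rewrite ?Rmult_0_r, ?Ropp_0; ring.
Qed.

Lemma exp_le_compat (x y : R) : x <= y -> exp x <= exp y.
Proof. intros [H| ->]; [left; now apply exp_increasing|right; reflexivity]. Qed.

Lemma Carg_Re_pos (s : C) : 0 < Re s -> Carg s = atan (Im s / Re s).
Proof. intros H. unfold Carg. now destruct (Rlt_dec 0 (Re s)). Qed.

Lemma ln_Cmod (s : C) : s <> 0 -> ln (Cmod s) = / 2 * ln (Re s ^ 2 + Im s ^ 2).
Proof. intros H%Cmod_gt_0. rewrite <- Cmod2_alt, ln_pow by exact H. simpl. field. Qed.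

Lemma is_derive_path_Clog_line (s h : C) (t : R) :
  0 < Re (s + RtoC t * h) ->
  is_derive_path (fun u => Clog (s + RtoC u * h)) t (h * / (s + RtoC t * h))%C.
Proof.
  destruct s as [x y], h as [a b]. intros Ht.
  assert (Hx : 0 < x + t * a) by (simpl in Ht; lra). clear Ht.
  assert (Q : 0 < (x + t * a) ^ 2 + (y + t * b) ^ 2).
  { pose proof (pow_lt _ 2 Hx). pose proof (pow2_ge_0 (y + t * b)). lra. }
  apply (is_derive_ext_loc (V := C_R_NormedModule) (fun u : R =>
    (/ 2 * ln ((x + u * a) ^ 2 + (y + u * b) ^ 2), atan ((y + u * b) / (x + u * a))) : C)).
  - assert (L : continuous (fun u => x + u * a) t).
    { apply (@ex_derive_continuous R_AbsRing R_NormedModule). auto_derive. exact I. }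
    eapply filter_imp; [|exact (L _ (open_gt 0 _ Hx))]. intros u Hu. cbv beta in Hu.
    assert (Re ((x, y) + RtoC u * (a, b))%C = x + u * a) as re_line by (simpl; ring).
    assert (Im ((x, y) + RtoC u * (a, b))%C = y + u * b) as im_line by (simpl; ring).
    unfold Clog. rewrite ln_Cmod, Carg_Re_pos, re_line, im_line; [reflexivity|now rewrite re_line|].
    apply Re_pos_neq_0. now rewrite re_line.
  - apply is_derive_path_pair; simpl; auto_derive.
    + simpl in Q. lra.
    + simpl in Q. field. lra.
    + lra.
    + simpl in Q. field. split; lra.
Qed.

Lemma is_derive_C_Clog (s : C) : 0 < Re s -> is_derive_C Clog s (/ s)%C.
Proof.
  intros Hs.
  assert (H : forall y, Cmod (y - s) < Re s -> 0 < Re y).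
  { intros y Hy. pose proof (Re_ge_opp_Cmod (y - s)) as K.
    change (Re (y - s)) with (Re y - Re s) in K. lra. }
  apply (is_derive_C_lines Clog Cinv s (Re s) Hs).
  - intros y Hy. eapply is_derive_C_continuous, is_derive_C_inv, Re_pos_neq_0, H, Hy.
  - intros h t Hh Ht. apply is_derive_path_Clog_line, H.
    replace (s + RtoC t * h - s)%C with (RtoC t * h)%C by ring.
    rewrite Cmod_mult, Cmod_R, Rabs_pos_eq by lra. pose proof (Cmod_ge_0 h). nra.
Qed.

Lemma Clog_RtoC (x : R) : 0 < x -> Clog (RtoC x) = RtoC (ln x).
Proof.
  intros Hx. unfold Clog. rewrite Cmod_R, Rabs_pos_eq, Carg_Re_pos by (simpl; lra).
  simpl. unfold Rdiv. now rewrite Rmult_0_l, atan_0.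
Qed.

Lemma Clog_mult_RtoC (x : R) (s : C) :
  0 < x -> 0 < Re s -> Clog (RtoC x * s) = (RtoC (ln x) + Clog s)%C.
Proof.
  intros Hx Hs. assert (Hm : 0 < Cmod s) by now apply Cmod_gt_0, Re_pos_neq_0.
  unfold Clog. rewrite Cmod_mult, Cmod_R, Rabs_pos_eq, ln_mult by lra.
  rewrite !Carg_Re_pos, re_scal_l, im_scal_l by (rewrite ?re_scal_l; nra).
  replace (x * Im s / (x * Re s)) with (Im s / Re s) by (field; lra).
  apply injective_projections; simpl; ring.
Qed.

Lemma Re_1_plus_pos (v : C) : Cmod v < 1 -> 0 < Re (1 + v).
Proof. intros H. rewrite re_plus, re_RtoC. pose proof (Re_ge_opp_Cmod v). lra. Qed.

Lemma Cmod_Clog_1_plus_le (v : C) : Cmod v < 1 -> Cmod (Clog (1 + v)) <= - ln (1 - Cmod v).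
Proof.
  intros Hv. pose proof (Cmod_ge_0 v) as Pv.
  assert (Hm : forall t, 0 <= t <= 1 -> Cmod (RtoC t * v) <= Cmod v /\ Cmod (RtoC t * v) = t * Cmod v).
  { intros t Ht. rewrite Cmod_mult, Cmod_R, Rabs_pos_eq by lra. split; [nra|reflexivity]. }
  assert (Hs : forall t, 0 <= t <= 1 -> 0 < Re (1 + RtoC t * v)).
  { intros t Ht. apply Re_1_plus_pos. destruct (Hm t Ht). lra. }
  replace (Clog (1 + v)) with (Clog (1 + RtoC 1 * v) - Clog (1 + RtoC 0 * v))%C.
  2: { replace (1 + RtoC 0 * v)%C with (RtoC 1) by ring.
       rewrite Cmult_1_l, Clog_RtoC, ln_1 by lra. ring. }
  replace (- ln (1 - Cmod v)) with (minus (- ln (1 - 1 * Cmod v)) (- ln (1 - 0 * Cmod v))).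
  2: { unfold minus, plus, opp; simpl. rewrite Rmult_1_l, Rmult_0_l, Rminus_0_r, ln_1. ring. }
  apply (Cmod_RInt_le (fun t => v * / (1 + RtoC t * v))%C
    (fun t => Cmod v / (1 - t * Cmod v)) 0 1); [lra|..].
  - intros t Ht. destruct (Hm t Ht) as [tv_le tv_eq].
    rewrite Cmod_mult, Cmod_inv by now apply Re_pos_neq_0, Hs.
    apply Rmult_le_compat_l; [exact Pv|]. apply Rinv_le_contravar; [lra|].
    pose proof (Cmod_triangle_inv 1 (RtoC t * v)) as T. rewrite Cmod_1 in T. lra.
  - apply (is_RInt_C_derive (fun t => Clog (1 + RtoC t * v))%C); rewrite Rmin_left, Rmax_right by lra;
      intros t Ht.
    + apply is_derive_path_Clog_line, Hs, Ht.
    + apply continuous_Cmult; [apply continuous_const|].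
      apply continuous_Cinv; [now apply Re_pos_neq_0, Hs|].
      eapply is_derive_path_continuous, is_derive_path_line.
  - apply (@is_RInt_derive R_CompleteNormedModule (fun t => - ln (1 - t * Cmod v)));
      rewrite Rmin_left, Rmax_right by lra; intros t Ht; assert (0 < 1 - t * Cmod v) by nra.
    + auto_derive; [lra|]. field. lra.
    + apply (@ex_derive_continuous R_AbsRing R_NormedModule). auto_derive. lra.
Qed.

(** * Goursat's theorem *)

Definition holomorphic_on (f : C -> C) (U : C -> Prop) : Prop :=
  forall z, U z -> @ex_derive C_AbsRing C_NormedModule f z.

Definition C1_path (g dg : R -> C) (a b : R) : Prop :=
  forall t, a <= t <= b -> is_derive_path g t (dg t) /\ continuous_path dg t.

Definition path_integral (k : C -> C) (g dg : R -> C) (a b : R) : C :=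
  RInt_C (fun t => k (g t) * dg t)%C a b.

Lemma C1_path_sub (g dg : R -> C) (a b a' b' : R) :
  C1_path g dg a b -> a <= a' -> b' <= b -> C1_path g dg a' b'.
Proof. intros H Ha Hb t Ht. apply H. lra. Qed.

Lemma holomorphic_on_continuous (f : C -> C) (U : C -> Prop) (z : C) :
  holomorphic_on f U -> U z -> continuous_C f z.
Proof. intros H Hz. destruct (H z Hz) as [l Hl]. exact (is_derive_C_continuous _ _ _ Hl). Qed.

Lemma path_integral_correct (k : C -> C) (g dg : R -> C) (a b : R) :
  a <= b -> C1_path g dg a b -> holomorphic_on k (fun z => exists t, a <= t <= b /\ z = g t) ->
  is_RInt_C (fun t => k (g t) * dg t)%C a b (path_integral k g dg a b).
Proof.
  intros Hab Hg Hk. apply RInt_C_correct. rewrite Rmin_left, Rmax_right by exact Hab.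
  intros t Ht. destruct (Hg t Ht) as [D Cd]. apply continuous_Cmult; [|exact Cd].
  apply (@continuous_comp R_UniformSpace C_UniformSpace C_UniformSpace g k).
  - exact (is_derive_path_continuous _ _ _ D).
  - eapply holomorphic_on_continuous; [exact Hk|]. now exists t.
Qed.

Lemma path_integral_Chasles (k : C -> C) (g dg : R -> C) (a b c : R) :
  a <= b -> b <= c -> C1_path g dg a c ->
    holomorphic_on k (fun z => exists t, a <= t <= c /\ z = g t) ->
  path_integral k g dg a c = (path_integral k g dg a b + path_integral k g dg b c)%C.
Proof.
  intros Hab Hbc Hg Hk. apply (is_RInt_C_unique (fun t => k (g t) * dg t)%C a c).
  - apply path_integral_correct; [lra|assumption..].
  - apply (@is_RInt_Chasles C_R_NormedModule _ a b c); apply path_integral_correct; try assumption;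
      try (apply (C1_path_sub g dg a c); [assumption|lra..]);
      intros z (t & Ht & ->); apply Hk; exists t; split; [lra|reflexivity|lra|reflexivity].
Qed.

Lemma C1_path_lipschitz (g dg : R -> C) (a b L s t : R) :
  C1_path g dg a b -> (forall u, a <= u <= b -> Cmod (dg u) <= L) ->
  a <= s <= b -> a <= t <= b -> Cmod (g t - g s) <= Rabs (t - s) * L.
Proof.
  intros Hg HL Hs Ht.
  assert (I : forall u, Rmin s t <= u <= Rmax s t -> a <= u <= b).
  { assert (a <= Rmin s t) by (apply Rmin_glb; lra).
    assert (Rmax s t <= b) by (apply Rmax_lub; lra). intros u Hu. lra. }
  apply (Cmod_path_increment_le g dg); intros u Hu; [apply Hg|apply Hg|apply HL]; now apply I.
Qed.

Definition affine_primitive (p k0 k1 z : C) : C := (k0 * z + k1 * ((z - p) * (z - p)) / 2)%C.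

Lemma path_integral_near_affine (k : C -> C) (g dg : R -> C) (a b : R) (p k0 k1 : C) (e L : R) :
  a <= b -> C1_path g dg a b -> 0 <= e ->
  holomorphic_on k (fun z => exists t, a <= t <= b /\ z = g t) ->
  (forall t, a <= t <= b -> Cmod (dg t) <= L) ->
  (forall t, a <= t <= b -> Cmod (k (g t) - k0 - (g t - p) * k1) <= e) ->
  Cmod (path_integral k g dg a b - (affine_primitive p k0 k1 (g b) - affine_primitive p k0 k1 (g a)))
    <= (b - a) * (e * L).
Proof.
  set (P := affine_primitive p k0 k1). intros Hab Hg He Hk HL Hke.
  assert (DP : forall t, a <= t <= b ->
    is_derive_path (fun t => P (g t)) t ((k0 + k1 * (g t - p)) * dg t)%C).
  { intros t Ht. destruct (Hg t Ht) as [D _].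
    assert (Dp : is_derive_path (fun u => g u - p)%C t (dg t)).
    { evar_last; [apply is_derive_path_plus; [exact D|apply is_derive_path_const]|ring]. }
    evar_last.
    - apply is_derive_path_plus; [apply is_derive_path_scal, D|].
      apply is_derive_path_mult; [|apply is_derive_path_const].
      apply is_derive_path_scal, is_derive_path_mult; exact Dp.
    - cbv beta. field. }
  assert (IP : is_RInt_C (fun t => (k0 + k1 * (g t - p)) * dg t)%C a b (P (g b) - P (g a))%C).
  { apply (is_RInt_C_derive (fun t => P (g t))); rewrite Rmin_left, Rmax_right by exact Hab;
      intros t Ht; [now apply DP|]. destruct (Hg t Ht) as [D Cd].
    apply is_derive_path_continuous in D.
    apply continuous_Cmult; [|exact Cd]. apply continuous_Cplus; [apply continuous_const|].
    apply continuous_Cmult; [apply continuous_const|].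
    apply continuous_Cminus; [exact D|apply continuous_const]. }
  rewrite <- (Rabs_pos_eq (b - a)) by lra.
  eapply Cmod_RInt_le_const.
  2: exact (@is_RInt_minus C_R_NormedModule _ _ _ _ _ _
    (path_integral_correct k g dg a b Hab Hg Hk) IP).
  rewrite Rmin_left, Rmax_right by exact Hab. intros t Ht.
  change (Cmod (k (g t) * dg t - (k0 + k1 * (g t - p)) * dg t) <= e * L).
  replace (k (g t) * dg t - (k0 + k1 * (g t - p)) * dg t)%C
    with ((k (g t) - k0 - (g t - p) * k1) * dg t)%C by ring.
  rewrite Cmod_mult. apply Rmult_le_compat; [apply Cmod_ge_0..|now apply Hke|now apply HL].
Qed.

Lemma nested_intervals (u w : nat -> R) :
  (forall n, 0 <= w n) -> (forall n, u n <= u (S n)) -> (forall n, u (S n) + w (S n) <= u n + w n) ->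
  exists l, forall n, u n <= l <= u n + w n.
Proof.
  intros Hw Hu Huw.
  assert (Hub : forall n m, u (m + n)%nat + w (m + n)%nat <= u n + w n).
  { intros n m. induction m as [|m IH]; [apply Rle_refl|]. simpl. specialize (Huw (m + n)%nat). lra. }
  destruct (ex_finite_lim_seq_incr u (u 0%nat + w 0%nat) Hu) as [l Hl].
  { intros n. specialize (Hub 0%nat n). rewrite Nat.add_0_r in Hub. specialize (Hw n). lra. }
  exists l. intros n. split; [exact (is_lim_seq_incr_compare u l Hl Hu n)|].
  apply (is_lim_seq_le (fun m => u (m + n)%nat) (fun _ => u n + w n) l (u n + w n)).
  - intros m. specialize (Hub n m). specialize (Hw (m + n)%nat). lra.
  - now apply is_lim_seq_incr_n.
  - apply is_lim_seq_const.
Qed.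

Lemma nested_rectangles (P : nat -> R -> R -> Prop) (w v : nat -> R) (x0 y0 : R) :
  (forall n, 0 <= w n) -> (forall n, 0 <= v n) -> P 0%nat x0 y0 ->
  (forall n x y, P n x y -> exists x' y', P (S n) x' y' /\
    (x <= x' /\ x' + w (S n) <= x + w n) /\ (y <= y' /\ y' + v (S n) <= y + v n)) ->
  exists xs ys, forall n, exists x y, P n x y /\ x <= xs <= x + w n /\ y <= ys <= y + v n.
Proof.
  intros Hw Hv HP0 HP.
  destruct (functional_choice (fun (s : nat * (R * R)) (q : R * R) =>
    let '(n, (x, y)) := s in let '(x', y') := q in
    P n x y -> P (S n) x' y' /\ (x <= x' /\ x' + w (S n) <= x + w n) /\
      (y <= y' /\ y' + v (S n) <= y + v n)))
    as [next Hnext].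
  { intros [n [x y]]. destruct (classic (P n x y)) as [H|H].
    - destruct (HP n x y H) as (x' & y' & H'). now exists (x', y').
    - now exists (x, y). }
  set (p := fix p n := match n with O => (x0, y0) | S m => next (m, p m) end).
  assert (Hp : forall n, P n (fst (p n)) (snd (p n)) /\
    (fst (p n) <= fst (p (S n)) /\ fst (p (S n)) + w (S n) <= fst (p n) + w n) /\
    (snd (p n) <= snd (p (S n)) /\ snd (p (S n)) + v (S n) <= snd (p n) + v n)).
  { assert (Hn : forall n, P n (fst (p n)) (snd (p n))).
    { induction n as [|n IH]; [exact HP0|]. specialize (Hnext (n, p n)). simpl.
      destruct (p n) as [x y], (next (n, (x, y))) as [x' y']. now apply Hnext. }
    intros n. split; [apply Hn|]. specialize (Hn n). specialize (Hnext (n, p n)). simpl.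
    destruct (p n) as [x y], (next (n, (x, y))) as [x' y']. now apply Hnext. }
  destruct (nested_intervals (fun n => fst (p n)) w Hw) as [xs Hxs]; [apply Hp..|].
  destruct (nested_intervals (fun n => snd (p n)) v Hv) as [ys Hys]; [apply Hp..|].
  exists xs, ys. intros n. exists (fst (p n)), (snd (p n)). split; [apply Hp|]. now split.
Qed.

Lemma exists_div_pow2_lt (x r : R) : 0 < r -> exists n, x / 2 ^ n < r.
Proof.
  intros Hr. destruct (Pow_x_infinity 2) with (b := x / r + 1) as [n Hn].
  { rewrite Rabs_pos_eq; lra. }
  exists n. specialize (Hn n (le_n n)). assert (P : 0 < 2 ^ n) by (apply pow_lt; lra).
  rewrite Rabs_pos_eq in Hn by lra.
  apply Rlt_div_l; [exact P|]. rewrite Rmult_comm. apply Rlt_div_l; lra.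
Qed.

Section AdditiveRectangleFunction.

Variables (Q : R -> R -> R -> R -> C) (a b c d : R).
Hypothesis a_le_b : a <= b.
Hypothesis c_le_d : c <= d.
Hypothesis Q_split_x : forall x1 x2 x3 y1 y2,
  a <= x1 <= x2 -> x2 <= x3 <= b -> c <= y1 <= y2 -> y2 <= d ->
  Q x1 x3 y1 y2 = (Q x1 x2 y1 y2 + Q x2 x3 y1 y2)%C.
Hypothesis Q_split_y : forall x1 x2 y1 y2 y3,
  a <= x1 <= x2 -> x2 <= b -> c <= y1 <= y2 -> y2 <= y3 <= d ->
  Q x1 x2 y1 y3 = (Q x1 x2 y1 y2 + Q x1 x2 y2 y3)%C.
Hypothesis Q_small : forall x y e, a <= x <= b -> c <= y <= d -> 0 < e ->
  exists r, 0 < r /\ forall x1 x2 y1 y2,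
    a <= x1 <= x -> x <= x2 <= b -> c <= y1 <= y -> y <= y2 <= d ->
    x2 - x1 < r -> y2 - y1 < r ->
    Cmod (Q x1 x2 y1 y2) <= e * ((x2 - x1) + (y2 - y1)) ^ 2.

Lemma exists_large_quarter (x y w v M : R) :
  0 <= w -> 0 <= v -> a <= x -> x + w <= b -> c <= y -> y + v <= d ->
  4 * M < Cmod (Q x (x + w) y (y + v)) ->
  exists x' y', M < Cmod (Q x' (x' + w / 2) y' (y' + v / 2)) /\
    (x <= x' /\ x' + w / 2 <= x + w) /\ (y <= y' /\ y' + v / 2 <= y + v).
Proof.
  intros Hw Hv Hax Hxb Hcy Hyd HM.
  set (q x' y' := Cmod (Q x' (x' + w / 2) y' (y' + v / 2))).
  assert (HQ : Cmod (Q x (x + w) y (y + v))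
    <= q x y + q x (y + v / 2) + (q (x + w / 2) y + q (x + w / 2) (y + v / 2))).
  { unfold q. replace (x + w / 2 + w / 2) with (x + w) by field.
    replace (y + v / 2 + v / 2) with (y + v) by field.
    rewrite (Q_split_x x (x + w / 2) (x + w)) by lra.
    rewrite (Q_split_y x (x + w / 2) y (y + v / 2) (y + v)) by lra.
    rewrite (Q_split_y (x + w / 2) (x + w) y (y + v / 2) (y + v)) by lra.
    eapply Rle_trans; [apply Cmod_triangle|]. apply Rplus_le_compat; apply Cmod_triangle. }
  destruct (Rlt_le_dec M (q x y)) as [L|not_ll]; [exists x, y; repeat split; (exact L || lra)|].
  destruct (Rlt_le_dec M (q x (y + v / 2))) as [L|not_lu];
    [exists x, (y + v / 2); repeat split; (exact L || lra)|].
  destruct (Rlt_le_dec M (q (x + w / 2) y)) as [L|not_rl];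
    [exists (x + w / 2), y; repeat split; (exact L || lra)|].
  exists (x + w / 2), (y + v / 2). repeat split; try lra. fold (q (x + w / 2) (y + v / 2)). lra.
Qed.

Lemma additive_rectangle_function_eq_0 : Q a b c d = 0.
Proof.
  apply Cmod_eq_0, Rle_antisym; [|apply Cmod_ge_0]. apply Rnot_lt_le. intros Hpos.
  set (e := Cmod (Q a b c d) / (((b - a) + (d - c)) ^ 2 + 1)).
  assert (Hs : 0 <= ((b - a) + (d - c)) ^ 2) by apply pow2_ge_0.
  assert (He : 0 < e) by (apply Rdiv_lt_0_compat; lra).
  set (w n := (b - a) / 2 ^ n). set (v n := (d - c) / 2 ^ n).
  assert (Hw : forall n, 0 <= w n) by (intros n; apply Rdiv_le_0_compat; [lra|apply pow_lt; lra]).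
  assert (Hv : forall n, 0 <= v n) by (intros n; apply Rdiv_le_0_compat; [lra|apply pow_lt; lra]).
  assert (wS : forall n, w (S n) = w n / 2)
    by (intros n; unfold w; simpl; field; apply pow_nonzero; lra).
  assert (vS : forall n, v (S n) = v n / 2)
    by (intros n; unfold v; simpl; field; apply pow_nonzero; lra).
  destruct (nested_rectangles (fun n x y => (a <= x /\ x + w n <= b) /\ (c <= y /\ y + v n <= d) /\
    e * (w n + v n) ^ 2 < Cmod (Q x (x + w n) y (y + v n))) w v a c Hw Hv) as (x & y & Hxy).
  - unfold w, v. simpl pow. rewrite !Rdiv_1_r.
    replace (a + (b - a)) with b by ring. replace (c + (d - c)) with d by ring.
    repeat split; try lra.
    replace (Cmod (Q a b c d)) with (e * (((b - a) + (d - c)) ^ 2 + 1)) by (unfold e; field; lra).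
    lra.
  - intros n x y ((Hax & Hxb) & (Hcy & Hyd) & HQ). rewrite wS, vS.
    destruct (exists_large_quarter x y (w n) (v n) (e * (w n / 2 + v n / 2) ^ 2))
      as (x' & y' & large & Hx & Hy);
      try (apply Hw || apply Hv || assumption).
    { eapply Rle_lt_trans; [|exact HQ]. right. field. }
    exists x', y'. repeat split; (exact large || lra).
  - destruct (Hxy 0%nat) as (x0 & y0 & (Hax & Hxb & _) & Hx0 & Hy0).
    destruct (Q_small x y e) as (r & Hr & Hsmall); [lra..|].
    destruct (exists_div_pow2_lt ((b - a) + (d - c)) r Hr) as [n Hn].
    assert (w n + v n < r).
    { eapply Rle_lt_trans; [|exact Hn]. right. unfold w, v. field. apply pow_nonzero; lra. }
    destruct (Hxy n) as (x1 & y1 & ((Hax1 & Hxb1) & (Hcy1 & Hyd1) & HQ) & Hx & Hy).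
    specialize (Hw n). specialize (Hv n).
    specialize (Hsmall x1 (x1 + w n) y1 (y1 + v n)).
    replace (x1 + w n - x1) with (w n) in Hsmall by ring.
    replace (y1 + v n - y1) with (v n) in Hsmall by ring.
    apply (Rlt_not_le _ _ HQ), Hsmall; lra.
Qed.

End AdditiveRectangleFunction.

Section Goursat.

Variables (h hx hy : R -> R -> C) (k : C -> C) (a b c d L : R).
Hypothesis a_le_b : a <= b.
Hypothesis c_le_d : c <= d.
Hypothesis h_x : forall y, c <= y <= d -> C1_path (fun x => h x y) (fun x => hx x y) a b.
Hypothesis h_y : forall x, a <= x <= b -> C1_path (h x) (hy x) c d.
Hypothesis hx_le : forall x y, a <= x <= b -> c <= y <= d -> Cmod (hx x y) <= L.
Hypothesis hy_le : forall x y, a <= x <= b -> c <= y <= d -> Cmod (hy x y) <= L.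
Hypothesis k_holomorphic :
  holomorphic_on k (fun z => exists x y, a <= x <= b /\ c <= y <= d /\ z = h x y).

(* The boundary of a rectangle is traversed through its image under [h]; [h] need not be
   injective. *)
Definition boundary_integral (x1 x2 y1 y2 : R) : C :=
  (path_integral k (fun x => h x y1) (fun x => hx x y1) x1 x2 + path_integral k (h x2) (hy x2) y1 y2
   - path_integral k (fun x => h x y2) (fun x => hx x y2) x1 x2
   - path_integral k (h x1) (hy x1) y1 y2)%C.

Lemma holomorphic_on_horizontal_side (x1 x2 y : R) : a <= x1 -> x2 <= b -> c <= y <= d ->
  holomorphic_on k (fun z => exists x, x1 <= x <= x2 /\ z = h x y).
Proof. intros Hax1 Hx2b Hy z (x & Hx & ->). apply k_holomorphic. exists x, y. repeat split; lra. Qed.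

Lemma holomorphic_on_vertical_side (x y1 y2 : R) : a <= x <= b -> c <= y1 -> y2 <= d ->
  holomorphic_on k (fun z => exists y, y1 <= y <= y2 /\ z = h x y).
Proof. intros Hx Hcy1 Hy2d z (y & Hy & ->). apply k_holomorphic. exists x, y. repeat split; lra. Qed.

Lemma rectangle_map_lipschitz (x y x' y' : R) :
  a <= x <= b -> c <= y <= d -> a <= x' <= b -> c <= y' <= d ->
  Cmod (h x' y' - h x y) <= (Rabs (x' - x) + Rabs (y' - y)) * L.
Proof.
  intros Hx Hy Hx' Hy'. eapply Rle_trans; [apply (Cmod_minus_triangle _ (h x y'))|].
  rewrite Rmult_plus_distr_r. apply Rplus_le_compat.
  - apply (C1_path_lipschitz (fun x => h x y') (fun x => hx x y') a b L); auto.
  - apply (C1_path_lipschitz (h x) (hy x) c d L); auto.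
Qed.

Lemma boundary_integral_near_affine (x1 x2 y1 y2 : R) (p k0 k1 : C) (e : R) :
  a <= x1 <= x2 -> x2 <= b -> c <= y1 <= y2 -> y2 <= d -> 0 <= e ->
  (forall x y, x1 <= x <= x2 -> y1 <= y <= y2 -> Cmod (k (h x y) - k0 - (h x y - p) * k1) <= e) ->
  Cmod (boundary_integral x1 x2 y1 y2) <= 2 * ((x2 - x1) + (y2 - y1)) * (e * L).
Proof.
  intros Hx1 Hx2 Hy1 Hy2 He Hk. set (P := affine_primitive p k0 k1).
  assert (horizontal : forall y, y1 <= y <= y2 ->
    Cmod (path_integral k (fun x => h x y) (fun x => hx x y) x1 x2 - (P (h x2 y) - P (h x1 y)))
      <= (x2 - x1) * (e * L)).
  { intros y Hy. apply (path_integral_near_affine k (fun x => h x y)); try assumption; [lra|..].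
    - apply (C1_path_sub _ _ a b); [apply h_x|..]; lra.
    - apply holomorphic_on_horizontal_side; lra.
    - intros t Ht. apply hx_le; lra.
    - intros t Ht. now apply Hk. }
  assert (vertical : forall x, x1 <= x <= x2 ->
    Cmod (path_integral k (h x) (hy x) y1 y2 - (P (h x y2) - P (h x y1))) <= (y2 - y1) * (e * L)).
  { intros x Hx. apply (path_integral_near_affine k (h x)); try assumption; [lra|..].
    - apply (C1_path_sub _ _ c d); [apply h_y|..]; lra.
    - apply holomorphic_on_vertical_side; lra.
    - intros t Ht. apply hy_le; lra.
    - intros t Ht. now apply Hk. }
  unfold boundary_integral.
  pose proof (horizontal y1 ltac:(lra)) as bottom. pose proof (vertical x2 ltac:(lra)) as right_side.
  pose proof (horizontal y2 ltac:(lra)) as top. pose proof (vertical x1 ltac:(lra)) as left_side.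
  set (i1 := path_integral k (fun x => h x y1) _ x1 x2) in *.
  set (i2 := path_integral k (h x2) _ y1 y2) in *.
  set (i3 := path_integral k (fun x => h x y2) _ x1 x2) in *.
  set (i4 := path_integral k (h x1) _ y1 y2) in *.
  replace (i1 + i2 - i3 - i4)%C with
    ((i1 - (P (h x2 y1) - P (h x1 y1))) + (i2 - (P (h x2 y2) - P (h x2 y1)))
     + - (i3 - (P (h x2 y2) - P (h x1 y2))) + - (i4 - (P (h x1 y2) - P (h x1 y1))))%C by ring.
  eapply Rle_trans; [apply Cmod_triangle|]. rewrite Cmod_opp.
  eapply Rle_trans; [apply Rplus_le_compat_r, Cmod_triangle|]. rewrite Cmod_opp.
  eapply Rle_trans; [apply Rplus_le_compat_r, Rplus_le_compat_r, Cmod_triangle|]. lra.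
Qed.

Lemma boundary_integral_small (x y e : R) : a <= x <= b -> c <= y <= d -> 0 < e ->
  exists r, 0 < r /\ forall x1 x2 y1 y2,
    a <= x1 <= x -> x <= x2 <= b -> c <= y1 <= y -> y <= y2 <= d ->
    x2 - x1 < r -> y2 - y1 < r ->
    Cmod (boundary_integral x1 x2 y1 y2) <= e * ((x2 - x1) + (y2 - y1)) ^ 2.
Proof.
  intros Hx Hy He.
  assert (HL : 0 <= L) by (eapply Rle_trans; [apply Cmod_ge_0|exact (hx_le x y Hx Hy)]).
  assert (L_sqr_nonneg : 0 <= L ^ 2) by apply pow2_ge_0.
  destruct (k_holomorphic (h x y)) as [l Hl]; [now exists x, y|].
  set (eta := e / (2 * (L ^ 2 + 1))).
  assert (Heta : 0 < eta) by (apply Rdiv_lt_0_compat; lra).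
  destruct (proj1 (is_derive_C_eps _ _ _) Hl eta Heta) as (dl & Hdl & Hk).
  exists (dl / (2 * (L + 1))). split; [apply Rdiv_lt_0_compat; lra|].
  intros x1 x2 y1 y2 Hx1 Hx2 Hy1 Hy2 Hrx Hry.
  set (s := (x2 - x1) + (y2 - y1)).
  assert (Hs : 0 <= s * L) by (apply Rmult_le_pos; unfold s; lra).
  assert (Hdist : forall x' y', x1 <= x' <= x2 -> y1 <= y' <= y2 -> Cmod (h x' y' - h x y) <= s * L).
  { intros x' y' Hx' Hy'. eapply Rle_trans; [apply rectangle_map_lipschitz; lra|].
    apply Rmult_le_compat_r; [exact HL|]. apply Rplus_le_compat; apply Rabs_le; lra. }
  assert (Hsmall : s * L < dl).
  { apply Rle_lt_trans with (s * (L + 1)); [unfold s in *; lra|].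
    apply Rlt_div_r; [lra|].
    replace (dl / (L + 1)) with (2 * (dl / (2 * (L + 1)))) by (field; lra). unfold s. lra. }
  apply Rle_trans with (2 * s * (eta * (s * L) * L)).
  - apply (boundary_integral_near_affine x1 x2 y1 y2 (h x y) (k (h x y)) l); try lra.
    + apply Rmult_le_pos; lra.
    + intros x' y' Hx' Hy'. specialize (Hdist x' y' Hx' Hy').
      eapply Rle_trans; [apply Hk; lra|]. apply Rmult_le_compat_l; lra.
  - replace (2 * s * (eta * (s * L) * L)) with (2 * eta * L ^ 2 * s ^ 2) by ring.
    apply Rmult_le_compat_r; [apply pow2_ge_0|].
    replace e with (2 * eta * (L ^ 2 + 1)) by (unfold eta; field; lra).
    apply Rmult_le_compat_l; lra.
Qed.

Lemma goursat : boundary_integral a b c d = 0.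
Proof.
  apply (additive_rectangle_function_eq_0 boundary_integral a b c d a_le_b c_le_d).
  - intros x1 x2 x3 y1 y2 Hx12 Hx23 Hy12 Hy2. unfold boundary_integral.
    rewrite (path_integral_Chasles k (fun x => h x y1) (fun x => hx x y1) x1 x2 x3),
      (path_integral_Chasles k (fun x => h x y2) (fun x => hx x y2) x1 x2 x3);
      try lra; try (apply holomorphic_on_horizontal_side; lra); try ring;
      apply (C1_path_sub _ _ a b); (lra || apply h_x; lra).
  - intros x1 x2 y1 y2 y3 Hx12 Hx2 Hy12 Hy23. unfold boundary_integral.
    rewrite (path_integral_Chasles k (h x1) (hy x1) y1 y2 y3),
      (path_integral_Chasles k (h x2) (hy x2) y1 y2 y3);
      try lra; try (apply holomorphic_on_vertical_side; lra); try ring;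
      apply (C1_path_sub _ _ c d); (lra || apply h_y; lra).
  - apply boundary_integral_small.
Qed.

End Goursat.

(** * Cauchy's integral formula *)

Definition circle (r t : R) : C := (r * cos t, r * sin t).

Lemma Cmod_circle (r t : R) : 0 <= r -> Cmod (circle r t) = r.
Proof. apply Cmod_polar. Qed.

Lemma circle_2PI (r : R) : circle r (2 * PI) = circle r 0.
Proof. unfold circle. now rewrite cos_2PI, sin_2PI, cos_0, sin_0. Qed.

Lemma is_derive_path_circle (r t : R) : is_derive_path (circle r) t (Ci * circle r t)%C.
Proof. apply is_derive_path_pair; simpl; auto_derive; try exact I; ring. Qed.

Lemma continuous_circle (r t : R) : continuous_path (circle r) t.
Proof. eapply is_derive_path_continuous, is_derive_path_circle. Qed.

Lemma Cmod_circle_minus_ge (r t : R) (z : C) : 0 <= r -> r - Cmod z <= Cmod (circle r t - z).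
Proof.
  intros Hr. pose proof (Cmod_triangle_inv (circle r t) (- z)) as T.
  now rewrite Cmod_circle, Cmod_opp in T.
Qed.

Lemma circle_minus_neq_0 (r t : R) (z : C) : Cmod z < r -> (circle r t - z)%C <> 0.
Proof.
  intros Hz. pose proof (Cmod_ge_0 z). apply Cmod_gt_0.
  pose proof (Cmod_circle_minus_ge r t z). lra.
Qed.

Lemma Ci_mult_Ci : (Ci * Ci)%C = (- (1))%C.
Proof. apply injective_projections; simpl; ring. Qed.

(* The integrand has the primitive [t - i log (1 - z / circle r t)]. *)
Lemma circle_winding (r : R) (z : C) : Cmod z < r ->
  is_RInt_C (fun t => circle r t * / (circle r t - z))%C 0 (2 * PI) (RtoC (2 * PI)).
Proof.
  intros Hz. pose proof (Cmod_ge_0 z) as Pz.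
  set (F := fun t => (RtoC t + - Ci * Clog (1 + - z * / circle r t))%C).
  assert (circle_neq_0 : forall t, circle r t <> 0)
    by (intros t; apply Cmod_gt_0; rewrite Cmod_circle; lra).
  assert (circle_z_neq_0 : forall t, (circle r t - z)%C <> 0)
    by (intros t; now apply circle_minus_neq_0).
  assert (Hre : forall t, 0 < Re (1 + - z * / circle r t)).
  { intros t. apply Re_1_plus_pos.
    rewrite Cmod_mult, Cmod_opp, Cmod_inv, Cmod_circle by (apply circle_neq_0 || lra).
    apply Rlt_div_l; lra. }
  replace (RtoC (2 * PI)) with (F (2 * PI)%R - F 0)%C by (unfold F; rewrite circle_2PI; ring).
  apply is_RInt_C_derive; intros t _.
  - evar_last.
    + apply is_derive_path_plus; [apply is_derive_path_RtoC, @is_derive_id|]. apply is_derive_path_scal.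
      apply (is_derive_path_comp Clog); [apply is_derive_C_Clog, Hre|].
      apply is_derive_path_plus; [apply is_derive_path_const|]. apply is_derive_path_scal.
      apply (is_derive_path_comp Cinv);
        [apply is_derive_C_inv, circle_neq_0|apply is_derive_path_circle].
    + unfold one; simpl.
      replace (- Ci * ((0 + - z * (Ci * circle r t * - / (circle r t * circle r t))) * /
        (1 + - z * / circle r t)))%C
        with ((Ci * Ci) * - (z * circle r t * / (circle r t * circle r t) * /
          (1 + - z * / circle r t)))%C by ring.
      rewrite Ci_mult_Ci. field. repeat split; try apply circle_neq_0; apply circle_z_neq_0.
  - apply continuous_Cmult; [apply continuous_circle|].
    apply continuous_Cinv; [apply circle_z_neq_0|].
    apply continuous_Cminus; [apply continuous_circle|apply continuous_const].
Qed.

Section CauchyFormula.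

Variables (f : C -> C) (r : R) (z : C).
Hypothesis z_inside : Cmod z < r.
Hypothesis f_holomorphic : holomorphic_on f (fun y => Cmod y <= r).

Let r_pos : 0 < r := Cmod_lt_pos z r z_inside.

Definition radial (s t : R) : C := (z + RtoC s * (circle r t - z))%C.

Definition radial_average (s : R) : C :=
  RInt_C (fun t => f (radial s t) * (circle r t * / (circle r t - z)))%C 0 (2 * PI).

Lemma Cmod_radial_le (s t : R) : 0 <= s <= 1 -> Cmod (radial s t) <= r.
Proof.
  intros Hs. pose proof r_pos. unfold radial.
  replace (z + RtoC s * (circle r t - z))%C with (RtoC (1 - s) * z + RtoC s * circle r t)%C
    by (rewrite RtoC_minus; ring).
  eapply Rle_trans; [apply Cmod_triangle|].
  rewrite !Cmod_mult, !Cmod_R, Cmod_circle, !Rabs_pos_eq by lra. nra.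
Qed.

Lemma radial_minus (s t : R) : (radial s t - z)%C = (RtoC s * (circle r t - z))%C.
Proof. unfold radial. ring. Qed.

Lemma radial_C1_s (t a b : R) : C1_path (fun s => radial s t) (fun _ => circle r t - z)%C a b.
Proof. intros s _. split; [apply is_derive_path_line|apply continuous_const]. Qed.

Definition radial_dt (s t : R) : C := (RtoC s * (Ci * circle r t))%C.

Lemma radial_C1_t (s a b : R) : C1_path (radial s) (radial_dt s) a b.
Proof.
  intros t _. split.
  - unfold radial. evar_last.
    + apply is_derive_path_plus; [apply is_derive_path_const|]. apply is_derive_path_scal.
      apply is_derive_path_plus; [apply is_derive_path_circle|apply is_derive_path_const].
    + unfold radial_dt. ring.
  - apply continuous_Cmult; [apply continuous_const|].
    apply continuous_Cmult; [apply continuous_const|apply continuous_circle].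
Qed.

Lemma radial_average_correct (s : R) : 0 <= s <= 1 ->
  is_RInt_C (fun t => f (radial s t) * (circle r t * / (circle r t - z)))%C 0 (2 * PI)
    (radial_average s).
Proof.
  intros Hs. apply RInt_C_correct. intros t _.
  apply continuous_Cmult.
  - apply (@continuous_comp R_UniformSpace C_UniformSpace C_UniformSpace (radial s) f).
    + destruct (radial_C1_t s t t t) as [D _]; [lra|]. exact (is_derive_path_continuous _ _ _ D).
    + eapply holomorphic_on_continuous; [exact f_holomorphic|now apply Cmod_radial_le].
  - apply continuous_Cmult; [apply continuous_circle|].
    apply continuous_Cinv; [now apply circle_minus_neq_0|].
    apply continuous_Cminus; [apply continuous_circle|apply continuous_const].
Qed.

Definition cauchy_quotient (y : C) : C := (f y * / (y - z))%C.

Lemma cauchy_quotient_holomorphic :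
  holomorphic_on cauchy_quotient (fun y => exists s t, 0 < s <= 1 /\ y = radial s t).
Proof.
  intros y (s & t & Hs & ->).
  destruct (f_holomorphic (radial s t)) as [l Hl]; [apply Cmod_radial_le; lra|].
  eexists. apply is_derive_C_mult; [exact Hl|].
  apply (is_derive_C_comp Cinv (fun y => y - z)%C); [|apply (is_derive_C_shift (- z)%C)].
  apply is_derive_C_inv. rewrite radial_minus.
  apply Cmult_neq_0; [|now apply circle_minus_neq_0]. intros E. apply RtoC_inj in E. lra.
Qed.

Lemma radial_contour_integral (s : R) : 0 < s <= 1 ->
  path_integral cauchy_quotient (radial s) (radial_dt s) 0 (2 * PI) = (Ci * radial_average s)%C.
Proof.
  intros Hs. pose proof PI_RGT_0.
  apply (is_RInt_C_unique (fun t => cauchy_quotient (radial s t) * radial_dt s t)%C 0 (2 * PI)).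
  - apply path_integral_correct; [lra|apply radial_C1_t|].
    intros y (t & _ & ->). apply cauchy_quotient_holomorphic. now exists s, t.
  - eapply is_RInt_C_ext; [|apply is_RInt_C_scal, radial_average_correct; lra].
    intros t. unfold cauchy_quotient, radial_dt. rewrite radial_minus. field.
    split; [now apply circle_minus_neq_0|]. intros E. apply RtoC_inj in E. lra.
Qed.

Lemma radial_average_const (e : R) : 0 < e <= 1 -> radial_average e = radial_average 1.
Proof.
  intros He. pose proof r_pos as Hr. pose proof PI_RGT_0 as Hpi.
  assert (G : boundary_integral radial (fun _ t => circle r t - z)%C radial_dt cauchy_quotient
    e 1 0 (2 * PI) = 0).
  { apply (goursat radial (fun _ t => circle r t - z)%C radial_dt cauchy_quotient
      e 1 0 (2 * PI) (2 * r));
      [lra|lra|..].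
    - intros t _. apply radial_C1_s.
    - intros s _. apply radial_C1_t.
    - intros s t _ _. eapply Rle_trans; [apply Cmod_triangle|]. rewrite Cmod_opp, Cmod_circle; lra.
    - intros s t Hs _. unfold radial_dt.
      rewrite !Cmod_mult, Cmod_R, Cmod_Ci, Cmod_circle, Rabs_pos_eq by lra. nra.
    - intros y (s & t & Hs & _ & ->). apply cauchy_quotient_holomorphic. exists s, t.
      split; [lra|reflexivity]. }
  unfold boundary_integral in G. rewrite !radial_contour_integral in G by lra.
  replace (path_integral cauchy_quotient (fun s => radial s (2 * PI))
    (fun _ => circle r (2 * PI) - z)%C e 1)
    with (path_integral cauchy_quotient (fun s => radial s 0) (fun _ => circle r 0 - z)%C e 1) in G
    by (unfold radial; now rewrite circle_2PI).
  set (i := path_integral _ _ _ e 1) in G.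
  transitivity (radial_average e + - Ci * (i + Ci * radial_average 1 - i - Ci * radial_average e))%C.
  - rewrite G. ring.
  - replace (radial_average e + - Ci * (i + Ci * radial_average 1 - i - Ci * radial_average e))%C
      with (radial_average e + - (Ci * Ci) * (radial_average 1 - radial_average e))%C by ring.
    rewrite Ci_mult_Ci. ring.
Qed.

Lemma radial_average_0_limit (eta : R) : 0 < eta ->
  exists e, 0 < e <= 1 /\
    Cmod (radial_average e - f z * RtoC (2 * PI)) <= 2 * PI * (r / (r - Cmod z)) * eta.
Proof.
  intros Heta. pose proof r_pos as Hr. pose proof PI_RGT_0 as Hpi.
  destruct (proj1 (continuous_C_eps f z)
    (holomorphic_on_continuous f _ z f_holomorphic (Rlt_le _ _ z_inside)) eta Heta) as (d & Hd & Hf).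
  exists (Rmin 1 (d / (4 * r))).
  assert (He : 0 < Rmin 1 (d / (4 * r)) <= 1).
  { split; [apply Rmin_pos; [lra|apply Rdiv_lt_0_compat; lra]|apply Rmin_l]. }
  assert (Hed : Rmin 1 (d / (4 * r)) * (2 * r) < d).
  { apply Rle_lt_trans with (d / (4 * r) * (2 * r)).
    - apply Rmult_le_compat_r; [lra|apply Rmin_r].
    - replace (d / (4 * r) * (2 * r)) with (d / 2) by (field; lra). lra. }
  set (e := Rmin 1 (d / (4 * r))) in *. split; [exact He|].
  replace (2 * PI * (r / (r - Cmod z)) * eta) with (Rabs (2 * PI - 0) * (eta * (r * / (r - Cmod z))))
    by (rewrite Rminus_0_r, Rabs_pos_eq by lra; field; lra).
  eapply Cmod_RInt_le_const;
    [|exact (@is_RInt_minus C_R_NormedModule _ _ _ _ _ _ (radial_average_correct e ltac:(lra))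
        (is_RInt_C_scal (f z) _ _ _ _ (circle_winding r z z_inside)))].
  intros t _. set (q := (circle r t * / (circle r t - z))%C).
  change (Cmod (f (radial e t) * q - f z * q) <= eta * (r * / (r - Cmod z))).
  replace (f (radial e t) * q - f z * q)%C with ((f (radial e t) - f z) * q)%C by ring.
  rewrite Cmod_mult. apply Rmult_le_compat; [apply Cmod_ge_0..| |].
  - apply Rlt_le, Hf. rewrite radial_minus, Cmod_mult, Cmod_R, Rabs_pos_eq by lra.
    eapply Rle_lt_trans; [|exact Hed]. apply Rmult_le_compat_l; [lra|].
    eapply Rle_trans; [apply Cmod_triangle|]. rewrite Cmod_opp, Cmod_circle; lra.
  - unfold q. rewrite Cmod_mult, Cmod_inv, Cmod_circle by (lra || now apply circle_minus_neq_0).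
    apply Rmult_le_compat_l; [lra|]. apply Rinv_le_contravar; [lra|].
    apply Cmod_circle_minus_ge. lra.
Qed.

Lemma cauchy_formula :
  is_RInt_C (fun t => f (circle r t) * (circle r t * / (circle r t - z)))%C 0 (2 * PI)
    (RtoC (2 * PI) * f z)%C.
Proof.
  pose proof r_pos as Hr. pose proof PI_RGT_0 as Hpi.
  replace (RtoC (2 * PI) * f z)%C with (radial_average 1).
  - eapply is_RInt_C_ext; [|apply radial_average_correct; lra].
    intros t. cbv beta. do 2 f_equal. unfold radial. ring.
  - apply Ceq_minus, Cmod_eq_0, Rle_antisym; [|apply Cmod_ge_0].
    apply Rnot_lt_le. intros Hpos.
    set (D := Cmod (radial_average 1 - RtoC (2 * PI) * f z)) in *.
    set (K := 2 * PI * (r / (r - Cmod z))).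
    assert (HK : 0 < K) by (apply Rmult_lt_0_compat; [lra|apply Rdiv_lt_0_compat; lra]).
    destruct (radial_average_0_limit (D / (2 * K))) as (e & He & HD); [apply Rdiv_lt_0_compat; lra|].
    rewrite radial_average_const, (Cmult_comm (f z)) in HD by exact He. fold D K in HD.
    replace (K * (D / (2 * K))) with (D / 2) in HD by (field; lra). lra.
Qed.

End CauchyFormula.

(* For [u = 1 / (rho - z - h)] and [v = 1 / (rho - z)] one has [u - v = h u v]: a Taylor estimate
   for the powers of the resolvent, uniform in [rho]. *)
Lemma Cpow_resolvent_taylor (q : R) (m : nat) : 0 <= q -> exists M, 0 <= M /\
  forall u v h : C, Cmod u <= q -> Cmod v <= q -> (u - v)%C = (h * u * v)%C ->
  Cmod (u ^ m - v ^ m - h * (RtoC (INR m) * v ^ S m)) <= M * Cmod h ^ 2.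
Proof.
  intros Hq. induction m as [|m (M & HM & IH)].
  - exists 0. split; [lra|]. intros u v h _ _ _.
    replace (u ^ 0 - v ^ 0 - h * (RtoC (INR 0) * v ^ 1))%C with (RtoC 0) by (simpl; ring).
    rewrite Cmod_0. lra.
  - exists (q * M + INR (S m) * (q * q ^ (m + 2))). split.
    { apply Rplus_le_le_0_compat; [nra|].
      apply Rmult_le_pos; [apply pos_INR|]. apply Rmult_le_pos; [exact Hq|now apply pow_le]. }
    intros u v h Hu Hv E. specialize (IH u v h Hu Hv E).
    assert (E0 : (u - v - h * u * v)%C = 0) by (rewrite E; ring).
    replace (u ^ S m - v ^ S m - h * (RtoC (INR (S m)) * v ^ S (S m)))%C with
      (u * (u ^ m - v ^ m - h * (RtoC (INR m) * v ^ S m))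
        + h * h * (RtoC (INR (S m)) * (u * v ^ (m + 2)))
        + (u - v - h * u * v) * (v ^ m + RtoC (INR (S m)) * h * v ^ S m))%C
      by (rewrite (Nat.add_comm m 2), S_INR, RtoC_plus; simpl Nat.add; rewrite !Cpow_S; ring).
    rewrite E0, Cmult_0_l, Cplus_0_r.
    eapply Rle_trans; [apply Cmod_triangle|].
    rewrite !Cmod_mult, Cmod_pow, Cmod_R, (Rabs_pos_eq (INR (S m))), Rmult_plus_distr_r
      by apply pos_INR.
    apply Rplus_le_compat.
    + rewrite Rmult_assoc. apply Rmult_le_compat; try apply Cmod_ge_0; assumption.
    + replace (INR (S m) * (q * q ^ (m + 2)) * Cmod h ^ 2)
        with (Cmod h * Cmod h * (INR (S m) * (q * q ^ (m + 2)))) by ring.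
      apply Rmult_le_compat_l; [apply Rle_0_sqr|]. apply Rmult_le_compat_l; [apply pos_INR|].
      apply Rmult_le_compat; [apply Cmod_ge_0|apply pow_le, Cmod_ge_0|exact Hu|].
      apply pow_incr. split; [apply Cmod_ge_0|exact Hv].
Qed.

Definition cauchy_integral (g : R -> C) (r : R) (m : nat) (z : C) : C :=
  RInt_C (fun t => g t * (/ (circle r t - z)) ^ m)%C 0 (2 * PI).

Section CauchyIntegral.

Variables (g : R -> C) (r : R).
Hypothesis g_continuous : forall t, continuous_path g t.

Lemma cauchy_integral_correct (m : nat) (z : C) : Cmod z < r ->
  is_RInt_C (fun t => g t * (/ (circle r t - z)) ^ m)%C 0 (2 * PI) (cauchy_integral g r m z).
Proof.
  intros Hz. apply RInt_C_correct. intros t _. apply continuous_Cmult; [apply g_continuous|].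
  apply continuous_Cpow, continuous_Cinv; [now apply circle_minus_neq_0|].
  apply continuous_Cminus; [apply continuous_circle|apply continuous_const].
Qed.

Lemma is_derive_C_cauchy_integral (m : nat) (z : C) : Cmod z < r ->
  is_derive_C (cauchy_integral g r m) z (RtoC (INR m) * cauchy_integral g r (S m) z)%C.
Proof.
  intros Hz. pose proof (Cmod_ge_0 z) as Pz. pose proof PI_RGT_0 as Hpi.
  destruct (@bounded_continuity R_AbsRing C_R_NormedModule g 0 (2 * PI)) as [G HG].
  { intros t _. apply g_continuous. }
  set (dl := (r - Cmod z) / 2). assert (Hdl : 0 < dl) by (unfold dl; lra).
  destruct (Cpow_resolvent_taylor (/ dl) m) as (M & HM & K); [now apply Rlt_le, Rinv_0_lt_compat|].
  apply (is_derive_C_quadratic _ _ _ (2 * PI * (G * M)) dl Hdl).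
  intros y Hy.
  assert (Hyz : Cmod y < Cmod z + dl).
  { pose proof (Cmod_triangle z (y - z)) as T. replace (z + (y - z))%C with y in T by ring. lra. }
  assert (Hyr : Cmod y < r) by (unfold dl in Hyz; lra).
  assert (Hinv : forall x t, Cmod x < Cmod z + dl -> Cmod (/ (circle r t - x)) <= / dl).
  { intros x t Hx. rewrite Cmod_inv by (apply circle_minus_neq_0; unfold dl in Hx; lra).
    apply Rinv_le_contravar; [exact Hdl|].
    pose proof (Cmod_circle_minus_ge r t x). unfold dl in *. lra. }
  replace (2 * PI * (G * M) * Cmod (y - z) ^ 2) with (Rabs (2 * PI - 0) * (G * (M * Cmod (y - z) ^ 2)))
    by (rewrite Rminus_0_r, Rabs_pos_eq by lra; ring).
  eapply Cmod_RInt_le_const.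
  2: exact (@is_RInt_minus C_R_NormedModule _ _ _ _ _ _
    (@is_RInt_minus C_R_NormedModule _ _ _ _ _ _ (cauchy_integral_correct m y Hyr)
      (cauchy_integral_correct m z Hz))
    (is_RInt_C_scal (y - z) _ _ _ _
      (is_RInt_C_scal (RtoC (INR m)) _ _ _ _ (cauchy_integral_correct (S m) z Hz)))).
  rewrite Rmin_left, Rmax_right by lra. intros t Ht.
  set (u := (/ (circle r t - y))%C). set (v := (/ (circle r t - z))%C).
  change (Cmod (g t * u ^ m - g t * v ^ m - (y - z) * (RtoC (INR m) * (g t * v ^ S m)))
    <= G * (M * Cmod (y - z) ^ 2)).
  replace (g t * u ^ m - g t * v ^ m - (y - z) * (RtoC (INR m) * (g t * v ^ S m)))%C
    with (g t * (u ^ m - v ^ m - (y - z) * (RtoC (INR m) * v ^ S m)))%C by ring.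
  rewrite Cmod_mult. apply Rmult_le_compat; [apply Cmod_ge_0..| |].
  - rewrite <- norm_C_R. apply Rlt_le, HG, Ht.
  - apply K; [apply Hinv; exact Hyz|apply Hinv; lra|].
    unfold u, v. field. split; now apply circle_minus_neq_0.
Qed.

End CauchyIntegral.

Fixpoint C_derive_n (f : C -> C) (n : nat) : C -> C :=
  match n with O => f | S m => C_derive (C_derive_n f m) end.

Section Derivatives.

Variables (f : C -> C) (c : C) (r : R).
Hypothesis r_gt_0 : 0 < r.
Hypothesis f_holomorphic : holomorphic_on f (fun y => Cmod (y - c) <= r).

Lemma continuous_circle_values (t : R) : continuous_path (fun t => f (c + circle r t) * circle r t)%C t.
Proof.
  apply continuous_Cmult; [|apply continuous_circle].
  apply (@continuous_comp R_UniformSpace C_UniformSpace C_UniformSpace (fun t => c + circle r t)%C f).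
  - apply continuous_Cplus; [apply continuous_const|apply continuous_circle].
  - apply (holomorphic_on_continuous f _ _ f_holomorphic).
    replace (c + circle r t - c)%C with (circle r t) by ring. rewrite Cmod_circle; lra.
Qed.

Definition cauchy_derivative (n : nat) (z : C) : C :=
  (RtoC (INR (fact n) / (2 * PI)) *
   cauchy_integral (fun t => f (c + circle r t) * circle r t) r (S n) (z - c))%C.

Lemma is_derive_C_cauchy_derivative (n : nat) (z : C) : Cmod (z - c) < r ->
  is_derive_C (cauchy_derivative n) z (cauchy_derivative (S n) z).
Proof.
  intros Hz. pose proof PI_RGT_0 as Hpi. unfold cauchy_derivative.
  evar_last.
  - apply is_derive_C_scal. apply (is_derive_C_comp _ (fun y => y - c)%C).
    + apply is_derive_C_cauchy_integral; [apply continuous_circle_values|exact Hz].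
    + apply (is_derive_C_shift (- c)%C).
  - rewrite fact_simpl, mult_INR.
    replace (INR (S n) * INR (fact n) / (2 * PI)) with (INR (fact n) / (2 * PI) * INR (S n))
      by (field; lra).
    rewrite RtoC_mult. ring.
Qed.

Lemma is_derive_C_eq_cauchy_derivative (h : C -> C) (n : nat) (z : C) :
  (forall y, Cmod (y - c) < r -> h y = cauchy_derivative n y) -> Cmod (z - c) < r ->
  is_derive_C h z (cauchy_derivative (S n) z).
Proof.
  intros Hh Hz.
  apply (is_derive_C_ext_disc (cauchy_derivative n) _ z _ (r - Cmod (z - c))); [lra|..].
  - intros y Hy. symmetry. apply Hh. pose proof (Cmod_minus_triangle y z c). lra.
  - now apply is_derive_C_cauchy_derivative.
Qed.

Lemma cauchy_derivative_0 (z : C) : Cmod (z - c) < r -> cauchy_derivative 0 z = f z.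
Proof.
  intros Hz. pose proof PI_RGT_0 as Hpi. unfold cauchy_derivative.
  replace (cauchy_integral _ r 1 (z - c)) with (RtoC (2 * PI) * f (c + (z - c)))%C.
  - rewrite Cmult_assoc, <- RtoC_mult. simpl.
    replace (1 / (2 * PI) * (2 * PI)) with 1 by (field; lra).
    replace (c + (z - c))%C with z by ring. ring.
  - eapply is_RInt_C_unique.
    + apply (cauchy_formula (fun y => f (c + y)%C) r (z - c)%C Hz).
      intros y Hy. destruct (f_holomorphic (c + y)%C) as [l Hl].
      { now replace (c + y - c)%C with y by ring. }
      exists (1 * l)%C. rewrite Cplus_comm in Hl.
      apply (is_derive_ext (V := C_NormedModule) (fun y => f (y + c)%C)).
      { intros x. now rewrite Cplus_comm. }
      apply (is_derive_C_comp f); [exact Hl|apply is_derive_C_shift].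
    + eapply is_RInt_C_ext; [|apply cauchy_integral_correct; [apply continuous_circle_values|exact Hz]].
      intros t. cbv beta. rewrite Cpow_1_r. ring.
Qed.

Lemma C_derive_n_cauchy (n : nat) (z : C) : Cmod (z - c) < r ->
  C_derive_n f n z = cauchy_derivative n z.
Proof.
  revert z. induction n as [|n IH]; intros z Hz; [symmetry; now apply cauchy_derivative_0|].
  now apply is_C_derive_unique, is_derive_C_eq_cauchy_derivative.
Qed.

Lemma cauchy_estimate (n : nat) (g : R -> R) (m : R) :
  (forall t, 0 <= t <= 2 * PI -> Cmod (f (c + circle r t)) <= g t) -> is_RInt g 0 (2 * PI) m ->
  Cmod (C_derive_n f n c) <= INR (fact n) * (m / (2 * PI)) / r ^ n.
Proof.
  intros Hg Hm. pose proof PI_RGT_0 as Hpi.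
  assert (Hc : Cmod (c - c) < r) by (replace (c - c)%C with (RtoC 0) by ring; now rewrite Cmod_0).
  rewrite (C_derive_n_cauchy n c Hc). unfold cauchy_derivative.
  assert (Hf : 0 < INR (fact n)) by apply INR_fact_lt_0.
  rewrite Cmod_mult, Cmod_R, Rabs_pos_eq by (apply Rlt_le, Rdiv_lt_0_compat; lra).
  replace (INR (fact n) * (m / (2 * PI)) / r ^ n) with (INR (fact n) / (2 * PI) * (/ r ^ n * m))
    by (field; split; [lra|apply pow_nonzero; lra]).
  apply Rmult_le_compat_l; [apply Rlt_le, Rdiv_lt_0_compat; lra|].
  apply (Cmod_RInt_le (fun t => f (c + circle r t) * circle r t * (/ (circle r t - (c - c))) ^ S n)%C
    (fun t => scal (/ r ^ n) (g t)) 0 (2 * PI)); [lra| |..].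
  - intros t Ht. replace (circle r t - (c - c))%C with (circle r t) by ring.
    rewrite !Cmod_mult, Cmod_pow, Cmod_inv, Cmod_circle
      by (lra || (apply Cmod_gt_0; rewrite Cmod_circle; lra)).
    unfold scal; simpl; unfold mult; simpl.
    replace (Cmod (f (c + circle r t)) * r * (/ r * (/ r) ^ n))
      with ((/ r) ^ n * Cmod (f (c + circle r t)))
      by (field; lra).
    rewrite pow_inv. apply Rmult_le_compat_l; [|now apply Hg].
    apply Rlt_le, Rinv_0_lt_compat, pow_lt, r_gt_0.
  - apply cauchy_integral_correct; [apply continuous_circle_values|exact Hc].
  - apply (@is_RInt_scal R_NormedModule), Hm.
Qed.

End Derivatives.

Lemma is_derive_C_derive_n (f : C -> C) (c : C) (r : R) (n : nat) (z : C) :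
  holomorphic_on f (fun y => Cmod (y - c) < r) -> Cmod (z - c) < r ->
  is_derive_C (C_derive_n f n) z (C_derive_n f (S n) z).
Proof.
  intros Hf Hz. pose proof (Cmod_ge_0 (z - c)) as P. set (r' := (Cmod (z - c) + r) / 2).
  assert (Hr' : 0 < r') by (unfold r'; lra).
  assert (Hf' : holomorphic_on f (fun y => Cmod (y - c) <= r')).
  { intros y Hy. apply Hf. unfold r' in Hy. lra. }
  assert (Hz' : Cmod (z - c) < r') by (unfold r'; lra).
  rewrite (C_derive_n_cauchy f c r' Hr' Hf' (S n) z Hz').
  apply is_derive_C_eq_cauchy_derivative; [assumption..| |assumption].
  now apply C_derive_n_cauchy.
Qed.

(** * Improper integrals *)

Record integration_domain (Fa Fb : (R -> Prop) -> Prop) (D : R -> Prop) : Prop := {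
  domain_convex : forall x y t, D x -> D y -> x <= t <= y -> D t;
  domain_left : Fa D;
  domain_right : Fb D;
  domain_ordered : filter_prod Fa Fb (fun ab => fst ab <= snd ab)
}.

Section ImproperIntegrals.

Context {Fa Fb : (R -> Prop) -> Prop} {FFa : ProperFilter Fa} {FFb : ProperFilter Fb} {D : R -> Prop}.
Hypothesis dom : integration_domain Fa Fb D.

Lemma domain_between (x y t : R) : D x -> D y -> Rmin x y <= t <= Rmax x y -> D t.
Proof.
  intros Hx Hy. unfold Rmin, Rmax. destruct (Rle_dec x y); intros Ht.
  - now apply (domain_convex _ _ _ dom x y).
  - now apply (domain_convex _ _ _ dom y x).
Qed.

Lemma domain_eventually : filter_prod Fa Fb (fun ab => D (fst ab) /\ D (snd ab)).
Proof. apply Filter_prod with D D; [apply dom|apply dom|]. now split. Qed.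

Lemma eventually_between (P : R -> Prop) : (forall t, D t -> P t) ->
  filter_prod Fa Fb (fun ab => forall t, Rmin (fst ab) (snd ab) <= t <= Rmax (fst ab) (snd ab) -> P t).
Proof.
  intros H. generalize domain_eventually. apply filter_imp. intros [x y] [Hx Hy] t Ht.
  apply H. now apply (domain_between x y).
Qed.

Lemma is_RInt_gen_filterlim {V : NormedModule R_AbsRing} (f : R -> V) (I : R * R -> V) (l : V) :
  filter_prod Fa Fb (fun ab => is_RInt f (fst ab) (snd ab) (I ab)) ->
  filterlim I (filter_prod Fa Fb) (locally l) -> is_RInt_gen f Fa Fb l.
Proof.
  intros HI Hl P HP. unfold filtermapi.
  eapply filter_imp; [|exact (filter_and (F := filter_prod Fa Fb) _ _ HI (Hl P HP))].
  intros ab [Hab HP_ab]. now exists (I ab).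
Qed.

Lemma is_RInt_gen_derive {V : CompleteNormedModule R_AbsRing} (F f : R -> V) (la lb : V) :
  (forall t, D t -> is_derive F t (f t)) -> (forall t, D t -> continuous f t) ->
  filterlim F Fa (locally la) -> filterlim F Fb (locally lb) ->
  is_RInt_gen f Fa Fb (minus lb la).
Proof.
  intros HF Hf Ha Hb.
  apply (is_RInt_gen_filterlim f (fun ab => minus (F (snd ab)) (F (fst ab)))).
  - generalize (filter_and _ _ (eventually_between _ HF) (eventually_between _ Hf)).
    apply filter_imp. intros [x y] [HFxy Hfxy]. now apply is_RInt_derive.
  - apply (filterlim_comp_2 (G := locally lb) (H := locally (opp la))
      (fun ab => F (snd ab)) (fun ab => opp (F (fst ab))) plus).
    + exact (filterlim_comp _ _ _ _ _ _ _ _ filterlim_snd Hb).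
    + apply (filterlim_comp _ _ _ (fun ab => F (fst ab)) opp _ (locally la)).
      * exact (filterlim_comp _ _ _ _ _ _ _ _ filterlim_fst Ha).
      * apply (filterlim_opp (V := V)).
    + apply (filterlim_plus (V := V)).
Qed.

Lemma is_RInt_gen_le (f g : R -> R) (lf lg : R) :
  (forall t, D t -> f t <= g t) ->
  is_RInt_gen f Fa Fb lf -> is_RInt_gen g Fa Fb lg -> lf <= lg.
Proof.
  intros H Hf Hg.
  assert (Hd : is_RInt_gen (fun t => g t - f t) Fa Fb (lg - lf))
    by exact (is_RInt_gen_minus (V := R_NormedModule) g f lg lf Hg Hf).
  assert (K : Rabs (lg - lf) <= lg - lf).
  { apply (RInt_gen_norm (V := R_CompleteNormedModule) (fun t => g t - f t) (fun t => g t - f t) _ _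
      (domain_ordered _ _ _ dom)); [|exact Hd|exact Hd].
    generalize (eventually_between _ H). apply filter_imp. intros [x y] Hxy t Ht.
    cbn [fst snd] in *. specialize (Hxy t). rewrite Rmin_left, Rmax_right in Hxy by lra.
    specialize (Hxy Ht). change (Rabs (g t - f t) <= g t - f t). rewrite Rabs_pos_eq; lra. }
  pose proof (Rabs_pos (lg - lf)). lra.
Qed.

Lemma is_RInt_domain {W : CompleteNormedModule R_AbsRing} (h : R -> W) (x y : R) :
  (forall t, D t -> continuous h t) -> D x -> D y -> is_RInt h x y (RInt h x y).
Proof.
  intros Hh Hx Hy. apply (RInt_correct h), (ex_RInt_continuous h). intros t Ht. apply Hh.
  now apply (domain_between x y).
Qed.

Section Domination.

Context {V : CompleteNormedModule R_AbsRing}.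
Variables (f : R -> V) (g : R -> R) (lg : R).
Hypothesis f_continuous : forall t, D t -> continuous f t.
Hypothesis g_continuous : forall t, D t -> continuous g t.
Hypothesis f_le_g : forall t, D t -> norm (f t) <= g t.
Hypothesis g_integrable : is_RInt_gen g Fa Fb lg.

Lemma norm_RInt_dominated (x y : R) : D x -> D y ->
  norm (RInt f x y) <= Rabs (RInt g x y).
Proof.
  assert (Hle : forall x y, D x -> D y -> x <= y -> norm (RInt f x y) <= Rabs (RInt g x y)).
  { intros u v Hu Hv Huv. eapply Rle_trans; [|apply Rle_abs].
    apply (norm_RInt_le f g u v); [exact Huv| |now apply is_RInt_domain|
      now apply (is_RInt_domain (W := R_CompleteNormedModule) g)].
    intros t Ht. apply f_le_g. now apply (domain_convex _ _ _ dom u v). }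
  intros Hx Hy. destruct (Rle_dec x y) as [H|H]; [now apply Hle|].
  rewrite <- (opp_RInt_swap f), <- (opp_RInt_swap (V := R_CompleteNormedModule) g)
    by (eexists; now apply is_RInt_domain).
  rewrite (norm_opp (V := V)). change (opp (RInt g y x)) with (- RInt g y x). rewrite Rabs_Ropp.
  apply Hle; (assumption || lra).
Qed.

Lemma RInt_gen_tails_small (eps : posreal) : exists A B : R -> Prop, Fa A /\ Fb B /\
  (forall x x', A x -> A x' -> D x /\ Rabs (RInt g x x') < eps) /\
  (forall y y', B y -> B y' -> D y /\ Rabs (RInt g y y') < eps).
Proof.
  pose proof (proj1 (filterlimi_locally _ _) g_integrable (pos_div_2 eps)) as H.
  destruct H as [A0 B0 HA0 HB0 H].
  assert (HA : Fa (fun x => A0 x /\ D x)) by (apply filter_and; [exact HA0|apply dom]).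
  assert (HB : Fb (fun y => B0 y /\ D y)) by (apply filter_and; [exact HB0|apply dom]).
  exists (fun x => A0 x /\ D x), (fun y => B0 y /\ D y). split; [exact HA|]. split; [exact HB|].
  assert (Hball : forall x y, (A0 x /\ D x) -> (B0 y /\ D y) -> Rabs (RInt g x y - lg) < eps / 2).
  { intros x y [Hx Dx] [Hy Dy]. destruct (H x y Hx Hy) as (I & HI & Hb).
    cbn [fst snd] in HI. rewrite (is_RInt_unique (V := R_CompleteNormedModule) _ _ _ _ HI). exact Hb. }
  assert (Chasles : forall x y z, D x -> D y -> D z -> RInt g x z = RInt g x y + RInt g y z).
  { intros x y z Hx Hy Hz. symmetry.
    apply (RInt_Chasles (V := R_CompleteNormedModule) g); eexists; now apply is_RInt_domain. }
  split.
  - destruct (filter_ex _ HB) as [y Hy]. intros x x' Hx Hx'. split; [apply Hx|].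
    pose proof (Hball x y Hx Hy) as near_lg. pose proof (Hball x' y Hx' Hy) as near_lg'.
    rewrite (Chasles x x' y) in near_lg by (apply Hx || apply Hx' || apply Hy).
    apply Rabs_def2 in near_lg. apply Rabs_def2 in near_lg'. apply Rabs_def1; lra.
  - destruct (filter_ex _ HA) as [x Hx]. intros y y' Hy Hy'. split; [apply Hy|].
    pose proof (Hball x y Hx Hy) as near_lg. pose proof (Hball x y' Hx Hy') as near_lg'.
    rewrite (Chasles x y y') in near_lg' by (apply Hx || apply Hy' || apply Hy).
    apply Rabs_def2 in near_lg. apply Rabs_def2 in near_lg'. apply Rabs_def1; lra.
Qed.

Lemma ex_RInt_gen_dominated : ex_RInt_gen f Fa Fb.
Proof.
  destruct (proj1 (filterlim_locally_cauchy (U := V) (F := filter_prod Fa Fb)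
    (fun ab => RInt f (fst ab) (snd ab)))) as [l Hl].
  - intros eps. destruct (RInt_gen_tails_small (pos_div_2 eps)) as (A & B & HA & HB & TA & TB).
    exists (fun ab => A (fst ab) /\ B (snd ab)). split; [now apply Filter_prod with A B|].
    intros [x y] [x' y'] [Hx Hy] [Hx' Hy']. cbn [fst snd] in *.
    destruct (TA x' x Hx' Hx) as [Dx' Tx]. destruct (TA x x Hx Hx) as [Dx _].
    destruct (TB y y' Hy Hy') as [Dy Ty]. destruct (TB y' y' Hy' Hy') as [Dy' _].
    apply (norm_compat1 (V := V) (RInt f x y) (RInt f x' y')).
    apply Rle_lt_trans with (norm (plus (RInt f x' x) (RInt f y y'))).
    + right. f_equal. rewrite <- (RInt_Chasles f x' x y'), <- (RInt_Chasles f x y y')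
        by (eexists; now apply is_RInt_domain).
      unfold minus. rewrite <- !plus_assoc. f_equal.
      now rewrite plus_comm, <- plus_assoc, plus_opp_l, plus_zero_r.
    + eapply Rle_lt_trans; [apply (norm_triangle (V := V))|].
      pose proof (norm_RInt_dominated x' x Dx' Dx). pose proof (norm_RInt_dominated y y' Dy Dy').
      simpl in Tx, Ty. lra.
  - exists l. apply (is_RInt_gen_filterlim f (fun ab => RInt f (fst ab) (snd ab))); [|exact Hl].
    generalize domain_eventually. apply filter_imp. intros [x y] [Hx Hy]. now apply is_RInt_domain.
Qed.

End Domination.

End ImproperIntegrals.

Lemma positive_half_line : integration_domain (at_right 0) (Rbar_locally p_infty) (fun t => 0 < t).
Proof.
  assert (pos_near_0 : at_right 0 (fun t => 0 < t)) by (now exists (mkposreal 1 Rlt_0_1)).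
  assert (pos_near_infty : Rbar_locally p_infty (fun t => 0 < t)) by (now exists 0).
  constructor; [intros; lra|exact pos_near_0|exact pos_near_infty|].
  apply Filter_prod with (fun t => t < 1) (fun t => 1 < t); [|now exists 1|simpl; intros; lra].
  exists (mkposreal 1 Rlt_0_1). intros t Ht Ht0. apply Rabs_def2 in Ht.
  unfold minus, plus, opp in Ht. simpl in Ht. lra.
Qed.

Lemma nonneg_half_line : integration_domain (at_point 0) (Rbar_locally p_infty) (fun t => 0 <= t).
Proof.
  constructor; [intros; lra|apply Rle_refl|exists 0; intros; lra|].
  apply Filter_prod with (fun t => t = 0) (fun t => 0 < t);
    [reflexivity|now exists 0|simpl; intros; lra].
Qed.

Section ComplexImproperIntegrals.

Context {Fa Fb : (R -> Prop) -> Prop} {FFa : ProperFilter Fa} {FFb : ProperFilter Fb}.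

Lemma is_RInt_gen_C_unique (f : R -> C) (l m : C) :
  is_RInt_gen_C f Fa Fb l -> is_RInt_gen_C f Fa Fb m -> l = m.
Proof.
  intros Hl Hm. rewrite <- (is_RInt_gen_unique (V := C_R_CompleteNormedModule) f l Hl).
  exact (is_RInt_gen_unique (V := C_R_CompleteNormedModule) f m Hm).
Qed.

Lemma is_RInt_gen_C_ext (f g : R -> C) (l : C) :
  (forall t, f t = g t) -> is_RInt_gen_C f Fa Fb l -> is_RInt_gen_C g Fa Fb l.
Proof. intros H. apply is_RInt_gen_ext, filter_forall. intros ab t _. apply H. Qed.

Lemma is_RInt_gen_C_scal (c : C) (f : R -> C) (l : C) :
  is_RInt_gen_C f Fa Fb l -> is_RInt_gen_C (fun t => c * f t)%C Fa Fb (c * l)%C.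
Proof.
  intros H P HP.
  assert (Hc : continuous_C (fun y => c * y)%C l)
    by (apply continuous_Cmult; [apply continuous_const|apply continuous_id]).
  unfold filtermapi. eapply filter_imp; [|exact (H _ (Hc P HP))]. intros ab (I & HI & HPI).
  exists (c * I)%C. split; [now apply is_RInt_C_scal|exact HPI].
Qed.

Lemma is_RInt_gen_C_Re (f : R -> C) (l : C) :
  is_RInt_gen_C f Fa Fb l -> is_RInt_gen (fun t => Re (f t)) Fa Fb (Re l).
Proof.
  intros H P HP. unfold filtermapi.
  eapply filter_imp; [|exact (H (fun y => P (Re y))
    (@continuous_fst R_UniformSpace R_UniformSpace (fst l) (snd l) P HP))]. intros ab (I & HI & HPI).
  exists (Re I). split; [now apply is_RInt_C_Re|exact HPI].
Qed.

End ComplexImproperIntegrals.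

Lemma is_RInt_gen_dilation {V : NormedModule R_AbsRing} (f : R -> V) (k : R) (l : V) :
  0 < k -> is_RInt_gen f (at_point 0) (Rbar_locally p_infty) l ->
  is_RInt_gen (fun t => scal k (f (k * t))) (at_point 0) (Rbar_locally p_infty) l.
Proof.
  intros Hk H P HP. destruct (H P HP) as [A B HA [M HM] HAB].
  apply Filter_prod with (fun t => t = 0) (fun t => M / k < t); [reflexivity|now exists (M / k)|].
  intros x y -> Hy. destruct (HAB 0 (k * y) HA) as (I & HI & HPI).
  { apply HM. apply Rlt_div_l in Hy; lra. }
  exists I. split; [|exact HPI]. cbn [fst snd] in *.
  eapply is_RInt_ext; [|apply (is_RInt_comp_lin f k 0); rewrite Rmult_0_r, !Rplus_0_r; exact HI].
  intros t _. cbv beta. now rewrite Rplus_0_r.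
Qed.

Lemma filterlim_C_0 {T : Type} {F : (T -> Prop) -> Prop} {FF : Filter F} (f : T -> C) :
  filterlim (fun t => Cmod (f t)) F (locally 0) -> filterlim f F (locally (0 : C)).
Proof.
  intros H. apply (filterlim_norm_zero (V := C_R_NormedModule)).
  eapply filterlim_ext; [|exact H]. intros t. symmetry. apply norm_C_R.
Qed.

Lemma filterlim_exp_m_infty {T : Type} {F : (T -> Prop) -> Prop} {FF : Filter F} (f : T -> R) :
  filterlim f F (Rbar_locally m_infty) -> filterlim (fun t => exp (f t)) F (locally 0).
Proof. intros H. exact (filterlim_comp _ _ _ _ _ _ _ _ H is_lim_exp_m). Qed.

(** * The Gamma function *)

Definition gamma_integrand (w : C) (t : R) : C :=
  (Cexp ((w - 1) * RtoC (ln t)) * RtoC (exp (- t)))%C.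

Lemma Cmod_gamma_integrand (w : C) (t : R) :
  Cmod (gamma_integrand w t) = exp ((Re w - 1) * ln t - t).
Proof.
  unfold gamma_integrand. rewrite Cmod_mult, Cmod_Cexp, Cmod_R, Rabs_pos_eq by (apply Rlt_le, exp_pos).
  now rewrite re_scal_r, <- exp_plus.
Qed.

Lemma Cexp_mult_ln_S (w : C) (t : R) : 0 < t ->
  Cexp ((w + 1) * RtoC (ln t)) = (RtoC t * Cexp (w * RtoC (ln t)))%C.
Proof.
  intros Ht. rewrite Cmult_plus_distr_r, Cexp_plus, Cmult_1_l, Cexp_RtoC, exp_ln by exact Ht.
  apply Cmult_comm.
Qed.

Lemma gamma_integrand_S (w : C) (t : R) : 0 < t ->
  gamma_integrand (w + 1) t = (RtoC t * gamma_integrand w t)%C.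
Proof.
  intros Ht. unfold gamma_integrand.
  replace (w + 1 - 1)%C with (w - 1 + 1)%C by ring. rewrite Cexp_mult_ln_S by exact Ht. ring.
Qed.

Lemma gamma_integrand_RtoC (x t : R) : gamma_integrand (RtoC x) t = RtoC (exp ((x - 1) * ln t - t)).
Proof.
  unfold gamma_integrand. rewrite <- RtoC_minus, <- RtoC_mult, Cexp_RtoC, <- RtoC_mult, <- exp_plus.
  reflexivity.
Qed.

Lemma is_derive_path_gamma_integrand (w : C) (t : R) : 0 < t ->
  is_derive_path (gamma_integrand (w + 1)) t (w * gamma_integrand w t - gamma_integrand (w + 1) t)%C.
Proof.
  intros Ht. evar_last.
  - apply is_derive_path_mult.
    + apply (@is_derive_comp R_AbsRing C_R_NormedModule (fun u => Cexp ((w + 1 - 1) * RtoC u))%C ln).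
      * apply is_derive_path_Cexp_line.
      * now apply is_derive_ln.
    + apply (is_derive_path_RtoC (fun t => exp (- t)) t (- exp (- t))). auto_derive; [exact I|ring].
  - rewrite scal_R_Cmult, RtoC_opp, (gamma_integrand_S w t Ht). unfold gamma_integrand.
    replace (w + 1 - 1)%C with (w - 1 + 1)%C by ring. rewrite Cexp_mult_ln_S, RtoC_inv by lra.
    field. intros E. apply RtoC_inj in E. lra.
Qed.

Lemma continuous_gamma_integrand (w : C) (t : R) : 0 < t -> continuous_path (gamma_integrand w) t.
Proof.
  intros Ht. replace w with (w - 1 + 1)%C by ring.
  eapply is_derive_path_continuous, is_derive_path_gamma_integrand, Ht.
Qed.

(* From [ln u <= u - 1] at [u = t / (2 x)]. *)
Lemma mult_ln_le (x t : R) : 0 < x -> 0 < t -> x * ln t <= x * ln (2 * x) - x + t / 2.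
Proof.
  intros Hx Ht. assert (P : 0 < t / (2 * x)) by (apply Rdiv_lt_0_compat; lra).
  pose proof (exp_ineq1_le (ln (t / (2 * x)))) as K. rewrite exp_ln, ln_div in K by lra.
  replace (x * ln (2 * x) - x + t / 2) with (x * (ln (2 * x) + (t / (2 * x) - 1))) by (field; lra).
  apply Rmult_le_compat_l; lra.
Qed.

Lemma filterlim_mult_ln_0 (x : R) : 0 < x ->
  filterlim (fun t => x * ln t) (at_right 0) (Rbar_locally m_infty).
Proof.
  intros Hx. eapply filterlim_comp; [exact is_lim_ln_0|].
  pose proof (filterlim_Rbar_mult_l x m_infty) as H.
  replace (Rbar_mult x m_infty) with m_infty in H; [exact H|]. symmetry.
  apply is_Rbar_mult_unique, is_Rbar_mult_sym, is_Rbar_mult_m_infty_pos. exact Hx.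
Qed.

Lemma filterlim_mult_ln_infty (x : R) : 0 < x ->
  filterlim (fun t => x * ln t) (Rbar_locally p_infty) (Rbar_locally p_infty).
Proof.
  intros Hx. eapply filterlim_comp; [exact is_lim_ln_p|].
  pose proof (filterlim_Rbar_mult_l x p_infty) as H.
  replace (Rbar_mult x p_infty) with p_infty in H; [exact H|]. symmetry.
  apply is_Rbar_mult_unique, is_Rbar_mult_sym, is_Rbar_mult_p_infty_pos. exact Hx.
Qed.

Lemma gamma_integrand_S_lim_0 (w : C) : 0 < Re w ->
  filterlim (gamma_integrand (w + 1)) (at_right 0) (locally (0 : C)).
Proof.
  intros Hw. apply filterlim_C_0.
  eapply filterlim_ext; [intros t; symmetry; apply Cmod_gamma_integrand|].
  apply filterlim_exp_m_infty.
  eapply filterlim_le_m_infty; [|exact (filterlim_mult_ln_0 (Re w) Hw)].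
  eapply filter_imp; [|exact (domain_left _ _ _ positive_half_line)].
  intros t Ht. rewrite re_plus, re_RtoC. lra.
Qed.

Lemma gamma_integrand_S_lim_infty (w : C) : 0 < Re w ->
  filterlim (gamma_integrand (w + 1)) (Rbar_locally p_infty) (locally (0 : C)).
Proof.
  intros Hw. set (x := Re w) in *. apply filterlim_C_0.
  eapply filterlim_ext; [intros t; symmetry; apply Cmod_gamma_integrand|].
  apply filterlim_exp_m_infty. intros P [M HM].
  exists (Rmax 0 (2 * (x * ln (2 * x) - x - M))). intros t Ht. apply HM.
  rewrite re_plus, re_RtoC. fold x.
  pose proof (Rmax_l 0 (2 * (x * ln (2 * x) - x - M))).
  pose proof (Rmax_r 0 (2 * (x * ln (2 * x) - x - M))).
  pose proof (mult_ln_le x t Hw). lra.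
Qed.

Section GammaConvergence.

Variable x : R.
Hypothesis x_pos : 0 < x.

(* The derivative [x t^(x-1) / (1 + t^x)^2] of [- 1 / (1 + t^x)]. *)
Definition gamma_majorant (t : R) : R := x * exp ((x - 1) * ln t) / (1 + exp (x * ln t)) ^ 2.

Lemma is_derive_gamma_majorant (t : R) : 0 < t ->
  is_derive (fun t => - / (1 + exp (x * ln t))) t (gamma_majorant t).
Proof.
  intros Ht. unfold gamma_majorant. pose proof (exp_pos (x * ln t)).
  auto_derive; [split; [exact Ht|split; [lra|exact I]]|].
  replace ((x - 1) * ln t) with (x * ln t - ln t) by ring.
  unfold Rminus. rewrite exp_plus, exp_Ropp, exp_ln by exact Ht. simpl. field. lra.
Qed.

Lemma continuous_gamma_majorant (t : R) : 0 < t -> continuous gamma_majorant t.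
Proof.
  intros Ht. pose proof (exp_pos (x * ln t)).
  apply (@ex_derive_continuous R_AbsRing R_NormedModule). unfold gamma_majorant. auto_derive.
  repeat split; try exact Ht. apply Rgt_not_eq. nra.
Qed.

Lemma is_RInt_gen_gamma_majorant :
  is_RInt_gen gamma_majorant (at_right 0) (Rbar_locally p_infty) (- 0 - - / (1 + 0)).
Proof.
  apply (is_RInt_gen_derive (V := R_CompleteNormedModule) positive_half_line
    (fun t => - / (1 + exp (x * ln t)))).
  - apply is_derive_gamma_majorant.
  - apply continuous_gamma_majorant.
  - apply (filterlim_comp _ _ _ (fun t => exp (x * ln t)) (fun u => - / (1 + u)) _ (locally 0)).
    + now apply filterlim_exp_m_infty, filterlim_mult_ln_0.
    + apply (@ex_derive_continuous R_AbsRing R_NormedModule (fun u => - / (1 + u))). auto_derive. lra.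
  - apply (filterlim_comp _ _ _ (fun t => / (1 + exp (x * ln t))) Ropp _ (locally 0));
      [|exact (filterlim_opp (V := R_NormedModule) 0)].
    apply (filterlim_comp _ _ _ (fun t => 1 + exp (x * ln t)) Rinv _ (Rbar_locally p_infty));
      [|now apply (filterlim_Rbar_inv p_infty)].
    eapply filterlim_ge_p_infty with (f := fun t => exp (x * ln t)).
    + apply filter_forall. intros t. lra.
    + exact (filterlim_comp _ _ _ _ _ _ _ _ (filterlim_mult_ln_infty x x_pos) is_lim_exp_p).
Qed.

Lemma gamma_integrand_le_majorant (t : R) : 0 < t ->
  exp ((x - 1) * ln t - t)
    <= (1 + exp (x * ln (2 * x) - x)) ^ 2 / x * gamma_majorant t.
Proof.
  intros Ht. unfold gamma_majorant. set (K := exp (x * ln (2 * x) - x)).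
  assert (HK : 0 < K) by apply exp_pos. pose proof (exp_pos (x * ln t)) as HT.
  assert (HE : exp t = exp (t / 2) ^ 2) by (simpl; rewrite Rmult_1_r, <- exp_plus; f_equal; field).
  assert (B : 0 <= 1 + exp (x * ln t) <= (1 + K) * exp (t / 2)).
  { assert (1 <= exp (t / 2)) by (rewrite <- exp_0; apply exp_le_compat; lra).
    assert (exp (x * ln t) <= K * exp (t / 2)); [|split; lra].
    unfold K. rewrite <- exp_plus. now apply exp_le_compat, mult_ln_le. }
  apply (pow_incr _ _ 2) in B. rewrite Rpow_mult_distr, <- HE in B.
  unfold Rminus at 1. rewrite exp_plus, exp_Ropp.
  replace ((1 + K) ^ 2 / x * (x * exp ((x - 1) * ln t) / (1 + exp (x * ln t)) ^ 2))
    with (exp ((x - 1) * ln t) * ((1 + K) ^ 2 / (1 + exp (x * ln t)) ^ 2)) by (field; lra).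
  apply Rmult_le_compat_l; [apply Rlt_le, exp_pos|].
  apply Rle_div_r; [apply pow_lt; lra|]. rewrite Rmult_comm.
  apply Rle_div_l; [apply exp_pos|]. exact B.
Qed.

End GammaConvergence.

Lemma Cgamma_correct (w : C) : 0 < Re w ->
  is_RInt_gen_C (gamma_integrand w) (at_right 0) (Rbar_locally p_infty) (Cgamma w).
Proof.
  intros Hw. apply (RInt_gen_correct (V := C_R_CompleteNormedModule)).
  set (x := Re w) in *.
  eapply (ex_RInt_gen_dominated (V := C_R_CompleteNormedModule) positive_half_line (gamma_integrand w)
    (fun t => scal ((1 + exp (x * ln (2 * x) - x)) ^ 2 / x) (gamma_majorant x t))).
  - intros t Ht. now apply continuous_gamma_integrand.
  - intros t Ht. now apply (continuous_scal_r (V := R_NormedModule)), continuous_gamma_majorant.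
  - intros t Ht. change (norm _) with (@norm R_AbsRing C_R_NormedModule (gamma_integrand w t)).
    rewrite norm_C_R, Cmod_gamma_integrand. now apply gamma_integrand_le_majorant.
  - apply (is_RInt_gen_scal (V := R_NormedModule)). now apply is_RInt_gen_gamma_majorant.
Qed.

Lemma Cgamma_S (w : C) : 0 < Re w -> Cgamma (w + 1) = (w * Cgamma w)%C.
Proof.
  intros Hw.
  assert (Hw1 : 0 < Re (w + 1)) by (rewrite re_plus, re_RtoC; lra).
  assert (K : is_RInt_gen_C (fun t => w * gamma_integrand w t - gamma_integrand (w + 1) t)%C
    (at_right 0) (Rbar_locally p_infty) (0 - 0)%C).
  { apply (is_RInt_gen_derive (V := C_R_CompleteNormedModule) positive_half_line
      (gamma_integrand (w + 1))).
    - apply is_derive_path_gamma_integrand.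
    - intros t Ht. apply continuous_Cminus; [|now apply continuous_gamma_integrand].
      apply continuous_Cmult; [apply continuous_const|now apply continuous_gamma_integrand].
    - now apply gamma_integrand_S_lim_0.
    - now apply gamma_integrand_S_lim_infty. }
  pose proof (is_RInt_gen_C_unique _ _ _ K (is_RInt_gen_minus (V := C_R_NormedModule) _ _ _ _
    (is_RInt_gen_C_scal w _ _ (Cgamma_correct w Hw)) (Cgamma_correct _ Hw1))) as E.
  change (0 - 0 = w * Cgamma w - Cgamma (w + 1))%C in E.
  symmetry. apply Ceq_minus. rewrite <- E. ring.
Qed.

Lemma Cgamma_1 : Cgamma 1 = 1.
Proof.
  assert (K : is_RInt_gen_C (gamma_integrand 1) (at_right 0) (Rbar_locally p_infty) (0 - - (1))%C).
  { apply (is_RInt_gen_derive (V := C_R_CompleteNormedModule) positive_half_line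
      (fun t => RtoC (- exp (- t)))).
    - intros t Ht. evar_last; [apply (is_derive_path_RtoC _ t (exp (- t)))|].
      + auto_derive; [exact I|ring].
      + rewrite gamma_integrand_RtoC. do 2 f_equal. ring.
    - intros t Ht. now apply continuous_gamma_integrand.
    - replace (- (1))%C with (RtoC (- exp (- 0))) by (rewrite Ropp_0, exp_0; apply RtoC_opp).
      apply (filterlim_filter_le_1 (F := locally 0)); [apply filter_le_within|].
      apply (continuous_RtoC (fun t => - exp (- t)) 0).
      apply (@ex_derive_continuous R_AbsRing R_NormedModule (fun t => - exp (- t))).
      auto_derive. exact I.
    - apply filterlim_C_0. eapply filterlim_ext.
      { intros t. symmetry. rewrite Cmod_R, Rabs_Ropp, Rabs_pos_eq by (apply Rlt_le, exp_pos).
        reflexivity. }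
      apply filterlim_exp_m_infty. exact (filterlim_Rbar_opp p_infty). }
  rewrite <- (is_RInt_gen_C_unique _ _ _ K (Cgamma_correct 1 Rlt_0_1)). ring.
Qed.

Lemma Cgamma_INR_S (n : nat) : Cgamma (RtoC (INR (S n))) = RtoC (INR (fact n)).
Proof.
  induction n as [|n IH]; [exact Cgamma_1|].
  rewrite S_INR, RtoC_plus, Cgamma_S, IH, fact_simpl, mult_INR, RtoC_mult; [reflexivity|].
  apply lt_0_INR, Nat.lt_0_succ.
Qed.

Lemma is_RInt_gen_gamma_integrand_real (x : R) : 0 < x ->
  is_RInt_gen (fun t => exp ((x - 1) * ln t - t)) (at_right 0) (Rbar_locally p_infty)
    (Re (Cgamma (RtoC x))).
Proof.
  intros Hx. eapply is_RInt_gen_ext; [|exact (is_RInt_gen_C_Re _ _ (Cgamma_correct (RtoC x) Hx))].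
  apply filter_forall. intros ab t _. now rewrite gamma_integrand_RtoC.
Qed.

Lemma Re_Cgamma_S (x : R) : 0 < x -> Re (Cgamma (RtoC (x + 1))) = x * Re (Cgamma (RtoC x)).
Proof. intros Hx. now rewrite RtoC_plus, Cgamma_S, re_scal_l. Qed.

Lemma Re_Cgamma_ge_1 (x : R) : 2 <= x -> 1 <= Re (Cgamma (RtoC x)).
Proof.
  intros Hx.
  assert (Gamma_1 : Re (Cgamma (RtoC 1)) = 1) by (now rewrite Cgamma_1).
  assert (Gamma_2 : Re (Cgamma (RtoC (1 + 1))) = 1) by (rewrite Re_Cgamma_S, Gamma_1; lra).
  replace 1 with (minus (scal (x - 1) (Re (Cgamma (RtoC (1 + 1)))))
    (scal (x - 2) (Re (Cgamma (RtoC 1))))).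
  2: { rewrite Gamma_1, Gamma_2. unfold minus, plus, opp, scal, mult; simpl. unfold mult; simpl. ring. }
  eapply (is_RInt_gen_le positive_half_line); [|apply (is_RInt_gen_minus (V := R_NormedModule));
    apply (is_RInt_gen_scal (V := R_NormedModule)); apply is_RInt_gen_gamma_integrand_real; lra|
    apply is_RInt_gen_gamma_integrand_real; lra].
  intros t Ht.
  change ((x - 1) * exp ((1 + 1 - 1) * ln t - t) - (x - 2) * exp ((1 - 1) * ln t - t)
    <= exp ((x - 1) * ln t - t)).
  replace ((1 + 1 - 1) * ln t - t) with (ln t + - t) by ring.
  replace ((1 - 1) * ln t - t) with (- t) by ring.
  replace ((x - 1) * ln t - t) with (ln t + - t + (x - 2) * ln t) by ring.
  rewrite (exp_plus (ln t + - t)), (exp_plus (ln t)), exp_ln by exact Ht.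
  (* [t^(x-2) >= 1 + (x-2) ln t >= 1 + (x-2) (1 - 1/t)] *)
  assert (L : 1 - / t <= ln t).
  { pose proof (exp_ineq1_le (- ln t)) as K. rewrite exp_Ropp, exp_ln in K by exact Ht. lra. }
  pose proof (exp_ineq1_le ((x - 2) * ln t)) as K.
  replace ((x - 1) * (t * exp (- t)) - (x - 2) * exp (- t))
    with (t * exp (- t) * (1 + (x - 2) * (1 - / t))) by (field; lra).
  apply Rmult_le_compat_l; [apply Rmult_le_pos; [lra|apply Rlt_le, exp_pos]|].
  assert ((x - 2) * (1 - / t) <= (x - 2) * ln t) by (apply Rmult_le_compat_l; lra). lra.
Qed.

Lemma cos_ge_quadratic (v : R) : 1 - v ^ 2 / 2 <= cos v.
Proof.
  assert (K : Rabs (sin (v / 2)) <= Rabs (v / 2)).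
  { pose proof (bounded_variation sin cos 1 0 (v / 2)) as B. rewrite sin_0, !Rminus_0_r, Rmult_1_l in B.
    apply B. intros t _. split; [apply is_derive_sin|]. pose proof (COS_bound t). now apply Rabs_le. }
  apply Rsqr_le_abs_1 in K. unfold Rsqr in K.
  replace v with (2 * (v / 2)) at 2 by field. rewrite cos_2a_sin. lra.
Qed.

Lemma sinh_ge (q : R) : 0 <= q -> q <= sinh q.
Proof.
  intros Hq. unfold sinh. pose proof (exp_ge_taylor q 2 Hq) as K. simpl in K.
  rewrite exp_Ropp. set (E := exp q) in *. assert (HE : 0 < E) by apply exp_pos.
  assert (KE : 1 + q ^ 2 / 2 <= E - q) by lra.
  assert (1 + q ^ 2 <= (E - q) ^ 2).
  { apply Rle_trans with ((1 + q ^ 2 / 2) ^ 2); [pose proof (pow2_ge_0 (q ^ 2)); nra|].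
    apply pow_incr. pose proof (pow2_ge_0 q). lra. }
  apply (Rmult_le_reg_r (2 * E)); [lra|].
  replace ((E - / E) / 2 * (2 * E)) with ((E - q) ^ 2 - 1 - q ^ 2 + q * (2 * E)) by (field; lra). lra.
Qed.

Lemma cosh_half_angle (v : R) : cosh v = 1 + 2 * sinh (v / 2) ^ 2.
Proof.
  unfold cosh, sinh. replace v with (v / 2 + v / 2) at 1 2 by field.
  rewrite Ropp_plus_distr, !exp_plus, exp_Ropp. pose proof (exp_pos (v / 2)). field. lra.
Qed.

Lemma cosh_ge_quadratic (v : R) : 1 + v ^ 2 / 2 <= cosh v.
Proof.
  rewrite cosh_half_angle.
  assert (K : forall u, 0 <= u -> u ^ 2 <= sinh u ^ 2)
    by (intros u Hu; apply pow_incr; split; [exact Hu|now apply sinh_ge]).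
  destruct (Rle_dec 0 v) as [Hv|Hv].
  - specialize (K (v / 2) ltac:(lra)). lra.
  - specialize (K (- (v / 2)) ltac:(lra)). unfold sinh in *. rewrite Ropp_involutive in K. nra.
Qed.

Lemma Re_rotated_gamma_integrand (x y t : R) :
  Re (Cexp (- Ci * RtoC (y * ln x)) * gamma_integrand (x, y) t)
  = exp ((x - 1) * ln t - t) * cos (y * (ln t - ln x)).
Proof.
  unfold gamma_integrand. rewrite Cmult_assoc, <- Cexp_plus, re_scal_r.
  set (s := (- Ci * RtoC (y * ln x) + ((x, y) - 1) * RtoC (ln t))%C).
  change (Re (Cexp s)) with (exp (Re s) * cos (Im s)).
  replace (Re s) with ((x - 1) * ln t) by (unfold s; simpl; ring).
  replace (Im s) with (y * (ln t - ln x)) by (unfold s; simpl; ring).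
  replace ((x - 1) * ln t - t) with ((x - 1) * ln t + - t) by ring. rewrite exp_plus. ring.
Qed.

Lemma cos_mult_ln_ge (x y t : R) : 0 < x -> 0 < t ->
  1 + 2 * (y ^ 2 / 2) - y ^ 2 / 2 / x * t - y ^ 2 / 2 * x * / t <= cos (y * (ln t - ln x)).
Proof.
  intros Hx Ht. eapply Rle_trans; [|apply cos_ge_quadratic].
  pose proof (cosh_ge_quadratic (ln t - ln x)) as K. unfold cosh in K.
  replace (exp (- (ln t - ln x))) with (x * / t) in K
    by (rewrite Ropp_minus_distr, <- ln_div, exp_ln by lra || (apply Rdiv_lt_0_compat; lra);
      reflexivity).
  replace (exp (ln t - ln x)) with (t / x) in K
    by (rewrite <- ln_div, exp_ln by lra || (apply Rdiv_lt_0_compat; lra); reflexivity).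
  replace (1 - (y * (ln t - ln x)) ^ 2 / 2) with (1 - y ^ 2 / 2 * (ln t - ln x) ^ 2) by field.
  apply (Rmult_le_compat_l (y ^ 2 / 2)) in K; [|pose proof (pow2_ge_0 y); lra].
  replace (y ^ 2 / 2 / x * t) with (y ^ 2 / 2 * (t / x)) by (field; lra). lra.
Qed.

(* The mass of [t^(x-1) e^(-t)] concentrates near [t = x], where [(t / x)^(i y)] is close to [1]. *)
Lemma Re_rotated_Cgamma_ge (x y : R) : 1 < x ->
  Re (Cgamma (RtoC x)) * (1 - y ^ 2 / 2 / (x - 1))
    <= Re (Cexp (- Ci * RtoC (y * ln x)) * Cgamma (x, y)).
Proof.
  intros Hx. set (q := y ^ 2 / 2). set (G := Re (Cgamma (RtoC x))).
  replace (G * (1 - q / (x - 1)))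
    with (minus (minus (scal (1 + 2 * q) G) (scal (q / x) (Re (Cgamma (RtoC (x + 1))))))
      (scal (q * x) (Re (Cgamma (RtoC (x - 1)))))).
  2: { assert (E : G = (x - 1) * Re (Cgamma (RtoC (x - 1)))).
       { unfold G. rewrite <- Re_Cgamma_S by lra. do 3 f_equal. ring. }
       rewrite Re_Cgamma_S by lra. fold G.
       replace (Re (Cgamma (RtoC (x - 1)))) with (G / (x - 1)) by (rewrite E; field; lra).
       unfold minus, plus, opp, scal, mult; simpl. unfold mult; simpl. field. lra. }
  eapply (is_RInt_gen_le positive_half_line).
  2: { apply (is_RInt_gen_minus (V := R_NormedModule));
         [apply (is_RInt_gen_minus (V := R_NormedModule))|];
         apply (is_RInt_gen_scal (V := R_NormedModule)); apply is_RInt_gen_gamma_integrand_real; lra. }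
  2: { apply is_RInt_gen_C_Re, is_RInt_gen_C_scal, Cgamma_correct. simpl. lra. }
  intros t Ht. cbv beta. rewrite Re_rotated_gamma_integrand.
  set (e := exp ((x - 1) * ln t - t)).
  change ((1 + 2 * q) * e - q / x * exp ((x + 1 - 1) * ln t - t) - q * x * exp ((x - 1 - 1) * ln t - t)
    <= e * cos (y * (ln t - ln x))).
  replace ((x + 1 - 1) * ln t - t) with (ln t + ((x - 1) * ln t - t)) by ring.
  replace ((x - 1 - 1) * ln t - t) with (- ln t + ((x - 1) * ln t - t)) by ring.
  rewrite !exp_plus, exp_Ropp, exp_ln by exact Ht. fold e.
  replace ((1 + 2 * q) * e - q / x * (t * e) - q * x * (/ t * e))
    with (e * (1 + 2 * q - q / x * t - q * x * / t)) by ring.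
  apply Rmult_le_compat_l; [apply Rlt_le, exp_pos|]. apply cos_mult_ln_ge; lra.
Qed.

Lemma Cgamma_neq_0_of_large_Re (w : C) : 2 + Im w ^ 2 <= Re w -> Cgamma w <> 0.
Proof.
  destruct w as [x y]. simpl Re. simpl Im. intros Hx E.
  assert (Hy : 0 <= y ^ 2) by apply pow2_ge_0.
  pose proof (Re_rotated_Cgamma_ge x y ltac:(lra)) as K. rewrite E, Cmult_0_r in K. simpl (Re 0) in K.
  pose proof (Re_Cgamma_ge_1 x ltac:(lra)) as Gamma_ge_1.
  assert (y ^ 2 / 2 / (x - 1) <= / 2).
  { apply Rle_div_l; lra. }
  nra.
Qed.

Fixpoint pochhammer (w : C) (n : nat) : C :=
  match n with O => RtoC 1 | S m => (pochhammer w m * (w + RtoC (INR m)))%C end.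

Lemma Re_plus_INR_pos (w : C) (n : nat) : 0 < Re w -> 0 < Re (w + RtoC (INR n)).
Proof. intros Hw. rewrite re_plus, re_RtoC. pose proof (pos_INR n). lra. Qed.

Lemma pochhammer_neq_0 (w : C) (n : nat) : 0 < Re w -> pochhammer w n <> 0.
Proof.
  intros Hw. induction n as [|n IH]; simpl; [exact C1_nz|].
  apply Cmult_neq_0; [exact IH|]. now apply Re_pos_neq_0, Re_plus_INR_pos.
Qed.

Lemma Cgamma_plus_INR (w : C) (n : nat) : 0 < Re w ->
  Cgamma (w + RtoC (INR n)) = (pochhammer w n * Cgamma w)%C.
Proof.
  intros Hw. induction n as [|n IH].
  - simpl. rewrite Cplus_0_r. ring.
  - rewrite S_INR, RtoC_plus, Cplus_assoc, Cgamma_S, IH by now apply Re_plus_INR_pos.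
    simpl. ring.
Qed.

Lemma Cgamma_neq_0 (w : C) : 0 < Re w -> Cgamma w <> 0.
Proof.
  intros Hw E. destruct (INR_unbounded (2 + Im w ^ 2)) as [n Hn].
  apply (Cgamma_neq_0_of_large_Re (w + RtoC (INR n))).
  - rewrite re_plus, im_plus, re_RtoC, im_RtoC, Rplus_0_r. lra.
  - rewrite Cgamma_plus_INR, E by exact Hw. ring.
Qed.

Lemma Cgamma_ratio (w : C) (n : nat) : 0 < Re w ->
  (Cgamma w * Cgamma (RtoC (INR (S n))) / Cgamma (w + RtoC (INR (S n))))%C
  = (RtoC (INR (fact n)) / pochhammer w (S n))%C.
Proof.
  intros Hw. rewrite Cgamma_INR_S, Cgamma_plus_INR by exact Hw.
  field. split; [now apply pochhammer_neq_0|now apply Cgamma_neq_0].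
Qed.

(** * Means of [exp (beta |log|)] over circles about [1] *)

Definition log_mean (beta al : R) : R :=
  RInt (fun t => exp (beta * Cmod (Clog (1 + circle al t)))) 0 (2 * PI) / (2 * PI).

Lemma continuous_Cmod (f : R -> C) (t : R) :
  continuous_path f t -> continuous (fun t => Cmod (f t)) t.
Proof.
  intros Hf. apply (continuous_ext (fun t => @norm R_AbsRing C_R_NormedModule (f t))).
  { intros u. apply norm_C_R. }
  exact (@filterlim_comp _ _ _ f (@norm R_AbsRing C_R_NormedModule) _ _ _ Hf
    (@filterlim_norm R_AbsRing C_R_NormedModule (f t))).
Qed.

Lemma Re_1_plus_circle_pos (al t : R) : 0 <= al < 1 -> 0 < Re (1 + circle al t).
Proof. intros Hal. apply Re_1_plus_pos. rewrite Cmod_circle; lra. Qed.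

Lemma log_mean_correct (beta al : R) : 0 <= al < 1 ->
  is_RInt (fun t => exp (beta * Cmod (Clog (1 + circle al t)))) 0 (2 * PI) (2 * PI * log_mean beta al).
Proof.
  intros Hal. pose proof PI_RGT_0 as Hpi.
  assert (E : 2 * PI * log_mean beta al
    = RInt (fun t => exp (beta * Cmod (Clog (1 + circle al t)))) 0 (2 * PI))
    by (unfold log_mean; field; lra).
  rewrite E.
  apply (RInt_correct (V := R_CompleteNormedModule)),
    (ex_RInt_continuous (V := R_CompleteNormedModule)).
  intros t _. apply continuous_exp_comp, (continuous_scal_r (V := R_NormedModule)), continuous_Cmod.
  apply (@continuous_comp R_UniformSpace C_UniformSpace C_UniformSpace
    (fun t => 1 + circle al t)%C Clog).
  - apply continuous_Cplus; [apply continuous_const|apply continuous_circle].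
  - eapply is_derive_C_continuous, is_derive_C_Clog. now apply Re_1_plus_circle_pos.
Qed.

Lemma log_mean_le (beta al m : R) (g : R -> R) : 0 <= al < 1 ->
  (forall t, 0 <= t <= 2 * PI -> exp (beta * Cmod (Clog (1 + circle al t))) <= g t) ->
  is_RInt g 0 (2 * PI) m -> log_mean beta al <= m / (2 * PI).
Proof.
  intros Hal Hg Hm. pose proof PI_RGT_0 as Hpi.
  apply (Rmult_le_reg_l (2 * PI)); [lra|]. replace (2 * PI * (m / (2 * PI))) with m by (field; lra).
  apply (is_RInt_le _ g 0 (2 * PI) _ _ ltac:(lra) (log_mean_correct beta al Hal) Hm).
  intros t Ht. apply Hg. lra.
Qed.

Lemma log_mean_le_sup (beta al : R) : 0 <= beta -> 0 <= al < 1 ->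
  log_mean beta al <= Rpower (1 - al) (- beta).
Proof.
  intros Hb Hal. pose proof PI_RGT_0 as Hpi.
  replace (Rpower (1 - al) (- beta)) with (scal (2 * PI - 0) (Rpower (1 - al) (- beta)) / (2 * PI))
    by (unfold scal; simpl; unfold mult; simpl; field; lra).
  apply (log_mean_le _ _ _ (fun _ => Rpower (1 - al) (- beta)) Hal);
    [|apply (is_RInt_const (V := R_NormedModule))].
  intros t _. apply exp_le_compat.
  pose proof (Cmod_Clog_1_plus_le (circle al t)) as K. rewrite Cmod_circle in K by lra.
  specialize (K ltac:(lra)). apply (Rmult_le_compat_l beta) in K; lra.
Qed.

Lemma sin_ge_third (w : R) : 0 <= w <= PI / 2 -> w / 3 <= sin w.
Proof.
  intros Hw. pose proof PI_4. pose proof PI_RGT_0.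
  destruct (sin_bound w 0) as [K _]; [lra|lra|].
  unfold sin_approx, sin_term in K. simpl in K.
  assert (E : w - w * w * w / 6 <= sin w) by (eapply Rle_trans; [|exact K]; right; field).
  assert (w * w <= 4) by nra. nra.
Qed.

Lemma one_plus_cos_ge (t : R) : 0 <= t <= 2 * PI -> (t - PI) ^ 2 / 18 <= 1 + cos t.
Proof.
  intros Ht. set (w := Rabs (t - PI) / 2).
  assert (Hw : 0 <= w <= PI / 2).
  { assert (Rabs (t - PI) <= PI) by (apply Rabs_le; lra). pose proof (Rabs_pos (t - PI)).
    unfold w. lra. }
  pose proof (sin_ge_third w Hw) as S.
  assert (E : 1 + cos t = 2 * (sin w * sin w)).
  { replace (cos t) with (- cos (2 * w)); [rewrite cos_2a_sin; ring|].
    replace (2 * w) with (Rabs (t - PI)) by (unfold w; field).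
    replace (cos (Rabs (t - PI))) with (cos (t - PI))
      by (unfold Rabs; destruct Rcase_abs; [now rewrite cos_neg|reflexivity]).
    rewrite cos_minus, cos_PI, sin_PI. ring. }
  rewrite E, <- pow2_abs. replace (Rabs (t - PI)) with (2 * w) by (unfold w; field). nra.
Qed.

Lemma Cmod_1_plus_circle_ge (al t : R) : 1 / 2 <= al < 1 -> 0 <= t <= 2 * PI ->
  (1 - al + Rabs (t - PI)) / 6 <= Cmod (1 + circle al t).
Proof.
  intros Hal Ht. pose proof (one_plus_cos_ge t Ht) as K. pose proof (Cmod_ge_0 (1 + circle al t)) as P.
  assert (E : Cmod (1 + circle al t) ^ 2 = (1 - al) ^ 2 + 2 * al * (1 + cos t)).
  { rewrite Cmod2_alt. simpl. pose proof (sin2_cos2 t) as S. unfold Rsqr in S. nra. }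
  apply Rsqr_incr_0_var; [|exact P]. rewrite !Rsqr_pow2, E.
  assert (H : (t - PI) ^ 2 / 18 <= 2 * al * (1 + cos t)) by (pose proof (pow2_ge_0 (t - PI)); nra).
  rewrite <- pow2_abs in H. pose proof (pow2_ge_0 (1 - al - Rabs (t - PI))).
  pose proof (pow2_ge_0 (1 - al)). lra.
Qed.

Lemma exp_log_circle_le (b c al t : R) : 0 <= b <= c -> 1 / 2 <= al < 1 -> 0 <= t <= 2 * PI ->
  exp (b * Cmod (Clog (1 + circle al t)))
    <= exp (c * (2 * ln 2 + ln 6 + 2)) * Rpower (1 - al + Rabs (t - PI)) (- c).
Proof.
  intros Hb Hal Ht. unfold Rpower. rewrite <- exp_plus. apply exp_le_compat.
  pose proof (Cmod_1_plus_circle_ge al t Hal Ht) as K.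
  pose proof (Re_1_plus_circle_pos al t ltac:(lra)) as Hre.
  set (q := 1 - al + Rabs (t - PI)) in *. set (u := (1 + circle al t)%C) in *.
  assert (Hq : 0 < q) by (unfold q; pose proof (Rabs_pos (t - PI)); lra).
  assert (Hu : Cmod u <= 2).
  { unfold u. eapply Rle_trans; [apply Cmod_triangle|]. rewrite Cmod_1, Cmod_circle; lra. }
  assert (ln_u_le : ln (Cmod u) <= ln 2) by (apply ln_le; lra).
  assert (ln_u_ge : ln q - ln 6 <= ln (Cmod u)) by (rewrite <- ln_div by lra; apply ln_le; lra).
  assert (Hln2 : 0 <= ln 2) by (rewrite <- ln_1; apply ln_le; lra).
  assert (HC : Cmod (Clog u) <= 2 * ln 2 + ln 6 + 2 - ln q).
  { eapply Rle_trans; [apply Cmod_le_Re_Im|]. unfold Clog; simpl.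
    assert (Rabs (ln (Cmod u)) <= 2 * ln 2 + ln 6 - ln q) by (apply Rabs_le; lra).
    assert (Rabs (Carg u) <= 2); [|lra].
    rewrite Carg_Re_pos by exact Hre. pose proof (atan_bound (Im u / Re u)). pose proof PI_4.
    apply Rabs_le; lra. }
  apply Rle_trans with (c * Cmod (Clog u)).
  - apply Rmult_le_compat_r; [apply Cmod_ge_0|lra].
  - apply (Rmult_le_compat_l c) in HC; lra.
Qed.

Lemma is_RInt_Rpower_affine (c k q a b : R) : k <> 0 -> c <> 1 ->
  (forall t, Rmin a b <= t <= Rmax a b -> 0 < k * t + q) ->
  is_RInt (fun t => Rpower (k * t + q) (- c)) a b
    (Rpower (k * b + q) (1 - c) / (k * (1 - c)) - Rpower (k * a + q) (1 - c) / (k * (1 - c))).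
Proof.
  intros Hk Hc Hpos.
  apply (is_RInt_derive (V := R_CompleteNormedModule)
    (fun t => Rpower (k * t + q) (1 - c) / (k * (1 - c)))); intros t Ht; specialize (Hpos t Ht).
  - unfold Rpower. auto_derive; [exact Hpos|].
    replace (- c * ln (k * t + q)) with ((1 - c) * ln (k * t + q) + - ln (k * t + q)) by ring.
    rewrite exp_plus, exp_Ropp, exp_ln by exact Hpos. field. lra.
  - apply (@ex_derive_continuous R_AbsRing R_NormedModule). unfold Rpower. auto_derive. exact Hpos.
Qed.

Lemma RInt_Rpower_abs_le (c d : R) : 1 < c -> 0 < d ->
  exists m, is_RInt (fun t => Rpower (d + Rabs (t - PI)) (- c)) 0 (2 * PI) m /\
    m <= 2 / (c - 1) * Rpower d (1 - c).
Proof.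
  intros Hc Hd. pose proof PI_RGT_0 as Hpi.
  assert (HP : forall y, 0 < Rpower y (1 - c)) by (intros; apply exp_pos).
  eexists. split.
  - apply (is_RInt_Chasles (V := R_NormedModule) _ 0 PI).
    + eapply is_RInt_ext; [|apply (is_RInt_Rpower_affine c (-1) (d + PI) 0 PI); [lra|lra|]];
        rewrite Rmin_left, Rmax_right by lra; intros t Ht; [|lra].
      rewrite Rabs_left1 by lra. f_equal. ring.
    + eapply is_RInt_ext; [|apply (is_RInt_Rpower_affine c 1 (d - PI) PI (2 * PI)); [lra|lra|]];
        rewrite Rmin_left, Rmax_right by lra; intros t Ht; [|lra].
      rewrite Rabs_pos_eq by lra. f_equal. ring.
  - unfold plus; simpl.
    replace (-1 * PI + (d + PI)) with d by ring. replace (1 * PI + (d - PI)) with d by ring.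
    replace (-1 * 0 + (d + PI)) with (d + PI) by ring.
    replace (1 * (2 * PI) + (d - PI)) with (d + PI) by ring.
    assert (0 <= Rpower (d + PI) (1 - c) / (c - 1)) by (apply Rlt_le, Rdiv_lt_0_compat; [apply HP|lra]).
    apply Rle_trans with (2 / (c - 1) * Rpower d (1 - c) - 2 * (Rpower (d + PI) (1 - c) / (c - 1)));
      [right; field; lra|lra].
Qed.

(* [exp (b |log (1 + v)|)] is large only near [v = - 1]: this gains a factor [1 - al] over the
   supremum. *)
Lemma log_mean_le_Rpower (b c : R) : 1 < c -> 0 <= b <= c -> exists K, 0 < K /\
  forall al, 1 / 2 <= al < 1 -> log_mean b al <= K * Rpower (1 - al) (1 - c).
Proof.
  intros Hc Hb. pose proof PI_RGT_0 as Hpi. set (M := exp (c * (2 * ln 2 + ln 6 + 2))).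
  assert (HM : 0 < M) by apply exp_pos.
  exists (M * (2 / (c - 1)) / (2 * PI)). split.
  { apply Rdiv_lt_0_compat; [|lra]. apply Rmult_lt_0_compat; [exact HM|apply Rdiv_lt_0_compat; lra]. }
  intros al Hal. destruct (RInt_Rpower_abs_le c (1 - al) Hc ltac:(lra)) as (m & Hm & Hle).
  apply Rle_trans with (M * m / (2 * PI)).
  - apply (log_mean_le b al _ (fun t => M * Rpower (1 - al + Rabs (t - PI)) (- c)) ltac:(lra)).
    + intros t Ht. now apply exp_log_circle_le.
    + exact (is_RInt_scal (V := R_NormedModule) _ _ _ M _ Hm).
  - apply (Rmult_le_compat_l (M / (2 * PI))) in Hle; [|apply Rlt_le, Rdiv_lt_0_compat; lra].
    lra.
Qed.

(** * Laplace integrals *)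

Definition laplace_transform (f : R -> C) (w : C) : C :=
  RInt_gen_C (fun t => f t * Cexp (- (w * RtoC t)))%C (at_point 0) (Rbar_locally p_infty).

Definition exponential_type (f : R -> C) (M beta : R) : Prop :=
  forall t, 0 <= t -> continuous_path f t /\ Cmod (f t) <= M * exp (beta * t).

Lemma is_derive_path_Cexp_opp (w : C) (t : R) :
  is_derive_path (fun u => Cexp (- (w * RtoC u))) t (- w * Cexp (- (w * RtoC t)))%C.
Proof.
  replace (- (w * RtoC t))%C with (- w * RtoC t)%C by ring.
  eapply is_derive_ext; [|apply (is_derive_path_Cexp_line (- w) t)].
  intros u. cbv beta. apply f_equal. ring.
Qed.

Lemma Cmod_Cexp_opp (w : C) (t : R) : Cmod (Cexp (- (w * RtoC t))) = exp (- (Re w * t)).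
Proof. now rewrite Cmod_Cexp, re_opp, re_scal_r. Qed.

Lemma filterlim_exp_decay (d : R) : 0 < d ->
  filterlim (fun t => exp (- (d * t))) (Rbar_locally p_infty) (locally 0).
Proof.
  intros Hd. apply filterlim_exp_m_infty. intros P [M HM]. exists (- M / d). intros t Ht.
  apply HM. apply Rlt_div_l in Ht; lra.
Qed.

Lemma is_RInt_gen_exp_decay (d : R) : 0 < d ->
  is_RInt_gen (fun t => exp (- (d * t))) (at_point 0) (Rbar_locally p_infty) (/ d).
Proof.
  intros Hd. replace (/ d) with (- / d * 0 - - / d * exp (- (d * 0)))
    by (rewrite (Rmult_0_r d), Ropp_0, exp_0; ring).
  apply (is_RInt_gen_derive (V := R_CompleteNormedModule) nonneg_half_line
    (fun t => - / d * exp (- (d * t)))).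
  - intros t _. auto_derive; [exact I|]. field. lra.
  - intros t _. apply (@ex_derive_continuous R_AbsRing R_NormedModule). auto_derive. exact I.
  - intros P HP. exact (locally_singleton _ _ HP).
  - exact (filterlim_comp _ _ _ _ _ _ _ _ (filterlim_exp_decay d Hd)
      (filterlim_scal_r (V := R_NormedModule) (- / d) 0)).
Qed.

Section Laplace.

Variables (w : C) (beta : R).
Hypothesis Re_w_gt : beta < Re w.

Lemma laplace_integrand_le (f : R -> C) (M t : R) : exponential_type f M beta -> 0 <= t ->
  Cmod (f t * Cexp (- (w * RtoC t))) <= M * exp (- ((Re w - beta) * t)).
Proof.
  intros Hf Ht. rewrite Cmod_mult, Cmod_Cexp_opp.
  replace (- ((Re w - beta) * t)) with (beta * t + - (Re w * t)) by ring.
  rewrite exp_plus, <- Rmult_assoc. apply Rmult_le_compat_r; [apply Rlt_le, exp_pos|now apply Hf].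
Qed.

Lemma is_RInt_gen_laplace_majorant (M : R) :
  is_RInt_gen (fun t => M * exp (- ((Re w - beta) * t))) (at_point 0) (Rbar_locally p_infty)
    (M / (Re w - beta)).
Proof.
  apply (is_RInt_gen_scal (V := R_NormedModule) (fun t => exp (- ((Re w - beta) * t))) M).
  apply is_RInt_gen_exp_decay. lra.
Qed.

Lemma laplace_transform_correct (f : R -> C) (M : R) : exponential_type f M beta ->
  is_RInt_gen_C (fun t => f t * Cexp (- (w * RtoC t)))%C (at_point 0) (Rbar_locally p_infty)
    (laplace_transform f w).
Proof.
  intros Hf. apply (RInt_gen_correct (V := C_R_CompleteNormedModule)).
  eapply (ex_RInt_gen_dominated (V := C_R_CompleteNormedModule) nonneg_half_line _
    (fun t => M * exp (- ((Re w - beta) * t)))).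
  - intros t Ht. apply continuous_Cmult; [now apply Hf|].
    eapply is_derive_path_continuous, is_derive_path_Cexp_opp.
  - intros t _. apply (@ex_derive_continuous R_AbsRing R_NormedModule). auto_derive. exact I.
  - intros t Ht. change (norm ?x) with (@norm R_AbsRing C_R_NormedModule x).
    rewrite norm_C_R. now apply laplace_integrand_le.
  - apply is_RInt_gen_laplace_majorant.
Qed.

Lemma Cmod_laplace_transform_le (f : R -> C) (M : R) : exponential_type f M beta ->
  Cmod (laplace_transform f w) <= M / (Re w - beta).
Proof.
  intros Hf. rewrite <- norm_C_R.
  refine (RInt_gen_norm (V := C_R_CompleteNormedModule) _ _ _ _ (domain_ordered _ _ _ nonneg_half_line)
    _ (laplace_transform_correct f M Hf) (is_RInt_gen_laplace_majorant M)).
  generalize (domain_eventually nonneg_half_line). apply filter_imp. intros [x y] [Hx _] t Ht.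
  change (norm ?x) with (@norm R_AbsRing C_R_NormedModule x). rewrite norm_C_R.
  apply laplace_integrand_le; [exact Hf|simpl in *; lra].
Qed.

Lemma exponential_type_lincomb (f g : R -> C) (M M' : R) (c d : C) :
  exponential_type f M beta -> exponential_type g M' beta ->
  exponential_type (fun t => c * f t + d * g t)%C (Cmod c * M + Cmod d * M') beta.
Proof.
  intros Hf Hg t Ht. destruct (Hf t Ht) as [Cf Bf], (Hg t Ht) as [Cg Bg]. split.
  - apply continuous_Cplus; (apply continuous_Cmult; [apply continuous_const|assumption]).
  - eapply Rle_trans; [apply Cmod_triangle|]. rewrite !Cmod_mult, Rmult_plus_distr_r, !Rmult_assoc.
    apply Rplus_le_compat; (apply Rmult_le_compat_l; [apply Cmod_ge_0|assumption]).
Qed.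

Lemma laplace_transform_lincomb (f g : R -> C) (M M' : R) (c d : C) :
  exponential_type f M beta -> exponential_type g M' beta ->
  laplace_transform (fun t => c * f t + d * g t)%C w
  = (c * laplace_transform f w + d * laplace_transform g w)%C.
Proof.
  intros Hf Hg.
  apply (is_RInt_gen_C_unique _ _ _
    (laplace_transform_correct _ _ (exponential_type_lincomb _ _ _ _ c d Hf Hg))).
  eapply is_RInt_gen_C_ext; [|apply (is_RInt_gen_plus (V := C_R_NormedModule));
    apply is_RInt_gen_C_scal;
      [exact (laplace_transform_correct f M Hf)|exact (laplace_transform_correct g M' Hg)]].
  intros t. change (c * (f t * Cexp (- (w * RtoC t))) + d * (g t * Cexp (- (w * RtoC t)))
    = (c * f t + d * g t) * Cexp (- (w * RtoC t)))%C. ring.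
Qed.

Lemma laplace_transform_derive (f df : R -> C) (M M' : R) :
  (forall t, 0 <= t -> is_derive_path f t (df t)) ->
  exponential_type f M beta -> exponential_type df M' beta ->
  laplace_transform df w = (w * laplace_transform f w - f 0)%C.
Proof.
  intros Hd Hf Hdf. set (e := fun t => Cexp (- (w * RtoC t))).
  assert (He : forall t, continuous_path e t)
    by (intros t; eapply is_derive_path_continuous, is_derive_path_Cexp_opp).
  assert (K : is_RInt_gen_C (fun t => df t * e t - w * (f t * e t))%C (at_point 0)
    (Rbar_locally p_infty) (0 - f 0)%C).
  { apply (is_RInt_gen_derive (V := C_R_CompleteNormedModule) nonneg_half_line (fun t => f t * e t)%C).
    - intros t Ht.
      evar_last; [apply is_derive_path_mult; [now apply Hd|apply is_derive_path_Cexp_opp]|].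
      unfold e. ring.
    - intros t Ht. apply continuous_Cminus; [|apply continuous_Cmult; [apply continuous_const|]];
        (apply continuous_Cmult; [now (apply Hf || apply Hdf)|apply He]).
    - intros P HP. unfold filtermap, at_point, e.
      rewrite Cmult_0_r, Copp_0, Cexp_RtoC, exp_0, Cmult_1_r. exact (locally_singleton _ _ HP).
    - apply filterlim_C_0.
      apply (filterlim_le_le (fun _ => 0) _ (fun t => M * exp (- ((Re w - beta) * t))) 0).
      + eapply filter_imp; [|exact (domain_right _ _ _ nonneg_half_line)]. intros t Ht.
        split; [apply Cmod_ge_0|now apply laplace_integrand_le].
      + apply filterlim_const.
      + pose proof (filterlim_comp _ _ _ _ _ _ _ _ (filterlim_exp_decay (Re w - beta) ltac:(lra))
          (filterlim_scal_r (V := R_NormedModule) M 0)) as L.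
        unfold scal in L; simpl in L; unfold mult in L; simpl in L. now rewrite Rmult_0_r in L. }
  pose proof (is_RInt_gen_C_unique _ _ _ K (is_RInt_gen_minus (V := C_R_NormedModule) _ _ _ _
    (laplace_transform_correct df M' Hdf)
    (is_RInt_gen_C_scal w _ _ (laplace_transform_correct f M Hf)))) as E.
  change (0 - f 0 = laplace_transform df w - w * laplace_transform f w)%C in E.
  replace (laplace_transform df w)
    with (laplace_transform df w - w * laplace_transform f w + w * laplace_transform f w)%C by ring.
  rewrite <- E. ring.
Qed.

End Laplace.

(** * Quotients of rising factorials *)

Lemma Rpower_succ_div_le_exp (m k : R) : 0 < m -> 0 <= k -> Rpower ((m + 1) / m) k <= exp (k / m).
Proof.
  intros Hm Hk. apply exp_le_compat. apply Rmult_le_compat_l; [exact Hk|].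
  assert (P : 0 < (m + 1) / m) by (apply Rdiv_lt_0_compat; lra).
  pose proof (exp_ineq1_le (ln ((m + 1) / m))) as K. rewrite exp_ln in K by exact P.
  replace (/ m) with ((m + 1) / m - 1) by (field; lra). lra.
Qed.

Lemma Rpower_succ_div_le (m k : R) : 0 <= k < m -> Rpower ((m + 1) / m) k <= m / (m - k).
Proof.
  intros Hk. eapply Rle_trans; [apply Rpower_succ_div_le_exp; lra|].
  pose proof (exp_ineq1_le (- (k / m))) as K. rewrite exp_Ropp in K.
  replace (1 + - (k / m)) with (/ (m / (m - k))) in K by (field; lra).
  apply Rinv_le_contravar in K; [|apply Rinv_0_lt_compat, Rdiv_lt_0_compat; lra].
  now rewrite !Rinv_inv in K.
Qed.

Lemma Cmod_pochhammer_RtoC_S (x : R) (n : nat) : 0 < x ->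
  Cmod (pochhammer (RtoC x) (S n)) = Cmod (pochhammer (RtoC x) n) * (x + INR n).
Proof.
  intros Hx. pose proof (pos_INR n). simpl pochhammer.
  rewrite Cmod_mult, <- RtoC_plus, Cmod_R, Rabs_pos_eq; [reflexivity|lra].
Qed.

Lemma Cmod_pochhammer_gt_0 (w : C) (n : nat) : 0 < Re w -> 0 < Cmod (pochhammer w n).
Proof. intros Hw. now apply Cmod_gt_0, pochhammer_neq_0. Qed.

Lemma Cmod_pochhammer_Re_le (w : C) (n : nat) : 0 < Re w ->
  Cmod (pochhammer (RtoC (Re w)) n) <= Cmod (pochhammer w n).
Proof.
  intros Hw. induction n as [|n IH]; [apply Rle_refl|].
  rewrite Cmod_pochhammer_RtoC_S by exact Hw. simpl pochhammer. rewrite Cmod_mult.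
  pose proof (pos_INR n).
  apply Rmult_le_compat; [apply Cmod_ge_0|lra|exact IH|].
  eapply Rle_trans; [|apply Re_le_Cmod]. rewrite re_plus, re_RtoC. lra.
Qed.

Lemma div_Cmod_pochhammer_le (u v : R) (w : C) (n : nat) : 0 < Re w -> u <= v -> 0 <= v ->
  u / Cmod (pochhammer w n) <= v / Cmod (pochhammer (RtoC (Re w)) n).
Proof.
  intros Hw Huv Hv. apply Rle_trans with (v / Cmod (pochhammer w n)).
  - apply Rmult_le_compat_r; [|exact Huv]. now apply Rlt_le, Rinv_0_lt_compat, Cmod_pochhammer_gt_0.
  - apply Rmult_le_compat_l; [exact Hv|].
    apply Rinv_le_contravar; [now apply Cmod_pochhammer_gt_0|now apply Cmod_pochhammer_Re_le].
Qed.

Lemma fact_Rpower_le_pochhammer (c : R) (n : nat) : 1 < c ->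
  INR (fact n) * Rpower (INR n + c + 1) (c - 1)
    <= Rpower (c + 1) (c - 1) * Cmod (pochhammer (RtoC c) n).
Proof.
  intros Hc. induction n as [|n IH].
  - simpl pochhammer. rewrite Cmod_1. simpl. rewrite Rplus_0_l. lra.
  - pose proof (pos_INR n) as Pn. set (m := INR n + c + 1) in *.
    assert (Q : Rpower ((m + 1) / m) (c - 1) <= (INR n + c) / (INR n + 1)).
    { eapply Rle_trans; [apply Rpower_succ_div_le; unfold m; lra|].
      apply Rle_div_l; [unfold m; lra|].
      replace ((INR n + c) / (INR n + 1) * (m - (c - 1)))
        with (m + (c - 1) / (INR n + 1)) by (unfold m; field; lra).
      assert (0 < (c - 1) / (INR n + 1)) by (apply Rdiv_lt_0_compat; lra). lra. }
    rewrite Cmod_pochhammer_RtoC_S, fact_simpl, mult_INR, S_INR by lra.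
    replace (INR n + 1 + c + 1) with (m * ((m + 1) / m)) by (unfold m; field; lra).
    rewrite <- Rpower_mult_distr by (try apply Rdiv_lt_0_compat; unfold m; lra).
    replace ((INR n + 1) * INR (fact n) * (Rpower m (c - 1) * Rpower ((m + 1) / m) (c - 1)))
      with (INR (fact n) * Rpower m (c - 1) * (Rpower ((m + 1) / m) (c - 1) * (INR n + 1))) by ring.
    rewrite <- (Rmult_assoc (Rpower (c + 1) _)), (Rplus_comm c (INR n)). apply Rle_div_r in Q; [|lra].
    apply Rmult_le_compat; [|apply Rmult_le_pos|exact IH|exact Q].
    + apply Rmult_le_pos; [apply pos_INR|apply Rlt_le, exp_pos].
    + apply Rlt_le, exp_pos.
    + lra.
Qed.

Section PochhammerRatio.

Variables c x : R.
Hypothesis c_pos : 0 < c.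
Hypothesis c_lt_x : c < x.

Definition pochhammer_ratio (n : nat) : R :=
  Cmod (pochhammer (RtoC c) n) / Cmod (pochhammer (RtoC x) n).

Lemma pochhammer_ratio_gt_0 (n : nat) : 0 < pochhammer_ratio n.
Proof. apply Rdiv_lt_0_compat; apply Cmod_pochhammer_gt_0; simpl; lra. Qed.

Lemma pochhammer_ratio_S (n : nat) :
  pochhammer_ratio (S n) = pochhammer_ratio n * ((c + INR n) / (x + INR n)).
Proof.
  unfold pochhammer_ratio. rewrite !Cmod_pochhammer_RtoC_S by lra.
  pose proof (pos_INR n). pose proof (Cmod_pochhammer_gt_0 (RtoC x) n ltac:(simpl; lra)). field. lra.
Qed.

Lemma pochhammer_ratio_le (n : nat) : pochhammer_ratio n <= Rpower (x / (x + INR n)) (x - c).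
Proof.
  induction n as [|n IH].
  - unfold pochhammer_ratio. simpl. rewrite Rplus_0_r. unfold Rdiv.
    rewrite !Rinv_r by (rewrite ?Cmod_1; lra). unfold Rpower. rewrite ln_1, Rmult_0_r, exp_0.
    apply Rle_refl.
  - pose proof (pos_INR n). rewrite pochhammer_ratio_S, S_INR. set (m := x + INR n) in *.
    replace (x + (INR n + 1)) with (m + 1) by (unfold m; ring).
    pose proof (Rpower_succ_div_le m (x - c) ltac:(unfold m; lra)) as Q.
    apply Rinv_le_contravar in Q; [|apply exp_pos].
    replace (x / (m + 1)) with (x / m * / ((m + 1) / m)) by (field; unfold m; lra).
    assert (P : 0 < (m + 1) / m) by (apply Rdiv_lt_0_compat; unfold m; lra).
    rewrite <- Rpower_mult_distr
      by (apply Rdiv_lt_0_compat || apply Rinv_0_lt_compat; unfold m in *; lra).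
    assert (E : Rpower (/ ((m + 1) / m)) (x - c) = / Rpower ((m + 1) / m) (x - c)).
    { unfold Rpower. rewrite ln_Rinv, <- exp_Ropp by exact P. f_equal. ring. }
    rewrite E. apply Rmult_le_compat; [apply Rlt_le, pochhammer_ratio_gt_0| |exact IH|].
    + apply Rlt_le, Rdiv_lt_0_compat; unfold m; lra.
    + replace ((c + INR n) / m) with (/ (m / (m - (x - c)))) by (unfold m; field; lra). exact Q.
Qed.

Lemma is_lim_seq_pochhammer_ratio : is_lim_seq pochhammer_ratio 0.
Proof.
  apply (is_lim_seq_le_le (fun _ => 0) _ (fun n => exp ((x - c) * (ln x - ln (x + INR n))))).
  - intros n. split; [apply Rlt_le, pochhammer_ratio_gt_0|].
    eapply Rle_trans; [apply pochhammer_ratio_le|]. unfold Rpower.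
    pose proof (pos_INR n). rewrite ln_div by lra. apply Rle_refl.
  - apply is_lim_seq_const.
  - apply (filterlim_exp_m_infty (F := eventually)). intros P [M HM].
    assert (L : filterlim (fun n => ln (x + INR n)) eventually (Rbar_locally p_infty)).
    { apply (filterlim_comp _ _ _ (fun n => x + INR n) ln _ (Rbar_locally p_infty));
        [|exact is_lim_ln_p].
      eapply filterlim_ge_p_infty; [|exact is_lim_seq_INR]. apply filter_forall. intros n. lra. }
    assert (HL : Rbar_locally p_infty (fun y => P ((x - c) * (ln x - y)))).
    { exists (ln x - M / (x - c)). intros y Hy. apply HM.
      replace M with ((x - c) * (M / (x - c))) by (field; lra). apply Rmult_lt_compat_l; lra. }
    exact (L _ HL).
Qed.

Lemma is_series_pochhammer_ratio : is_series (fun n => pochhammer_ratio n / (x + INR n)) (/ (x - c)).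
Proof.
  assert (T : forall N, sum_n (fun n => pochhammer_ratio n / (x + INR n)) N
    = / (x - c) * (1 - pochhammer_ratio (S N))).
  { assert (D : forall n, pochhammer_ratio n / (x + INR n)
      = / (x - c) * (pochhammer_ratio n - pochhammer_ratio (S n))).
    { intros n. rewrite pochhammer_ratio_S. pose proof (pos_INR n). field. lra. }
    induction N as [|N IH].
    - rewrite sum_O, D. unfold pochhammer_ratio at 1. simpl. rewrite Cmod_1. field. lra.
    - rewrite sum_Sn, IH, D. unfold plus; simpl. ring. }
  apply (is_lim_seq_ext _ _ (/ (x - c)) (fun N => eq_sym (T N))).
  replace (Finite (/ (x - c))) with (Rbar_mult (/ (x - c)) (1 - 0)) by (simpl; f_equal; ring).
  apply is_lim_seq_scal_l, is_lim_seq_minus'; [apply is_lim_seq_const|].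
  apply (is_lim_seq_incr_1 pochhammer_ratio 0), is_lim_seq_pochhammer_ratio.
Qed.

End PochhammerRatio.

(** * Finite sums and Stirling numbers *)

Lemma sum_n_csum (f : nat -> C) (n : nat) : sum_n (G := C_NormedModule) f n = csum f n.
Proof. induction n as [|n IH]; [now rewrite sum_O|]. rewrite sum_Sn, IH. reflexivity. Qed.

Lemma is_series_C_csum (f : nat -> C) (l : C) :
  is_lim_seq (fun N => Cmod (l - csum f N)) 0 -> is_series_C f l.
Proof.
  intros H P HP. apply locally_C in HP. destruct HP as [e He].
  generalize (H _ (open_lt e 0 (cond_pos e))). unfold filtermap. apply filter_imp. intros N HN.
  apply He. rewrite sum_n_csum. change (Cmod (csum f N - l) < e). now rewrite Cmod_minus_sym.
Qed.

Lemma csum_ext (f g : nat -> C) (n : nat) : (forall k, (k <= n)%nat -> f k = g k) ->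
  csum f n = csum g n.
Proof.
  induction n as [|n IH]; intros H; simpl; [apply H; lia|].
  rewrite IH by (intros; apply H; lia). f_equal. apply H; lia.
Qed.

Lemma csum_scal (c : C) (f : nat -> C) (n : nat) : csum (fun k => c * f k)%C n = (c * csum f n)%C.
Proof. induction n as [|n IH]; simpl; [reflexivity|]. rewrite IH. ring. Qed.

Lemma csum_plus (f g : nat -> C) (n : nat) : csum (fun k => f k + g k)%C n = (csum f n + csum g n)%C.
Proof. induction n as [|n IH]; simpl; [reflexivity|]. rewrite IH. ring. Qed.

Lemma csum_shift (f : nat -> C) (n : nat) : csum f (S n) = (f O + csum (fun k => f (S k)) n)%C.
Proof. induction n as [|n IH]; [reflexivity|]. simpl in *. rewrite IH. ring. Qed.

Lemma is_derive_path_csum (f : nat -> R -> C) (df : nat -> C) (t : R) (n : nat) :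
  (forall k, is_derive_path (f k) t (df k)) ->
  is_derive_path (fun u => csum (fun k => f k u) n) t (csum df n).
Proof. intros H. induction n as [|n IH]; simpl; [apply H|]. now apply is_derive_path_plus. Qed.

Lemma nth_padd (p q : list Z) (k : nat) : nth k (padd p q) 0%Z = (nth k p 0 + nth k q 0)%Z.
Proof.
  revert q k. induction p as [|x p IH]; intros q k; [destruct k; reflexivity|].
  destruct q as [|y q]; [simpl; destruct k; lia|].
  destruct k as [|k]; simpl; [reflexivity|apply IH].
Qed.

Lemma nth_mul_X_minus (c : Z) (p : list Z) (k : nat) :
  nth k (mul_X_minus c p) 0%Z = (nth k (0%Z :: p) 0 - c * nth k p 0)%Z.
Proof.
  unfold mul_X_minus. rewrite nth_padd. unfold Z.sub. rewrite <- Z.mul_opp_l. f_equal.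
  replace 0%Z with (- c * 0)%Z at 1 by lia. apply (map_nth (fun x => (- c * x)%Z)).
Qed.

Lemma stirling1_S_0 (n : nat) : stirling1 (S n) 0 = (- Z.of_nat n * stirling1 n 0)%Z.
Proof. unfold stirling1. cbn [falling_poly]. rewrite nth_mul_X_minus. simpl nth at 1. lia. Qed.

Lemma stirling1_S_S (n k : nat) :
  stirling1 (S n) (S k) = (stirling1 n k - Z.of_nat n * stirling1 n (S k))%Z.
Proof. unfold stirling1. cbn [falling_poly]. now rewrite nth_mul_X_minus. Qed.

Lemma stirling1_out (n k : nat) : (n < k)%nat -> stirling1 n k = 0%Z.
Proof.
  revert k. induction n as [|n IH]; intros k Hk.
  - destruct k as [|[|k]]; [lia|reflexivity|]. unfold stirling1. simpl. now destruct k.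
  - destruct k as [|k]; [lia|]. rewrite stirling1_S_S, !IH by lia. lia.
Qed.

Definition stirling_sum (n : nat) (x : nat -> C) : C :=
  csum (fun k => RtoC (IZR (stirling1 n k)) * x k)%C n.

Lemma stirling_sum_S (n : nat) (x : nat -> C) :
  stirling_sum (S n) x = (stirling_sum n (fun k => x (S k)) - RtoC (INR n) * stirling_sum n x)%C.
Proof.
  unfold stirling_sum. rewrite csum_shift, stirling1_S_0.
  assert (E : csum (fun k => RtoC (IZR (stirling1 n k)) * x k)%C n
     = csum (fun k => RtoC (IZR (stirling1 n k)) * x k)%C (S n)).
  { simpl. rewrite (stirling1_out n (S n)) by lia. ring. }
  rewrite E, csum_shift. rewrite (csum_ext _ (fun k => RtoC (IZR (stirling1 n k)) * x (S k)
    + - RtoC (INR n) * (RtoC (IZR (stirling1 n (S k))) * x (S k)))%C).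
  - rewrite csum_plus, csum_scal. rewrite mult_IZR, opp_IZR, <- INR_IZR_INZ, RtoC_mult, RtoC_opp. ring.
  - intros k _. rewrite stirling1_S_S, minus_IZR, mult_IZR, <- INR_IZR_INZ, RtoC_minus, RtoC_mult. ring.
Qed.

Lemma stirling_sum_scal (n : nat) (c : C) (x : nat -> C) :
  stirling_sum n (fun k => c * x k)%C = (c * stirling_sum n x)%C.
Proof. unfold stirling_sum. rewrite <- csum_scal. apply csum_ext. intros k _. ring. Qed.

Lemma is_derive_path_stirling_sum (n : nat) (x : nat -> R -> C) (dx : nat -> C) (t : R) :
  (forall k, is_derive_path (x k) t (dx k)) ->
  is_derive_path (fun u => stirling_sum n (fun k => x k u)) t (stirling_sum n dx).
Proof.
  intros H. apply (is_derive_path_csum (fun k u => RtoC (IZR (stirling1 n k)) * x k u)%C).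
  intros k. apply is_derive_path_scal, H.
Qed.

Lemma locally_Rabs_lt (t r : R) : Rabs t < r -> locally t (fun v => Rabs v < r).
Proof. intros Ht. apply (continuous_Rabs t (fun v => v < r)). now apply open_lt. Qed.

(* For [g n t = s^n phi^(n)(s)] with [s = exp (- t)] and [f k = (d/dt)^k (g 0)], this is
   [s^n (d/ds)^n = (s d/ds) (s d/ds - 1) ... (s d/ds - n + 1)], since [s d/ds = - d/dt]. *)
Lemma scaled_derivatives_stirling_sum (f g : nat -> R -> C) (r : R) :
  (forall k t, Rabs t < r -> is_derive_path (f k) t (f (S k) t)) ->
  (forall n t, Rabs t < r ->
    is_derive_path (g n) t (- (1) * g (S n) t + - RtoC (INR n) * g n t)%C) ->
  (forall t, Rabs t < r -> g O t = f O t) ->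
  forall n t, Rabs t < r -> g n t = stirling_sum n (fun k => RtoC ((-1) ^ k) * f k t)%C.
Proof.
  intros Hf Hg Hfg. induction n as [|n IH]; intros t Ht.
  - unfold stirling_sum. cbn [csum pow]. change (stirling1 0 0) with 1%Z. rewrite Hfg by exact Ht. ring.
  - assert (D : is_derive_path (g n) t (stirling_sum n (fun k => RtoC ((-1) ^ k) * f (S k) t)%C)).
    { apply (is_derive_ext_loc (V := C_R_NormedModule)
        (fun u => stirling_sum n (fun k => RtoC ((-1) ^ k) * f k u)%C)).
      - generalize (locally_Rabs_lt t r Ht). apply filter_imp. intros u Hu. symmetry. now apply IH.
      - apply (is_derive_path_stirling_sum n (fun k u => RtoC ((-1) ^ k) * f k u)%C). intros k.
        apply is_derive_path_scal, Hf, Ht. }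
    pose proof (is_derive_path_unique _ _ _ _ D (Hg n t Ht)) as E.
    assert (E_neg : stirling_sum n (fun k => RtoC ((-1) ^ S k) * f (S k) t)%C
      = (- (1) * stirling_sum n (fun k => RtoC ((-1) ^ k) * f (S k) t))%C).
    { rewrite <- stirling_sum_scal. apply csum_ext. intros k _.
      rewrite <- tech_pow_Rmult, RtoC_mult, (RtoC_opp 1 : RtoC (-1) = _). ring. }
    rewrite stirling_sum_S, <- IH, E_neg, E by exact Ht. ring.
Qed.

(** * Derivatives of exponential generating series *)

Lemma lt_CV_radius (u : nat -> R) (r t : R) :
  (forall t, Rabs t < r -> ex_pseries u t) -> Rabs t < r -> Rbar_lt (Rabs t) (CV_radius u).
Proof.
  intros H Ht. set (t' := (Rabs t + r) / 2). pose proof (Rabs_pos t).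
  assert (Et' : Rabs t' = t') by (apply Rabs_pos_eq; unfold t'; lra).
  apply Rbar_lt_le_trans with (Rabs t'); [simpl; unfold t' in *; lra|].
  apply Rbar_not_lt_le. intros K. apply CV_disk_outside in K. apply K.
  apply (is_lim_seq_ext (fun n => scal (pow_n t' n) (u n))).
  { intros n. rewrite pow_n_pow. apply Rmult_comm. }
  apply ex_series_lim_0, H. unfold t' in *. lra.
Qed.

Section RealSeries.

Variables (u : nat -> R) (f : R -> R) (r : R).
Hypothesis f_egf : forall t, Rabs t < r -> is_series (fun n => u n * t ^ n / INR (fact n)) (f t).

Lemma is_pseries_egf (t : R) : Rabs t < r -> is_pseries (fun n => u n / INR (fact n)) t (f t).
Proof.
  intros Ht. eapply is_series_ext; [|exact (f_egf t Ht)]. intros n. rewrite pow_n_pow.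
  change (u n * t ^ n / INR (fact n) = t ^ n * (u n / INR (fact n))). unfold Rdiv. ring.
Qed.

Lemma locally_egf (t : R) : Rabs t < r ->
  locally t (fun v => PSeries (fun n => u n / INR (fact n)) v = f v).
Proof.
  intros Ht. generalize (locally_Rabs_lt t r Ht). apply filter_imp. intros v Hv.
  now apply is_pseries_unique, is_pseries_egf.
Qed.

Lemma lt_CV_radius_egf (t : R) : Rabs t < r ->
  Rbar_lt (Rabs t) (CV_radius (fun n => u n / INR (fact n))).
Proof. apply lt_CV_radius. intros v Hv. eexists. now apply is_pseries_egf. Qed.

Lemma is_derive_Derive_n_egf (k : nat) (t : R) : Rabs t < r ->
  is_derive (Derive_n f k) t (Derive_n f (S k) t).
Proof.
  intros Ht. apply Derive_correct.
  apply (ex_derive_n_ext_loc _ f (S k) t (locally_egf t Ht)), ex_derive_n_PSeries, lt_CV_radius_egf, Ht.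
Qed.

Lemma Derive_n_egf_0 (k : nat) : 0 < r -> Derive_n f k 0 = u k.
Proof.
  intros Hr. assert (zero_in : Rabs 0 < r) by (now rewrite Rabs_R0).
  rewrite <- (Derive_n_ext_loc _ f k 0 (locally_egf 0 zero_in)), Derive_n_coef.
  - field. apply INR_fact_neq_0.
  - rewrite <- Rabs_R0. now apply lt_CV_radius_egf.
Qed.

End RealSeries.

Lemma sum_n_Re (u : nat -> C) (n : nat) : sum_n (fun n => Re (u n)) n
  = Re (sum_n (G := C_NormedModule) u n).
Proof. induction n as [|n IH]; [now rewrite !sum_O|]. rewrite !sum_Sn, IH. reflexivity. Qed.

Lemma sum_n_Im (u : nat -> C) (n : nat) : sum_n (fun n => Im (u n)) n
  = Im (sum_n (G := C_NormedModule) u n).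
Proof. induction n as [|n IH]; [now rewrite !sum_O|]. rewrite !sum_Sn, IH. reflexivity. Qed.

Lemma is_series_C_Re (u : nat -> C) (l : C) : is_series_C u l -> is_series (fun n => Re (u n)) (Re l).
Proof.
  intros H. eapply filterlim_ext; [intros n; symmetry; apply sum_n_Re|].
  eapply filterlim_comp; [exact H|].
  intros P HP. destruct l as [x y]. exact (@continuous_fst R_UniformSpace R_UniformSpace x y P HP).
Qed.

Lemma is_series_C_Im (u : nat -> C) (l : C) : is_series_C u l -> is_series (fun n => Im (u n)) (Im l).
Proof.
  intros H. eapply filterlim_ext; [intros n; symmetry; apply sum_n_Im|].
  eapply filterlim_comp; [exact H|].
  intros P HP. destruct l as [x y]. exact (@continuous_snd R_UniformSpace R_UniformSpace x y P HP).
Qed.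

Definition path_derive_n (f : R -> C) (k : nat) (t : R) : C :=
  (Derive_n (fun v => Re (f v)) k t, Derive_n (fun v => Im (f v)) k t).

Section ComplexSeries.

Variables (u : nat -> C) (f : R -> C) (r : R).
Hypothesis f_egf : forall t, Rabs t < r ->
  is_series_C (fun n => u n * RtoC t ^ n / RtoC (INR (fact n)))%C (f t).

Lemma egf_term_RtoC (c : C) (t : R) (n : nat) :
  (c * RtoC t ^ n / RtoC (INR (fact n)))%C = (c * RtoC (t ^ n / INR (fact n)))%C.
Proof.
  unfold Rdiv, Cdiv. now rewrite RtoC_mult, RtoC_pow, RtoC_inv, Cmult_assoc by apply INR_fact_neq_0.
Qed.

Lemma is_series_egf_Re (t : R) : Rabs t < r ->
  is_series (fun n => Re (u n) * t ^ n / INR (fact n)) (Re (f t)).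
Proof.
  intros Ht. eapply is_series_ext; [|exact (is_series_C_Re _ _ (f_egf t Ht))]. intros n. cbv beta.
  rewrite egf_term_RtoC, re_scal_r. symmetry. apply Rmult_assoc.
Qed.

Lemma is_series_egf_Im (t : R) : Rabs t < r ->
  is_series (fun n => Im (u n) * t ^ n / INR (fact n)) (Im (f t)).
Proof.
  intros Ht. eapply is_series_ext; [|exact (is_series_C_Im _ _ (f_egf t Ht))]. intros n. cbv beta.
  rewrite egf_term_RtoC, im_scal_r. symmetry. apply Rmult_assoc.
Qed.

Lemma is_derive_path_derive_n (k : nat) (t : R) : Rabs t < r ->
  is_derive_path (path_derive_n f k) t (path_derive_n f (S k) t).
Proof.
  intros Ht. apply is_derive_path_pair.
  - exact (is_derive_Derive_n_egf _ _ r is_series_egf_Re k t Ht).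
  - exact (is_derive_Derive_n_egf _ _ r is_series_egf_Im k t Ht).
Qed.

Lemma path_derive_n_0 (k : nat) : 0 < r -> path_derive_n f k 0 = u k.
Proof.
  intros Hr. apply injective_projections.
  - exact (Derive_n_egf_0 _ _ r is_series_egf_Re k Hr).
  - exact (Derive_n_egf_0 _ _ r is_series_egf_Im k Hr).
Qed.

End ComplexSeries.

(** * Functions of logarithmic growth on the disc *)

Section DerivativeBound.

Variables A beta : R.
Hypothesis A_nonneg : 0 <= A.

Definition derivative_bound (n : nat) (al : R) : R := A * (INR (fact n) / al ^ n * log_mean beta al).

(* [n / (n + beta)] minimizes [al^(-n) (1 - al)^(- beta)]. *)
Lemma derivative_bound_optimal (n : nat) : (0 < n)%nat -> 0 < beta ->
  derivative_bound n (INR n / (INR n + beta))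
    <= A * (INR (fact n) * Rpower (INR n + beta) (INR n + beta) / (INR n ^ n * Rpower beta beta)).
Proof.
  intros Hn Hb. assert (Pn : 0 < INR n) by now apply lt_0_INR. set (q := INR n + beta).
  assert (Hq : 0 < q) by (unfold q; lra).
  assert (Hal : 0 < INR n / q < 1).
  { split; [now apply Rdiv_lt_0_compat|]. apply Rlt_div_l; unfold q; lra. }
  assert (Pn' : 0 < INR n ^ n) by now apply pow_lt. assert (Pq : 0 < q ^ n) by now apply pow_lt.
  assert (Pb : 0 < Rpower beta beta) by apply exp_pos.
  apply Rmult_le_compat_l; [exact A_nonneg|].
  replace (INR (fact n) * Rpower q q / (INR n ^ n * Rpower beta beta))
    with (INR (fact n) / (INR n / q) ^ n * Rpower (1 - INR n / q) (- beta)).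
  - apply Rmult_le_compat_l; [|apply log_mean_le_sup; lra].
    apply Rmult_le_pos; [apply pos_INR|]. apply Rlt_le, Rinv_0_lt_compat, pow_lt, Hal.
  - replace (1 - INR n / q) with (beta / q) by (unfold q; field; fold q; lra).
    assert (E : Rpower (beta / q) (- beta) = Rpower q beta / Rpower beta beta).
    { unfold Rpower, Rdiv. rewrite ln_mult, ln_Rinv, <- exp_Ropp, <- exp_plus by
        (try apply Rinv_0_lt_compat; assumption). f_equal. ring. }
    rewrite E. unfold q at 4. rewrite Rpower_plus, Rpower_pow by exact Hq.
    unfold Rdiv at 2. rewrite Rpow_mult_distr, pow_inv. field. lra.
Qed.

Hypothesis beta_nonneg : 0 <= beta.

Lemma derivative_bound_le_pochhammer (c : R) : 1 < c -> beta <= c -> exists M, 0 <= M /\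
  forall n, exists al, 0 < al < 1 /\ derivative_bound n al <= M * Cmod (pochhammer (RtoC c) n).
Proof.
  intros Hc Hb. destruct (log_mean_le_Rpower beta c Hc (conj beta_nonneg Hb)) as (K & HK & HKal).
  exists (A * (exp 1 * K * Rpower (c + 1) (c - 1))). split.
  { repeat apply Rmult_le_pos; (exact A_nonneg || (apply Rlt_le; first [exact HK|apply exp_pos])). }
  intros n. pose proof (pos_INR n) as Pn. set (m := INR n + c).
  assert (Hm : 1 < m) by (unfold m; lra).
  assert (Hi : 0 < / (m + 1) <= / 2)
    by (split; [apply Rinv_0_lt_compat; lra|apply Rinv_le_contravar; lra]).
  exists (1 - / (m + 1)). split; [lra|].
  unfold derivative_bound. rewrite !Rmult_assoc. apply Rmult_le_compat_l; [exact A_nonneg|].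
  assert (Em : / (1 - / (m + 1)) = (m + 1) / m) by (field; lra).
  assert (P : / (1 - / (m + 1)) ^ n <= exp 1).
  { rewrite <- pow_inv, Em, <- Rpower_pow by (apply Rdiv_lt_0_compat; lra).
    eapply Rle_trans; [apply Rpower_succ_div_le_exp; lra|]. apply exp_le_compat.
    apply Rle_div_l; unfold m; lra. }
  assert (L : log_mean beta (1 - / (m + 1)) <= K * Rpower (m + 1) (c - 1)).
  { eapply Rle_trans; [apply HKal; lra|]. right. f_equal.
    replace (1 - (1 - / (m + 1))) with (/ (m + 1)) by ring. unfold Rpower.
    rewrite ln_Rinv by lra. f_equal. ring. }
  replace (INR (fact n) / (1 - / (m + 1)) ^ n * log_mean beta (1 - / (m + 1)))
    with (/ (1 - / (m + 1)) ^ n * (INR (fact n) * log_mean beta (1 - / (m + 1))))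
      by (unfold Rdiv; ring).
  assert (Pi : 0 <= / (1 - / (m + 1)) ^ n).
  { rewrite <- pow_inv, Em. apply Rlt_le, pow_lt, Rdiv_lt_0_compat; lra. }
  eapply Rle_trans.
  - apply Rmult_le_compat_l; [exact Pi|]. apply Rmult_le_compat_l; [apply pos_INR|exact L].
  - replace (INR (fact n) * (K * Rpower (m + 1) (c - 1)))
      with (K * (INR (fact n) * Rpower (m + 1) (c - 1)))
      by ring.
    apply Rmult_le_compat; [exact Pi| |exact P|].
    + repeat apply Rmult_le_pos; [lra|apply pos_INR|apply Rlt_le, exp_pos].
    + apply Rmult_le_compat_l; [lra|]. now apply fact_Rpower_le_pochhammer.
Qed.

End DerivativeBound.

Record logarithmic_growth (phi : C -> C) (A beta : R) : Prop := {
  log_growth_holomorphic : holomorphic_on phi (fun s => Cmod (s - 1) < 1);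
  log_growth_constant_nonneg : 0 <= A;
  log_growth_exponent_nonneg : 0 <= beta;
  log_growth_le : forall s, Cmod (s - 1) < 1 -> Cmod (phi s) <= A * exp (beta * Cmod (Clog s))
}.

Lemma Cmod_RtoC_minus_1 (s : R) : 0 < s <= 1 -> Cmod (RtoC s - 1) = 1 - s.
Proof. intros Hs. rewrite <- RtoC_minus, Cmod_R, Rabs_minus_sym. apply Rabs_pos_eq. lra. Qed.

Lemma exp_opp_in_disc (t : R) : - ln 2 < t -> Cmod (RtoC (exp (- t)) - 1) < 1.
Proof.
  intros Ht. rewrite <- RtoC_minus, Cmod_R. pose proof (exp_pos (- t)).
  assert (exp (- t) < 2) by (rewrite <- (exp_ln 2) by lra; apply exp_increasing; lra).
  apply Rabs_def1; lra.
Qed.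

Lemma exp_opp_le_1 (t : R) : 0 <= t -> 0 < exp (- t) <= 1.
Proof. intros Ht. split; [apply exp_pos|]. rewrite <- exp_0. apply exp_le_compat. lra. Qed.

Lemma nonneg_gt_opp_ln_2 (t : R) : 0 <= t -> - ln 2 < t.
Proof. intros Ht. assert (0 < ln 2) by (rewrite <- ln_1; apply ln_increasing; lra). lra. Qed.

Section LogarithmicGrowth.

Variables (phi : C -> C) (A beta : R).
Hypothesis phi_growth : logarithmic_growth phi A beta.

Let phi_holomorphic : holomorphic_on phi (fun s => Cmod (s - 1) < 1) :=
  log_growth_holomorphic _ _ _ phi_growth.
Let A_nonneg : 0 <= A := log_growth_constant_nonneg _ _ _ phi_growth.
Let beta_nonneg : 0 <= beta := log_growth_exponent_nonneg _ _ _ phi_growth.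

Lemma log_growth_circle_le (s al t : R) : 0 < s <= 1 -> 0 < al < 1 ->
  Cmod (phi (RtoC s + circle (s * al) t))
    <= A * Rpower s (- beta) * exp (beta * Cmod (Clog (1 + circle al t))).
Proof.
  intros Hs Hal.
  assert (E : (RtoC s + circle (s * al) t)%C = (RtoC s * (1 + circle al t))%C)
    by (apply injective_projections; simpl; ring).
  assert (Hd : Cmod (RtoC s + circle (s * al) t - 1) < 1).
  { replace (RtoC s + circle (s * al) t - 1)%C with (RtoC s - 1 + circle (s * al) t)%C by ring.
    eapply Rle_lt_trans; [apply Cmod_triangle|]. rewrite Cmod_RtoC_minus_1, Cmod_circle by nra. nra. }
  eapply Rle_trans; [apply (log_growth_le _ _ _ phi_growth _ Hd)|].
  rewrite E, Clog_mult_RtoC; [|lra|apply Re_1_plus_circle_pos; lra].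
  unfold Rpower. rewrite Rmult_assoc, <- exp_plus.
  apply Rmult_le_compat_l, exp_le_compat; [exact A_nonneg|].
  replace (- beta * ln s) with (beta * - ln s) by ring. rewrite <- Rmult_plus_distr_l.
  apply Rmult_le_compat_l; [exact beta_nonneg|]. eapply Rle_trans; [apply Cmod_triangle|].
  assert (ln s <= 0) by (rewrite <- ln_1; apply ln_le; lra).
  rewrite Cmod_R, Rabs_left1 by assumption. lra.
Qed.

Lemma Cmod_C_derive_n_le (n : nat) (s al : R) : 0 < s <= 1 -> 0 < al < 1 ->
  s ^ n * Cmod (C_derive_n phi n (RtoC s)) <= derivative_bound A beta n al * Rpower s (- beta).
Proof.
  intros Hs Hal. pose proof PI_RGT_0.
  assert (Ps : 0 < s ^ n) by (apply pow_lt; lra). assert (Pa : 0 < al ^ n) by (apply pow_lt; lra).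
  replace (derivative_bound A beta n al * Rpower s (- beta))
    with (s ^ n * (INR (fact n) * (A * Rpower s (- beta) * (2 * PI * log_mean beta al) / (2 * PI)) /
      (s * al) ^ n)).
  2: { unfold derivative_bound. rewrite Rpow_mult_distr. field. lra. }
  apply Rmult_le_compat_l; [lra|]. eapply cauchy_estimate; [nra| | |].
  - intros y Hy. apply phi_holomorphic.
    pose proof (Cmod_minus_triangle y (RtoC s) 1) as T. rewrite Cmod_RtoC_minus_1 in T by exact Hs. nra.
  - intros t _. apply log_growth_circle_le; assumption.
  - apply (is_RInt_scal (V := R_NormedModule) (fun t => exp (beta * Cmod (Clog (1 + circle al t))))).
    apply log_mean_correct. lra.
Qed.

Definition scaled_derivative (n : nat) (t : R) : C :=
  (RtoC (exp (- (INR n * t))) * C_derive_n phi n (RtoC (exp (- t))))%C.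

Lemma is_derive_scaled_derivative (n : nat) (t : R) : - ln 2 < t ->
  is_derive_path (scaled_derivative n) t
    (- (1) * scaled_derivative (S n) t + - RtoC (INR n) * scaled_derivative n t)%C.
Proof.
  intros Ht. evar_last.
  - apply is_derive_path_mult.
    + apply (is_derive_path_RtoC (fun t => exp (- (INR n * t))) t (- (INR n * exp (- (INR n * t))))).
      auto_derive; [exact I|ring].
    + apply (is_derive_path_comp (C_derive_n phi n) (fun t => RtoC (exp (- t))) t).
      * apply (is_derive_C_derive_n phi 1 1 n _ phi_holomorphic), exp_opp_in_disc, Ht.
      * apply (is_derive_path_RtoC (fun t => exp (- t)) t (- exp (- t))). auto_derive; [exact I|ring].
  - unfold scaled_derivative.
    replace (- (INR (S n) * t)) with (- (INR n * t) + - t) by (rewrite S_INR; ring).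
    rewrite exp_plus, !RtoC_opp, !RtoC_mult. ring.
Qed.

Lemma scaled_derivative_0 (n : nat) : scaled_derivative n 0 = C_derive_n phi n 1.
Proof. unfold scaled_derivative. rewrite Rmult_0_r, Ropp_0, exp_0. apply Cmult_1_l. Qed.

Lemma scaled_derivative_exponential_type (n : nat) (al : R) : 0 < al < 1 ->
  exponential_type (scaled_derivative n) (derivative_bound A beta n al) beta.
Proof.
  intros Hal t Ht.
  split; [now eapply is_derive_path_continuous, is_derive_scaled_derivative, nonneg_gt_opp_ln_2|].
  pose proof (Cmod_C_derive_n_le n (exp (- t)) al (exp_opp_le_1 t Ht) Hal) as K.
  unfold scaled_derivative. rewrite Cmod_mult, Cmod_R, Rabs_pos_eq by apply Rlt_le, exp_pos.
  rewrite <- Rpower_pow in K by apply exp_pos. unfold Rpower in K. rewrite !ln_exp in K.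
  replace (INR n * - t) with (- (INR n * t)) in K by ring.
  now replace (- beta * - t) with (beta * t) in K by ring.
Qed.

Section FactorialExpansion.

Variable w : C.
Hypothesis Re_w_gt : beta < Re w.

Definition scaled_derivative_laplace (n : nat) : C := laplace_transform (scaled_derivative n) w.

Lemma scaled_derivative_laplace_le (n : nat) (al : R) : 0 < al < 1 ->
  Cmod (scaled_derivative_laplace n) <= derivative_bound A beta n al / (Re w - beta).
Proof.
  intros Hal.
  exact (Cmod_laplace_transform_le w beta Re_w_gt _ _ (scaled_derivative_exponential_type n al Hal)).
Qed.

Lemma scaled_derivative_laplace_rec (n : nat) :
  ((w + RtoC (INR n)) * scaled_derivative_laplace n + scaled_derivative_laplace (S n))%C
    = C_derive_n phi n 1.
Proof.
  assert (Hal : 0 < / 2 < 1) by lra.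
  pose proof (scaled_derivative_exponential_type n _ Hal) as type_n.
  pose proof (scaled_derivative_exponential_type (S n) _ Hal) as type_Sn.
  pose proof (laplace_transform_derive w beta Re_w_gt _ _ _ _
    (fun t Ht => is_derive_scaled_derivative n t (nonneg_gt_opp_ln_2 t Ht)) type_n
    (exponential_type_lincomb beta _ _ _ _ (- (1))%C (- RtoC (INR n))%C type_Sn type_n)) as E.
  rewrite (laplace_transform_lincomb w beta Re_w_gt _ _ _ _ _ _ type_Sn type_n) in E.
  rewrite scaled_derivative_0 in E.
  fold (scaled_derivative_laplace n) (scaled_derivative_laplace (S n)) in E.
  replace (C_derive_n phi n 1)
    with (w * scaled_derivative_laplace n - (w * scaled_derivative_laplace n - C_derive_n phi n 1))%C
    by ring.
  rewrite <- E. ring.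
Qed.

Definition factorial_term (n : nat) : C :=
  (RtoC ((-1) ^ n) * C_derive_n phi n 1 / pochhammer w (S n))%C.

Lemma factorial_expansion_remainder (N : nat) :
  (scaled_derivative_laplace 0 - csum factorial_term N)%C
  = (RtoC ((-1) ^ S N) * scaled_derivative_laplace (S N) / pochhammer w (S N))%C.
Proof.
  assert (Hw0 : 0 < Re w) by lra.
  induction N as [|N IH].
  - simpl csum. unfold factorial_term. rewrite <- scaled_derivative_laplace_rec.
    simpl pochhammer. simpl pow. rewrite Rmult_1_r, (RtoC_opp 1 : RtoC (-1) = _).
    change (INR 0) with 0. field.
    now apply Re_pos_neq_0.
  - replace (scaled_derivative_laplace 0 - csum factorial_term (S N))%C
      with (scaled_derivative_laplace 0 - csum factorial_term N - factorial_term (S N))%C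
        by (simpl; ring).
    rewrite IH. unfold factorial_term. rewrite <- scaled_derivative_laplace_rec.
    change (pochhammer w (S (S N))) with (pochhammer w (S N) * (w + RtoC (INR (S N))))%C.
    rewrite <- (tech_pow_Rmult (-1) (S N)), RtoC_mult, (RtoC_opp 1 : RtoC (-1) = _). field.
    split; [apply Re_pos_neq_0, Re_plus_INR_pos, Hw0|now apply pochhammer_neq_0].
Qed.

Lemma factorial_expansion_remainder_le (N : nat) (al : R) : 0 < al < 1 ->
  Cmod (scaled_derivative_laplace 0 - csum factorial_term N)
    <= derivative_bound A beta (S N) al / (Re w - beta) / Cmod (pochhammer w (S N)).
Proof.
  intros Hal. assert (Hp : pochhammer w (S N) <> 0) by (apply pochhammer_neq_0; lra).
  rewrite factorial_expansion_remainder, Cmod_div, Cmod_mult, Cmod_R, pow_1_abs, Rmult_1_l by exact Hp.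
  apply Rmult_le_compat_r; [|now apply scaled_derivative_laplace_le].
  now apply Rlt_le, Rinv_0_lt_compat, Cmod_gt_0.
Qed.

Lemma Cmod_factorial_term_le (n : nat) (al : R) : 0 < al < 1 ->
  Cmod (factorial_term n) <= derivative_bound A beta n al / Cmod (pochhammer w (S n)).
Proof.
  intros Hal. unfold factorial_term.
  assert (Hp : 0 < Cmod (pochhammer w (S n))) by (apply Cmod_pochhammer_gt_0; lra).
  rewrite Cmod_div, Cmod_mult, Cmod_R, pow_1_abs, Rmult_1_l by now apply Cmod_gt_0.
  apply Rmult_le_compat_r; [now apply Rlt_le, Rinv_0_lt_compat|].
  pose proof (Cmod_C_derive_n_le n 1 al ltac:(lra) Hal) as K.
  unfold Rpower in K. now rewrite pow1, ln_1, Rmult_0_r, exp_0, Rmult_1_l, Rmult_1_r in K.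
Qed.

Lemma derivative_bound_le_pochhammer_below_Re : 1 < Re w -> exists c M, 1 < c < Re w /\ 0 <= M /\
  forall n, exists al, 0 < al < 1 /\ derivative_bound A beta n al <= M * Cmod (pochhammer (RtoC c) n).
Proof.
  intros Hw1. pose proof (Rmax_l 1 beta). pose proof (Rmax_r 1 beta).
  pose proof (Rmax_lub_lt _ _ _ Hw1 Re_w_gt).
  destruct (derivative_bound_le_pochhammer A beta A_nonneg beta_nonneg ((Rmax 1 beta + Re w) / 2))
    as (M & HM & HMc); [lra|lra|].
  exists ((Rmax 1 beta + Re w) / 2), M. split; [lra|now split].
Qed.

Lemma ex_series_Cmod_factorial_term : 1 < Re w -> ex_series (fun n => Cmod (factorial_term n)).
Proof.
  intros Hw1. destruct (derivative_bound_le_pochhammer_below_Re Hw1) as (c & M & Hc & HM & Hb).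
  apply (ex_series_le (V := R_CompleteNormedModule) _
    (fun n => scal M (pochhammer_ratio c (Re w) n / (Re w + INR n)))).
  - intros n. destruct (Hb n) as (al & Hal & HMn). change (norm ?x) with (Rabs x).
    rewrite Rabs_pos_eq by apply Cmod_ge_0.
    eapply Rle_trans; [apply (Cmod_factorial_term_le n al Hal)|].
    eapply Rle_trans; [apply (div_Cmod_pochhammer_le _ _ w (S n) ltac:(lra) HMn)|].
    + apply Rmult_le_pos; [exact HM|apply Cmod_ge_0].
    + right. pose proof (pos_INR n).
      pose proof (Cmod_pochhammer_gt_0 (RtoC (Re w)) n ltac:(simpl; lra)).
      rewrite Cmod_pochhammer_RtoC_S by lra. unfold pochhammer_ratio, scal; simpl; unfold mult; simpl.
      field. lra.
  - apply (ex_series_scal (V := R_NormedModule)). eexists. apply is_series_pochhammer_ratio; lra.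
Qed.

Lemma is_series_factorial_term : 1 < Re w -> is_series_C factorial_term (scaled_derivative_laplace 0).
Proof.
  intros Hw1. destruct (derivative_bound_le_pochhammer_below_Re Hw1) as (c & M & Hc & HM & Hb).
  apply is_series_C_csum.
  apply (is_lim_seq_le_le (fun _ => 0) _
    (fun N => M / (Re w - beta) * pochhammer_ratio c (Re w) (S N))).
  - intros N. split; [apply Cmod_ge_0|]. destruct (Hb (S N)) as (al & Hal & HMn).
    eapply Rle_trans; [apply (factorial_expansion_remainder_le N al Hal)|].
    replace (M / (Re w - beta) * pochhammer_ratio c (Re w) (S N))
      with (M * Cmod (pochhammer (RtoC c) (S N)) / (Re w - beta)
        / Cmod (pochhammer (RtoC (Re w)) (S N)))
      by (unfold pochhammer_ratio, Rdiv; ring).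
    assert (Hi : 0 <= / (Re w - beta)) by (apply Rlt_le, Rinv_0_lt_compat; lra).
    apply div_Cmod_pochhammer_le; [lra|now apply Rmult_le_compat_r|].
    apply Rmult_le_pos; [|exact Hi]. apply Rmult_le_pos; [exact HM|apply Cmod_ge_0].
  - apply is_lim_seq_const.
  - replace (Finite 0) with (Rbar_mult (M / (Re w - beta)) 0) by (simpl; f_equal; ring).
    apply is_lim_seq_scal_l.
    apply (is_lim_seq_incr_1 (pochhammer_ratio c (Re w)) 0), is_lim_seq_pochhammer_ratio; lra.
Qed.

End FactorialExpansion.

End LogarithmicGrowth.

(** * Factorial series of the Borel sum *)

Section FactorialSeries.

Variables (a : nat -> C) (F : C -> C) (lam A B : R).
Hypothesis lam_pos : 0 < lam.
Hypothesis A_pos : 0 < A.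
Hypothesis B_pos : 0 < B.
Hypothesis F_holomorphic : holomorphic_on F (Delta_lam lam).
Hypothesis F_borel : exists r : R, 0 < r /\ forall zeta : C, Cmod zeta < r ->
  is_series_C (borel_term a zeta) (F zeta).
Hypothesis F_growth : forall zeta : C, Delta_lam lam zeta -> Cmod (F zeta) <= A * exp (B * Cmod zeta).

Definition disc_transform (s : C) : C := F (- RtoC lam * Clog s)%C.

Notation phi := disc_transform.

Lemma Delta_lam_Clog (s : C) : Cmod (s - 1) < 1 -> Delta_lam lam (- RtoC lam * Clog s)%C.
Proof. intros Hs. exists (- Clog s)%C. split; [now exists s|ring]. Qed.

Lemma disc_transform_logarithmic_growth : logarithmic_growth phi A (lam * B).
Proof.
  split; [|lra|nra|].
  - intros s Hs. destruct (F_holomorphic _ (Delta_lam_Clog s Hs)) as [l Hl].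
    assert (Hs0 : 0 < Re s).
    { replace s with (1 + (s - 1))%C by ring. now apply Re_1_plus_pos. }
    eexists. apply (is_derive_C_comp F (fun y => - RtoC lam * Clog y)%C s); [exact Hl|].
    apply is_derive_C_scal. now apply is_derive_C_Clog.
  - intros s Hs. eapply Rle_trans; [apply F_growth, Delta_lam_Clog, Hs|].
    rewrite Cmod_mult, Cmod_opp, Cmod_R, Rabs_pos_eq by lra. right. do 2 f_equal. ring.
Qed.

Lemma scaled_derivative_disc_transform_0 (t : R) : scaled_derivative phi 0 t = F (RtoC (lam * t)).
Proof.
  unfold scaled_derivative, disc_transform. simpl C_derive_n. simpl INR.
  rewrite Rmult_0_l, Ropp_0, exp_0, Cmult_1_l, Clog_RtoC, ln_exp, RtoC_opp, RtoC_mult by apply exp_pos.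
  f_equal. ring.
Qed.

Lemma C_derive_n_disc_transform (n : nat) :
  C_derive_n phi n 1 = stirling_sum n (fun k => RtoC ((-1) ^ k) * (RtoC (lam ^ k) * a (S k)))%C.
Proof.
  destruct F_borel as (r & Hr & HF). set (f := fun t => F (RtoC (lam * t))).
  set (r' := Rmin (r / lam) (ln 2)).
  assert (Hr' : 0 < r').
  { apply Rmin_pos; [now apply Rdiv_lt_0_compat|]. rewrite <- ln_1. apply ln_increasing; lra. }
  assert (Hf : forall t, Rabs t < r' ->
    is_series_C (fun n => RtoC (lam ^ n) * a (S n) * RtoC t ^ n / RtoC (INR (fact n)))%C (f t)).
  { intros t Ht%Rmin_Rgt_l. destruct Ht as [Ht _]. apply Rlt_div_r in Ht; [|exact lam_pos].
    eapply is_series_ext; [|apply (HF (RtoC (lam * t)))].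
    - intros m. unfold borel_term. rewrite <- !RtoC_pow, Rpow_mult_distr, RtoC_mult.
      unfold Cdiv. change (?x = ?y) with (@eq C x y). ring.
    - rewrite Cmod_R, Rabs_mult, (Rabs_pos_eq lam); lra. }
  rewrite <- scaled_derivative_0.
  rewrite (scaled_derivatives_stirling_sum (path_derive_n f) (scaled_derivative phi) r').
  - apply csum_ext. intros k _. do 2 f_equal.
    exact (path_derive_n_0 _ f r' Hf k Hr').
  - intros k t Ht. exact (is_derive_path_derive_n _ f r' Hf k t Ht).
  - intros m t Ht%Rmin_Rgt_l.
    apply (is_derive_scaled_derivative _ _ _ disc_transform_logarithmic_growth).
    destruct Ht as [_ Ht]. apply Rabs_def2 in Ht. lra.
  - intros t _. rewrite scaled_derivative_disc_transform_0. now apply injective_projections.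
  - now rewrite Rabs_R0.
Qed.

Lemma b_lam_C_derive_n (n : nat) :
  b_lam lam a n = (RtoC ((-1) ^ n) / RtoC (INR (fact n)) * C_derive_n phi n 1)%C.
Proof.
  rewrite C_derive_n_disc_transform. unfold b_lam, Cdiv.
  rewrite (Cmult_comm (RtoC _) (/ _)), <- Cmult_assoc.
  f_equal. unfold stirling_sum. rewrite <- csum_scal. apply csum_ext. intros k Hk.
  assert (E : (-1) ^ n * (-1) ^ k = (-1) ^ (n - k)).
  { replace n with (n - k + k)%nat at 1 by lia.
    rewrite pow_add, Rmult_assoc, <- Rpow_mult_distr. replace (-1 * -1) with 1 by ring.
    rewrite pow1. ring. }
  rewrite <- E, !RtoC_mult. ring.
Qed.

Section BorelSum.

Variable z : C.
Hypothesis Re_z_gt : B < Re z.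

Let w : C := (RtoC lam * z)%C.

Lemma Re_dilated_gt : lam * B < Re w.
Proof. unfold w. rewrite re_scal_l. now apply Rmult_lt_compat_l. Qed.

Lemma fact_term_disc_transform (n : nat) : fact_term lam a z n = (RtoC lam * factorial_term phi w n)%C.
Proof.
  assert (Hw : 0 < Re w) by (pose proof Re_dilated_gt; nra).
  unfold fact_term, factorial_term. fold w. rewrite b_lam_C_derive_n.
  replace (RtoC lam * (Cgamma w * Cgamma (RtoC (INR (S n))) *
     (RtoC ((-1) ^ n) / RtoC (INR (fact n)) * C_derive_n phi n 1)) / Cgamma (w + RtoC (INR (S n))))%C
   with (RtoC lam * (RtoC ((-1) ^ n) / RtoC (INR (fact n)) * C_derive_n phi n 1) *
     (Cgamma w * Cgamma (RtoC (INR (S n))) / Cgamma (w + RtoC (INR (S n)))))%C by (unfold Cdiv; ring).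
  rewrite Cgamma_ratio by exact Hw. field.
  split; [now apply pochhammer_neq_0|]. intros E%RtoC_inj. now apply (INR_fact_neq_0 n).
Qed.

Lemma is_RInt_gen_laplace_integrand :
  is_RInt_gen_C (laplace_integrand F z) (at_point 0) (Rbar_locally p_infty)
    (RtoC lam * scaled_derivative_laplace phi w 0)%C.
Proof.
  assert (Hil : 0 < / lam) by now apply Rinv_0_lt_compat.
  assert (Hal : 0 < / 2 < 1) by lra.
  pose proof (scaled_derivative_exponential_type _ _ _ disc_transform_logarithmic_growth 0
    (/ 2) Hal) as Ht.
  eapply is_RInt_gen_C_ext;
    [|apply is_RInt_gen_C_scal, (is_RInt_gen_dilation (V := C_R_NormedModule) _ (/ lam) _ Hil
        (laplace_transform_correct w (lam * B) Re_dilated_gt _ _ Ht))].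
  intros t. cbv beta. rewrite scal_R_Cmult, scaled_derivative_disc_transform_0.
  unfold laplace_integrand, w.
  rewrite <- Rmult_assoc, Rinv_r, Rmult_1_l by lra.
  replace (RtoC lam * z * RtoC (/ lam * t))%C with (z * RtoC t)%C.
  - rewrite RtoC_inv by lra. field. intros E%RtoC_inj. lra.
  - rewrite RtoC_mult, RtoC_inv by lra. field. intros E%RtoC_inj. lra.
Qed.

Lemma borel_sum_disc_transform : borel_sum a F z
  = (a O + RtoC lam * scaled_derivative_laplace phi w 0)%C.
Proof.
  unfold borel_sum. f_equal.
  exact (is_RInt_gen_unique (V := C_R_CompleteNormedModule) _ _ is_RInt_gen_laplace_integrand).
Qed.

Lemma R_fact_pochhammer (N : nat) :
  R_fact lam A B N z =
    lam * (A * (INR (fact (S N)) * Rpower (INR (S N) + lam * B) (INR (S N) + lam * B)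
        / (INR (S N) ^ S N * Rpower (lam * B) (lam * B)))
      / (Re w - lam * B) / Cmod (pochhammer w (S N))).
Proof.
  pose proof Re_dilated_gt as Hw. assert (Hw0 : 0 < Re w) by nra.
  assert (HzB : RtoC (Re z - B) <> 0) by (intros E%RtoC_inj; lra).
  assert (Hp : pochhammer w (S N) <> 0) by now apply pochhammer_neq_0.
  unfold R_fact. fold w.
  replace (Cgamma w * Cgamma (RtoC (INR (S N))) / (Cgamma (w + RtoC (INR (S N))) * RtoC (Re z - B)))%C
    with (RtoC (INR (fact N)) / pochhammer w (S N) / RtoC (Re z - B))%C.
  2: { rewrite <- (Cgamma_ratio w N Hw0). field. split; [exact HzB|].
       apply Cgamma_neq_0, Re_plus_INR_pos, Hw0. }
  rewrite !Cmod_div, !Cmod_R, (Rabs_pos_eq (INR _)), (Rabs_pos_eq (Re z - B))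
    by (assumption || apply pos_INR || lra).
  replace (INR N + lam * B + 1) with (INR (S N) + lam * B) by (rewrite S_INR; ring).
  replace (Re w - lam * B) with (lam * (Re z - B)) by (unfold w; rewrite re_scal_l; ring).
  rewrite fact_simpl, mult_INR, <- S_INR, <- (tech_pow_Rmult (INR (S N))).
  assert (0 < Cmod (pochhammer w (S N))) by now apply Cmod_gt_0.
  assert (0 < INR (S N)) by apply lt_0_INR, Nat.lt_0_succ.
  assert (0 < INR (S N) ^ N) by now apply pow_lt.
  assert (0 < Rpower (lam * B) (lam * B)) by apply exp_pos.
  field. lra.
Qed.

Lemma Cmod_borel_sum_remainder_le (N : nat) :
  Cmod (borel_sum a F z - (a O + csum (fact_term lam a z) N)) <= R_fact lam A B N z.
Proof.
  assert (Hb : 0 < lam * B) by now apply Rmult_lt_0_compat.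
  set (n := INR (S N)). assert (Hn : 0 < n) by apply lt_0_INR, Nat.lt_0_succ.
  assert (Hal : 0 < n / (n + lam * B) < 1).
  { split; [apply Rdiv_lt_0_compat; lra|]. apply Rlt_div_l; lra. }
  assert (E : csum (fact_term lam a z) N = (RtoC lam * csum (factorial_term phi w) N)%C).
  { rewrite <- csum_scal. apply csum_ext. intros k _. apply fact_term_disc_transform. }
  rewrite borel_sum_disc_transform, E, R_fact_pochhammer.
  replace (a O + RtoC lam * scaled_derivative_laplace phi w 0
    - (a O + RtoC lam * csum (factorial_term phi w) N))%C
    with (RtoC lam * (scaled_derivative_laplace phi w 0 - csum (factorial_term phi w) N))%C by ring.
  rewrite Cmod_mult, Cmod_R, Rabs_pos_eq by lra. apply Rmult_le_compat_l; [lra|].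
  eapply Rle_trans;
    [exact (factorial_expansion_remainder_le _ _ _ disc_transform_logarithmic_growth w Re_dilated_gt
      N _ Hal)|].
  assert (Hw := Re_dilated_gt).
  apply Rmult_le_compat_r; [apply Rlt_le, Rinv_0_lt_compat, Cmod_pochhammer_gt_0; lra|].
  apply Rmult_le_compat_r; [apply Rlt_le, Rinv_0_lt_compat; lra|].
  apply derivative_bound_optimal; [lra|apply Nat.lt_0_succ|exact Hb].
Qed.

Lemma Re_dilated_gt_1 : / lam < Re z -> 1 < Re w.
Proof.
  intros Hzl. unfold w. rewrite re_scal_l, <- (Rinv_r lam) by lra. now apply Rmult_lt_compat_l.
Qed.

Lemma ex_series_Cmod_fact_term : / lam < Re z -> ex_series (fun n => Cmod (fact_term lam a z n)).
Proof.
  intros Hw1%Re_dilated_gt_1.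
  eapply ex_series_ext; [|apply (ex_series_scal (V := R_NormedModule) lam),
    (ex_series_Cmod_factorial_term _ _ _ disc_transform_logarithmic_growth w Re_dilated_gt Hw1)].
  intros n. rewrite fact_term_disc_transform, Cmod_mult, Cmod_R, Rabs_pos_eq by lra. reflexivity.
Qed.

Lemma is_series_fact_term : / lam < Re z ->
  is_series_C (fact_term lam a z) (borel_sum a F z - a O)%C.
Proof.
  intros Hw1%Re_dilated_gt_1. rewrite borel_sum_disc_transform.
  replace (a O + RtoC lam * scaled_derivative_laplace phi w 0 - a O)%C
    with (RtoC lam * scaled_derivative_laplace phi w 0)%C by ring.
  eapply is_series_ext; [intros n; symmetry; apply fact_term_disc_transform|].
  apply (is_series_scal (V := C_NormedModule) (RtoC lam)).
  exact (is_series_factorial_term _ _ _ disc_transform_logarithmic_growth w Re_dilated_gt Hw1).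
Qed.

End BorelSum.

End FactorialSeries.

Theorem theorem3p2 (a : nat -> C) (F : C -> C) (lam A B : R) :
  Gevrey1 a ->
  0 < lam -> 0 < A -> 0 < B ->
  (* F is holomorphic on Delta_lambda *)
  (forall zeta : C, Delta_lam lam zeta -> @ex_derive C_AbsRing C_NormedModule F zeta) ->
  (* F extends the Borel transform (agrees with its series near 0) *)
  (exists r : R, 0 < r /\ forall zeta : C, Cmod zeta < r ->
      @is_series C_AbsRing C_NormedModule (borel_term a zeta) (F zeta)) ->
  (* exponential bound on Delta_lambda *)
  (forall zeta : C, Delta_lam lam zeta -> Cmod (F zeta) <= A * exp (B * Cmod zeta)) ->
  (* (i) *)
  (forall z : C, Rmax B (/ lam) < Re z ->
     @ex_RInt_gen C_R_NormedModule (laplace_integrand F z) (at_point 0) (Rbar_locally p_infty)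
     /\ ex_series (fun n => Cmod (fact_term lam a z n))
     /\ @is_series C_AbsRing C_NormedModule (fact_term lam a z) (borel_sum a F z - a O)%C)
  /\
  (* (ii) *)
  (forall (N : nat) (z : C), B < Re z ->
     @ex_RInt_gen C_R_NormedModule (laplace_integrand F z) (at_point 0) (Rbar_locally p_infty)
     /\ Cmod (borel_sum a F z - (a O + csum (fact_term lam a z) N))%C
          <= R_fact lam A B N z).
Proof.
  intros _ Hlam HA HB HF Hborel HFle. split.
  - intros z Hz.
    assert (HzB : B < Re z) by (eapply Rle_lt_trans; [apply Rmax_l|exact Hz]).
    assert (Hzl : / lam < Re z) by (eapply Rle_lt_trans; [apply Rmax_r|exact Hz]).
    repeat split.
    + eexists. now apply (is_RInt_gen_laplace_integrand F lam A B).
    + now apply (ex_series_Cmod_fact_term a F lam A B).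
    + now apply (is_series_fact_term a F lam A B).
  - intros N z Hz. split.
    + eexists. now apply (is_RInt_gen_laplace_integrand F lam A B).
    + now apply Cmod_borel_sum_remainder_le.
Qed.
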